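(* (1) $\Pi_{\ell^1}$ is compact. (2) $\Pi_{\ell^1}(X)$ is dense in $\Pi_{\ell^1}$. (3) The following are equivalent: (a) $\Pi_{\ell^1}(\mathrm{Per}(\sigma))=\Pi_{\ell^1}$; (b) $\mathrm{Per}(\sigma)=X$. (4) The following are equivalent: (a) $\Pi_{\ell^1}(\mathrm{Per}(\sigma))$ is dense in $\Pi_{\ell^1}$; (b) $\mathrm{Per}(\sigma)$ is dense in $X$. (5) The following are equivalent: (a) $\Pi_{\ell^1}(\infty)=\Pi_{\ell^1}$; (b) $\mathrm{Aper}(\sigma)=X$. (6) The following are equivalent: (a) $\Pi_{\ell^1}(\mathrm{Aper}(\sigma))$ is dense in $\Pi_{\ell^1}$; (b) $\Pi_{\ell^1}(\infty)$ is dense in $\Pi_{\ell^1}$; (c) $\mathrm{Aper}(\sigma)$ is dense in $X$. (7) (a) For all $\overline{\mathfrak{o}}\in\overline{\mathfrak{O}}_{\mathrm{Per}(\sigma)}$ and $\lambda\in\mathbb{T}$, the singleton $\{P_{\overline{\mathfrak{o}},\lambda}\}$ is closed in $\Pi_{\ell^1}$. (b) For all $\overline{\mathfrak{o}}\in\overline{\mathfrak{O}}_{\mathrm{Aper}(\sigma)}$, the singleton $\{P_{\overline{\mathfrak{o}}}\}$ is closed in $\Pi_{\ell^1}(X)$ if and only if $\overline{\mathfrak{o}}$ is a minimal orbit closure. (8) If, for every infinite dimensional algebraically irreducible representation $\pi$ of $\ell^1(\Sigma)$, the closed subset $X_\pi$ of $X$ is metrizable (this is certainly the case if $X$ is metrizable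 or $X=\mathrm{Per}(\sigma)$), then: (a) $\Pi_{\ell^1}(X)=\Pi_{\ell^1}$, and $\Pi_{\ell^1}(X)$ is compact; (b) if $P\in\Pi_{\ell^1}$, then the singleton $\{P\}$ is closed in $\Pi_{\ell^1}$ if and only if $P$ is associated with a minimal orbit closure.
   Context: $X$ is a non-empty compact Hausdorff space, $\sigma:X\to X$ is a homeomorphism, $\Sigma=(X,\sigma)$, and $\mathbb{Z}$ acts on $X$ via $n\mapsto\sigma^n$. $\mathrm{Per}(\sigma)$ and $\mathrm{Aper}(\sigma)$ are the sets of points with finite, respectively infinite, orbit. $\overline{\mathfrak{O}}_{\mathrm{Per}(\sigma)}$ (resp. $\overline{\mathfrak{O}}_{\mathrm{Aper}(\sigma)}$) is the set of closures $\overline{\mathfrak{o}}$ of orbits $\mathfrak{o}$ of points in $\mathrm{Per}(\sigma)$ (resp. $\mathrm{Aper}(\sigma)$). A minimal orbit closure is a minimal element, under inclusion, of the set of all closures of orbits in $X$. $\mathbb{T}$ is the unit circle in $\mathbb{C}$. $C(X)$ carries the supremum norm and $\alpha(f)=f\circ\sigma^{-1}$. $\ell^1(\Sigma)$ is the Banach space of all $a:\mathbb{Z}\to C(X)$ with $\|a\|=\sum_n\|a(n)\|<\infty$, with multiplication $(aa')(n)=\sum_{k\in\mathbb{Z}}a(k)\,\alpha^k(a'(n-k))$. Elements are written $a=\sum_nf_n\delta^n$ with $f_n=a(n)$, where $\delta(1)=1$ and $\delta(m)=0$ for $m\ne1$; $C(X)$ embeds via $f\mapsto f\delta^0$. A representation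 of an algebra $A$ on a complex vector space $E$ is algebraically irreducible if $\pi(A)E\ne\{0\}$ and the only invariant subspaces are $\{0\}$ and $E$; a primitive ideal is the kernel of such a representation. For an algebraically irreducible representation $\pi$ of $\ell^1(\Sigma)$ on $E$, there is a Banach space norm on $E$ making $\pi$ a continuous representation by bounded operators; hence $\{f\in C(X):\pi(f)=0\}$ is a proper closed $\alpha$-invariant ideal of $C(X)$, and $X_\pi$ is the unique closed subset of $X$ (non-empty and $\sigma$-invariant) such that $\{f\in C(X):\pi(f)=0\}=\{f\in C(X):f|_{X_\pi}=0\}$. For $x\in\mathrm{Per}(\sigma)$ of period $p$ with orbit $\mathfrak{o}=\overline{\mathfrak{o}}$, and $\lambda\in\mathbb{T}$, $P_{\overline{\mathfrak{o}},\lambda}$ is the kernel of the algebraically irreducible representation $\pi_{x,\lambda}$ on $\mathbb{C}^p$ (basis $e_0,\dots,e_{p-1}$) given by $\pi_{x,\lambda}(f)e_j=f(\sigma^jx)e_j$ for $f\in C(X)$, $\pi_{x,\lambda}(\delta)e_j=e_{j+1}$ for $0\le j\le p-2$, $\pi_{x,\lambda}(\delta)e_{p-1}=\lambda e_0$; it depends only on $\overline{\mathfrak{o}}$ and $\lambda$. For $x\in\mathrm{Aper}(\sigma)$ with orbit closure $\overline{\mathfrak{o}}$, $P_{\overline{\mathfrak{o}}}$ is the kernel of the algebraically irreducible contractive representation $\pi_x^1$ on $\ell^1(\mathbb{Z})$ with $\pi_x^1(f)e_k=f(\sigma^kx)e_k$, $\pi_x^1(\delta)e_k=e_{k+1}$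 ($k\in\mathbb{Z}$); it depends only on $\overline{\mathfrak{o}}$ and equals $\{\sum_nf_n\delta^n:f_n|_{\overline{\mathfrak{o}}}=0\ \forall n\}$. The ideals $P_{\overline{\mathfrak{o}},\lambda}$ and $P_{\overline{\mathfrak{o}}}$ are said to be associated with the orbit closure $\overline{\mathfrak{o}}$. $\Pi_{\ell^1}$ is the set of all primitive ideals of $\ell^1(\Sigma)$; $\Pi_{\ell^1}(\infty)$ is the set of kernels of infinite dimensional algebraically irreducible representations; $\Pi_{\ell^1}(\mathrm{Per}(\sigma))$ is the set of all $P_{\overline{\mathfrak{o}},\lambda}$ with $\overline{\mathfrak{o}}\in\overline{\mathfrak{O}}_{\mathrm{Per}(\sigma)}$, $\lambda\in\mathbb{T}$; $\Pi_{\ell^1}(\mathrm{Aper}(\sigma))$ is the set of all $P_{\overline{\mathfrak{o}}}$ with $\overline{\mathfrak{o}}\in\overline{\mathfrak{O}}_{\mathrm{Aper}(\sigma)}$; $\Pi_{\ell^1}(X)=\Pi_{\ell^1}(\mathrm{Per}(\sigma))\cup\Pi_{\ell^1}(\mathrm{Aper}(\sigma))$. $\Pi_{\ell^1}$ carries the hull-kernel topology: the closure of $E\subset\Pi_{\ell^1}$ is $\{P\in\Pi_{\ell^1}:P\supset\bigcap_{Q\in E}Q\}$ (the intersection over the empty set being $\ell^1(\Sigma)$). Subsets of $\Pi_{\ell^1}$ carry the induced topologies. Compactness does not include the Hausdorff property. *)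

(* Defs.v *)
From HB Require Import structures.
From mathcomp Require Import all_boot all_order all_algebra.
From mathcomp Require Import all_classical all_reals all_analysis.
From mathcomp Require Import complex ring.

Set Implicit Arguments.
Unset Strict Implicit.
Unset Printing Implicit Defensive.

Import Order.TTheory GRing.Theory Num.Theory.
Import numFieldNormedType.Exports.

Local Open Scope classical_set_scope.
Local Open Scope ring_scope.

Section ComplexNumbers.
Variable R : realType.
Local Notation C := (R[i]%type)^o.

Lemma gt0_complexP (e : R[i]) : 0 < e -> exists2 r : R, 0 < r & e = r%:C%C.
Proof.
move=> e0; have er : (complex.Re e)%:C%C = e by rewrite RRe_real ?gtr0_real.
by exists (complex.Re e); rewrite // -ltcR er.
Qed.

Definition real_norm (V : normedZmodType R[i]) (v : V) : R := complex.Re `|v|.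

Lemma real_normK (V : normedZmodType R[i]) (v : V) : (real_norm v)%:C%C = `|v|.
Proof. by rewrite RRe_real ?normr_real. Qed.

Lemma real_norm_ge0 (V : normedZmodType R[i]) (v : V) : 0 <= real_norm v.
Proof. by rewrite -lecR real_normK; exact: normr_ge0. Qed.

Lemma normc_ge_Im (z : C) : `|complex.Im z|%:C%C <= `|z|.
Proof.
rewrite normc_def lecR -sqrtr_sqr ler_wsqrtr //.
by rewrite lerDr sqr_ge0.
Qed.

Lemma normc_le_ReIm (z : C) :
  `|z| <= `|complex.Re z|%:C%C + `|complex.Im z|%:C%C.
Proof.
rewrite {1}(_ : z = (complex.Re z)%:C%C + 'i%C * (complex.Im z)%:C%C); last first.
  exact: complexE.
rewrite (le_trans (ler_normD _ _)) // lerD //.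
  by rewrite normc_def /= expr0n addr0 sqrtr_sqr.
by rewrite normrM !normc_def /= !expr0n /= add0r addr0 expr1n sqrtr1 mul1r sqrtr_sqr.
Qed.

Lemma complex_complete (F : set_system C) :
  ProperFilter F -> cauchy F -> cvg F.
Proof.
move=> FF /cauchyP Fc.
have Rc (h : C -> R) : (forall z w : C, `|h z - h w|%:C%C <= `|z - w|) ->
    cvg (h @ F).
  move=> hP; apply: cauchy_cvg; apply/cauchy_exP => e e0.
  have [|z zF] := Fc e%:C%C; first by rewrite ltcR.
  exists (h z); rewrite /fmapE /=; near do rewrite -ball_normE /=.
  apply: filterS zF => w; rewrite -!ball_normE /= => zw.
  by rewrite -ltcR (le_lt_trans _ zw) //.
have /cvg_ex[a ha] : cvg ((@complex.Re R : C -> R) @ F).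
  apply: Rc => z w; rewrite (_ : _ - _ = complex.Re (z - w)) ?normc_ge_Re //.
  by case: z w => [? ?] [? ?].
have /cvg_ex[b hb] : cvg ((@complex.Im R : C -> R) @ F).
  apply: Rc => z w; rewrite (_ : _ - _ = complex.Im (z - w)) ?normc_ge_Im //.
  by case: z w => [? ?] [? ?].
apply/cvg_ex; exists (Complex a b); apply/cvgrPdist_lt => e.
move=> /gt0_complexP[r r0 ->].
have r20 : 0 < r / 2 by rewrite divr_gt0.
near=> z.
apply: le_lt_trans (normc_le_ReIm _) _.
rewrite -rmorphD ltcR [r]splitr ltrD //=.
  rewrite (_ : complex.Re _ = a - complex.Re z); last by case: (z).
  by near: z; move/cvgrPdist_lt : ha => /(_ _ r20); apply.
rewrite (_ : complex.Im _ = b - complex.Im z); last by case: (z).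
by near: z; move/cvgrPdist_lt : hb => /(_ _ r20); apply.
Unshelve. all: by end_near. Qed.

End ComplexNumbers.

Record dynamical_system := DynamicalSystem {
  space :> topologicalType;
  space_compact : compact [set: space];
  space_hausdorff : hausdorff_space space;
  space_nonempty : [set: space] !=set0;
  shift_map : space -> space;
  shift_inv : space -> space;
  shift_mapK : cancel shift_map shift_inv;
  shift_invK : cancel shift_inv shift_map;
  shift_map_continuous : continuous shift_map;
  shift_inv_continuous : continuous shift_inv }.

Section Dynamics.
Variable S : dynamical_system.

(* The action n |-> shift_map ^ n of the integers. *)
Definition act (n : int) : S -> S :=
  match n with
  | Posz m => iter m (@shift_map S)
  | Negz m => iter m.+1 (@shift_inv S)
  end.

Lemma act_continuous n : continuous (act n).
Proof.
have itc (f : S -> S) m : continuous f -> continuous (iter m f).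
  move=> fc; elim: m => [|m IH] x; first exact: cvg_id.
  exact: (@continuous_comp _ _ _ (iter m f) f x (IH x) (fc _)).
by case: n => m; apply: itc;
  [exact: shift_map_continuous | exact: shift_inv_continuous].
Qed.

Definition orbit (x : S) : set S := range (act^~ x).
Definition per : set S := [set x | finite_set (orbit x)].
Definition aper : set S := [set x | infinite_set (orbit x)].

End Dynamics.
Arguments per S _ : clear implicits.
Arguments aper S _ : clear implicits.

Section ContinuousFunctions.
Variables (R : realType) (S : dynamical_system).
Local Notation C := (R[i]%type)^o.

Definition cfun := continuousType S C.
HB.instance Definition _ := gen_eqMixin cfun.
HB.instance Definition _ := gen_choiceMixin cfun.
Implicit Types f g h : cfun.

Lemma cfunP f g : f =1 g -> f = g.
Proof. by move/continuousEP. Qed.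

Definition cfun_of (f : S -> C) (fc : continuous f) : cfun := mkcts fc.

Lemma cst_continuousC (c : C) : continuous (fun _ : S => c).
Proof. by move=> x; exact: cvg_cst. Qed.
Lemma addf_continuous f g : continuous (fun x : S => f x + g x : C).
Proof. by move=> x; apply: cvgD; exact: cts_fun. Qed.
Lemma oppf_continuous f : continuous (fun x : S => - f x : C).
Proof. by move=> x; apply: cvgN; exact: cts_fun. Qed.
Lemma scalef_continuous (c : R[i]) f : continuous (fun x : S => c *: f x : C).
Proof. by move=> x; apply: cvgZr; exact: cts_fun. Qed.
Lemma mulf_continuous f g : continuous (fun x : S => f x * g x : C).
Proof.
by move=> x; apply: (@cvgZ _ C S _ _ f g); exact: cts_fun.
Qed.

Definition cfun_cst c := cfun_of (@cst_continuousC c).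
Definition cfun_add f g := cfun_of (@addf_continuous f g).
Definition cfun_opp f := cfun_of (@oppf_continuous f).
Definition cfun_scale c f := cfun_of (@scalef_continuous c f).
Definition cfun_mul f g := cfun_of (@mulf_continuous f g).

Fact cfun_addA : associative cfun_add.
Proof. by move=> f g h; apply/cfunP => x /=; rewrite /mkcts addrA. Qed.
Fact cfun_addC : commutative cfun_add.
Proof. by move=> f g; apply/cfunP => x /=; rewrite /mkcts addrC. Qed.
Fact cfun_add0 : left_id (cfun_cst 0) cfun_add.
Proof. by move=> f; apply/cfunP => x /=; rewrite /mkcts add0r. Qed.
Fact cfun_addN : left_inverse (cfun_cst 0) cfun_opp cfun_add.
Proof. by move=> f; apply/cfunP => x /=; rewrite /mkcts addNr. Qed.
HB.instance Definition _ :=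
  GRing.isZmodule.Build cfun cfun_addA cfun_addC cfun_add0 cfun_addN.

Fact cfun_scaleA c d f : cfun_scale c (cfun_scale d f) = cfun_scale (c * d) f.
Proof. by apply/cfunP => x /=; rewrite /mkcts scalerA. Qed.
Fact cfun_scale1 : left_id 1 cfun_scale.
Proof. by move=> f; apply/cfunP => x /=; rewrite /mkcts scale1r. Qed.
Fact cfun_scaleDr : right_distributive cfun_scale +%R.
Proof. by move=> c f g; apply/cfunP => x /=; rewrite /mkcts scalerDr. Qed.
Fact cfun_scaleDl f : {morph cfun_scale^~ f : c d / c + d}.
Proof. by move=> c d; apply/cfunP => x /=; rewrite /mkcts scalerDl. Qed.
HB.instance Definition _ := GRing.Zmodule_isLmodule.Build R[i] cfun
  cfun_scaleA cfun_scale1 cfun_scaleDr cfun_scaleDl.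

Definition sup_norm f : R := sup (range (fun x => real_norm (f x))).

Lemma sup_norm_has_sup f : has_sup (range (fun x => real_norm (f x))).
Proof.
have [x0 _] := @space_nonempty S; split; first by exists (real_norm (f x0)), x0.
have cn : continuous (fun x : S => real_norm (f x)).
  move=> x; apply/cvgrPdist_lt => e e0.
  have fx : f y @[y --> x] --> f x by exact: cts_fun.
  have ec : 0 < e%:C%C :> R[i] by rewrite ltcR.
  move/cvgrPdist_lt : fx => /(_ _ ec); apply: filterS => y.
  rewrite -ltcR; apply: le_lt_trans.
  have -> : real_norm (f x) - real_norm (f y) = complex.Re (`|f x| - `|f y|).
    by rewrite /real_norm; case: `|f x| `|f y| => [? ?] [? ?].
  exact: le_trans (normc_ge_Re _) (ler_dist_dist _ _).
have [M MP] : has_ubound (range (fun x => real_norm (f x))).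
  have := continuous_compact (continuous_subspaceT cn) (@space_compact S).
  move=> /compact_bounded [M [_ MP]]; exists (M + 1) => _ [x _ <-].
  apply: le_trans (ler_norm _) _; apply: (MP (M + 1)); first by rewrite ltrDl.
  by exists x.
by exists M.
Qed.

Lemma sup_norm_ge f x : `|f x| <= (sup_norm f)%:C%C.
Proof.
rewrite -real_normK lecR; apply: sup_upper_bound; first exact: sup_norm_has_sup.
by exists x.
Qed.

Lemma sup_norm_le f (r : R) :
  (forall x, `|f x| <= r%:C%C) -> sup_norm f <= r.
Proof.
move=> fr; apply: ge_sup; first by case: (sup_norm_has_sup f).
by move=> _ [x _ <-]; rewrite -lecR real_normK.
Qed.

Lemma sup_norm_ge0 f : 0 <= sup_norm f.
Proof.
have [x0 _] := @space_nonempty S.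
by rewrite -lecR (le_trans _ (sup_norm_ge f x0)).
Qed.

Fact sup_normD f g :
  (sup_norm (f + g))%:C%C <= (sup_norm f)%:C%C + (sup_norm g)%:C%C :> R[i].
Proof.
rewrite -rmorphD lecR; apply: sup_norm_le => x.
by rewrite rmorphD /= (le_trans (ler_normD _ _)) // lerD // sup_norm_ge.
Qed.

Fact sup_norm_eq0 f : (sup_norm f)%:C%C = 0 :> R[i] -> f = 0.
Proof.
move=> f0; apply/cfunP => x; apply/normr0_eq0/eqP.
by rewrite eq_le normr_ge0 andbT -f0 sup_norm_ge.
Qed.

Fact sup_normZ (c : R[i]) f :
  (sup_norm (c *: f))%:C%C = `|c| * (sup_norm f)%:C%C.
Proof.
have leZ d h : (sup_norm (d *: h))%:C%C <= `|d| * (sup_norm h)%:C%C.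
  have [r rE] : exists r : R, r%:C%C = `|d|.
    by exists (@real_norm _ C d); exact: (@real_normK _ C).
  rewrite -rE -rmorphM lecR; apply: sup_norm_le => x.
  by rewrite rmorphM /= rE normrM ler_wpM2l // sup_norm_ge.
apply/eqP; rewrite eq_le leZ /=.
have [->|c0] := eqVneq c 0; first by rewrite normr0 mul0r lecR sup_norm_ge0.
rewrite -ler_pdivlMl ?normr_gt0 // -normfV.
by rewrite -[X in sup_norm X](scale1r f) -(mulVf c0) -scalerA leZ.
Qed.

HB.instance Definition _ := @Lmodule_isNormed.Build R[i] cfun
  (fun f => (sup_norm f)%:C%C) sup_normD sup_normZ sup_norm_eq0.

Lemma cfun_normE f : `|f| = (sup_norm f)%:C%C. Proof. by []. Qed.

End ContinuousFunctions.

Section ContinuousFunctionsComplete.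
Variables (R : realType) (S : dynamical_system).
Local Notation C := (R[i]%type)^o.
Local Notation cfun := (cfun R S).

Lemma cfun_complete (F : set_system cfun) :
  ProperFilter F -> cauchy F -> cvg F.
Proof.
move=> FF /cauchyP Fc.
have evc x : cvg ((fun f : cfun => f x : C) @ F).
  apply: complex_complete; apply/cauchy_exP => e e0.
  have [f fF] := Fc e e0; exists (f x); rewrite /fmapE /=.
  apply: filterS fF => h; rewrite -!ball_normE /=; apply: le_lt_trans.
  exact: (sup_norm_ge (f - h)).
pose g x : C := lim ((fun f : cfun => f x : C) @ F).
have gP (e : R[i]) : 0 < e ->
    F [set f : cfun | forall x : S, `|g x - (f x : C)| <= e].
  move=> e0; have e20 : 0 < e / 2 by rewrite divr_gt0.
  have [f0 f0F] := Fc _ (divr_gt0 e20 (ltr0Sn _ 1)); near=> f => x.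
  have fF : `|f0 - f| < e / 2 / 2.
    by near: f; apply: filterS (f0F) => h; rewrite -ball_normE.
  near F => h.
  rewrite -[g x - _](@subrKA _ (h x : C)) (le_trans (ler_normD _ _)) //.
  rewrite [e]splitr lerD //.
    by near: h; move/cvgrPdist_le : (evc x); apply.
  rewrite (_ : _ - _ = (h - f) x) // (le_trans (sup_norm_ge _ _)) //.
  rewrite -cfun_normE -(subrKA f0) (le_trans (ler_normD _ _)) //.
  rewrite [e / 2]splitr lerD //; last exact: ltW.
  by near: h; apply: filterS (f0F) => h; rewrite -ball_normE /= distrC => /ltW.
have gc : continuous g.
  move=> x; apply/cvgrPdist_lt => e e0.
  have e30 : 0 < e / 3 by rewrite divr_gt0.
  near F => f.
  have fg : forall y, `|g y - (f y : C)| <= e / 3 by near: f; exact: gP.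
  have fx : f y @[y --> x] --> (f x : C) by exact: cts_fun.
  near=> y.
  have -> : e = e / 3 + (e / 3 + e / 3) by field.
  rewrite -[g x - _](@subrKA _ (f x : C)) (le_lt_trans (ler_normD _ _)) //.
  rewrite ler_ltD // -[_ - g y](@subrKA _ (f y : C)).
  rewrite (le_lt_trans (ler_normD _ _)) // ltr_leD //; last by rewrite distrC.
  by near: y; move/cvgrPdist_lt : fx; apply.
apply/cvg_ex; exists (cfun_of gc : cfun); apply/cvgrPdist_le => e e0.
have [r r0 eE] := gt0_complexP e0.
move: (gP e e0); apply: filterS => f fg.
by rewrite eE cfun_normE lecR; apply: sup_norm_le => x; rewrite -eE; exact: fg.
Unshelve. all: by end_near. Qed.

HB.instance Definition _ := Uniform_isComplete.Build cfun cfun_complete.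

End ContinuousFunctionsComplete.

Section Ell1.
Variables (R : realType) (V : normedModType R[i]).
Implicit Types (a b : int -> V) (u v : V).

Lemma real_normD u v : real_norm (u + v) <= real_norm u + real_norm v.
Proof. by rewrite -lecR rmorphD /= !real_normK ler_normD. Qed.
Lemma real_norm0 : real_norm (0 : V) = 0.
Proof. by rewrite /real_norm normr0. Qed.
Lemma real_normZ (c : R[i]) u :
  real_norm (c *: u) = @real_norm R (R[i]%type)^o c * real_norm u.
Proof.
apply: complexI; rewrite real_normK rmorphM /= real_normK normrZ.
by congr (_ * _); rewrite real_normK.
Qed.

Definition l1_sum a : \bar R := (\esum_(n in [set: int]) (real_norm (a n))%:E)%E.

Lemma l1_sum_ge0 a : (0 <= l1_sum a)%E.
Proof. by apply: esum_ge0 => n _; rewrite lee_fin real_norm_ge0. Qed.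

Lemma esumZ_le (T : choiceType) (r : R) (f : T -> \bar R) : 0 <= r ->
  (forall i, 0 <= f i)%E ->
  (\esum_(i in [set: T]) (r%:E * f i) <= r%:E * \esum_(i in [set: T]) f i)%E.
Proof.
move=> r0 f0; apply: ge_ereal_sup => _ [A [Afin _] <-].
rewrite -ge0_mule_fsumr // lee_wpmul2l ?lee_fin //.
by apply: esum_ge; exists A.
Qed.

Lemma l1_sumD a b : (l1_sum (a \+ b)%R <= l1_sum a + l1_sum b)%E.
Proof.
rewrite /l1_sum -esumD; last 2 first.
- by move=> n _; rewrite lee_fin real_norm_ge0.
- by move=> n _; rewrite lee_fin real_norm_ge0.
by apply: le_esum => n _; rewrite lee_fin real_normD.
Qed.

Lemma l1_sumZ_le (c : R[i]) a :
  (l1_sum (fun n => c *: a n) <= (@real_norm R (R[i]%type)^o c)%:E * l1_sum a)%E.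
Proof.
apply: le_trans (esumZ_le _ _); first last.
- by move=> n; rewrite lee_fin real_norm_ge0.
- exact: (@real_norm_ge0 _ (R[i]%type)^o c).
by apply: le_esum => n _; rewrite real_normZ EFinM.
Qed.

Definition l1_summable : {pred int -> V} :=
  [pred a | `[< (l1_sum a < +oo)%E >]].

Lemma l1_sum0 : l1_sum (fun=> 0) = 0%E.
Proof. by apply: esum1 => n _; rewrite real_norm0. Qed.

Lemma l1_submod_closed : submod_closed l1_summable.
Proof.
split; first by apply/asboolP; rewrite l1_sum0 ltry.
move=> c a b /asboolP afin /asboolP bfin; apply/asboolP.
apply: le_lt_trans (l1_sumD (fun n => c *: a n) b) _.
rewrite lte_add_pinfty // (le_lt_trans (l1_sumZ_le _ _)) //.
by rewrite lte_mul_pinfty // ?lee_fin ?(@real_norm_ge0 _ (R[i]%type)^o c).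
Qed.

HB.instance Definition _ :=
  GRing.isSubmodClosed.Build _ _ l1_summable l1_submod_closed.

Record ell1 := Ell1 { ell1_fun :> int -> V; ell1P : ell1_fun \in l1_summable }.

HB.instance Definition _ := [isSub for ell1_fun].
HB.instance Definition _ := [Choice of ell1 by <:].
HB.instance Definition _ := [SubChoice_isSubLmodule of ell1 by <:].

Implicit Types x y : ell1.

Lemma ell1_eqP x y : x =1 y -> x = y.
Proof. by move=> xy; apply/val_inj/funext. Qed.

Lemma l1_sum_fin x : l1_sum x \is a fin_num.
Proof. by rewrite ge0_fin_numE ?l1_sum_ge0 //; exact/asboolP/(valP x). Qed.

Definition l1_norm x : R := fine (l1_sum x).

Lemma l1_norm_ge0 x : 0 <= l1_norm x.
Proof. by rewrite fine_ge0 ?l1_sum_ge0. Qed.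

Fact l1_normD x y :
  (l1_norm (x + y))%:C%C <= (l1_norm x)%:C%C + (l1_norm y)%:C%C :> R[i].
Proof.
rewrite -rmorphD lecR -fineD ?l1_sum_fin // fine_le ?fin_numD ?l1_sum_fin //.
exact: l1_sumD.
Qed.

Fact l1_norm_eq0 x : (l1_norm x)%:C%C = 0 :> R[i] -> x = 0.
Proof.
move=> /complexI x0; apply/ell1_eqP => n; apply/normr0_eq0.
suff : real_norm (x n) <= 0.
  move=> xn; rewrite -real_normK; congr (_%:C%C); apply/eqP.
  by rewrite eq_le xn; exact: real_norm_ge0.
rewrite -lee_fin -x0 (fineK (l1_sum_fin x)).
apply: esum_ge; exists [set n] => //.
by rewrite fsbig_set1.
Qed.

Fact l1_normZ (c : R[i]) x :
  (l1_norm (c *: x))%:C%C = `|c| * (l1_norm x)%:C%C.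
Proof.
have leZ d y : (l1_norm (d *: y))%:C%C <= `|d| * (l1_norm y)%:C%C.
  rewrite -[`|d|](@real_normK _ (R[i]%type)^o) -rmorphM lecR -lee_fin EFinM.
  by rewrite !fineK ?l1_sum_fin //; exact: l1_sumZ_le.
apply/eqP; rewrite eq_le leZ /=.
have [->|c0] := eqVneq c 0; first by rewrite normr0 mul0r lecR l1_norm_ge0.
rewrite -ler_pdivlMl ?normr_gt0 // -normfV.
by rewrite -[X in l1_norm X](scale1r x) -(mulVf c0) -scalerA leZ.
Qed.

HB.instance Definition _ := @Lmodule_isNormed.Build R[i] ell1
  (fun x => (l1_norm x)%:C%C) l1_normD l1_normZ l1_norm_eq0.

Lemma l1_sum_single (n : int) (u : V) :
  (l1_sum (fun m => if m == n then u else 0%R) < +oo)%E.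
Proof.
rewrite /l1_sum (esumID [set n]) ?setTI; last first.
  by move=> m _; rewrite lee_fin real_norm_ge0.
rewrite esum_set1 ?lee_fin ?real_norm_ge0 // esum1 ?adde0 ?ltry //.
by move=> m /= /eqP/negPf mn; rewrite mn real_norm0.
Qed.

(* The element with value u at n and 0 elsewhere: u delta^n. *)
Definition single (n : int) (u : V) : ell1 :=
  Ell1 (introT (asboolP _) (l1_sum_single n u)).

End Ell1.

Section SumOverIntegers.
Variables (R : realType) (V : normedModType R[i]).
Implicit Type u : int -> V.

(* The partial sums run over the integers in [-n, n); for a family that is
   summable in norm in a complete space, this is the unconditional sum. *)
Definition zsum u : V := limn (series (fun k : nat => u (Posz k) + u (Negz k))).

Lemma esum_int (f : int -> \bar R) : (forall n, 0 <= f n)%E ->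
  (\esum_(n in [set: int]) f n = \sum_(k <oo) (f (Posz k) + f (Negz k)))%E.
Proof.
move=> f0; rewrite (esumID (range Posz)) ?setTI //.
rewrite nneseriesD //; congr (_ + _)%E.
  rewrite (reindex_esum [set: nat] _ Posz) ?nneseries_esumT //.
  split => [k _ | k l _ _ [] // | n [k _ <-]]; first by exists k.
  by exists k.
rewrite (reindex_esum [set: nat] _ Negz) ?nneseries_esumT //.
split => [k _ [] // | k l _ _ [] // | [k|k] kn]; last by exists k.
by exfalso; apply: kn; exists k.
Qed.

Lemma zsum_terms u (k : nat) :
  `|u (Posz k) + u (Negz k)| <=
    (real_norm (u (Posz k)) + real_norm (u (Negz k)))%:C%C.
Proof. by rewrite rmorphD /= !real_normK ler_normD. Qed.

Lemma zsum_partial u (n : nat) : (l1_sum u < +oo)%E ->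
  \sum_(0 <= k < n) (real_norm (u (Posz k)) + real_norm (u (Negz k)))
    <= fine (l1_sum u).
Proof.
move=> ufin; rewrite -lee_fin fineK ?ge0_fin_numE ?l1_sum_ge0 //.
rewrite /l1_sum esum_int; last by move=> m; rewrite lee_fin real_norm_ge0.
rewrite -sumEFin.
under eq_bigr do rewrite EFinD.
by apply: nneseries_lim_ge => k _; rewrite adde_ge0 ?lee_fin ?real_norm_ge0.
Qed.

Lemma zsum_cauchy u : (l1_sum u < +oo)%E ->
  cauchy (series (fun k : nat => u (Posz k) + u (Negz k)) @ \oo).
Proof.
move=> ufin.
pose w (k : nat) := real_norm (u (Posz k)) + real_norm (u (Negz k)).
have w0 k : 0 <= w k by rewrite addr_ge0 ?real_norm_ge0.
have : cvgn (series w).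
  apply: nondecreasing_is_cvgn.
    by apply: nondecreasing_series => k _ _; exact: w0.
  by exists (fine (l1_sum u)) => _ [n _ <-]; exact: zsum_partial.
move=> /cauchy_cvgP/cauchy_seriesP wc.
apply/cauchy_seriesP => e /gt0_complexP[r r0 ->].
apply: filterS (wc r r0) => n; rewrite ger0_norm ?sumr_ge0 // => wn.
apply: (@le_lt_trans _ _ (\sum_(n.1 <= k < n.2) w k)%:C%C); last by rewrite ltcR.
rewrite (le_trans (ler_norm_sum _ _ _)) // rmorph_sum /= ler_sum // => k _.
exact: zsum_terms.
Qed.

Lemma zsum_norm u : (l1_sum u < +oo)%E ->
  cvgn (series (fun k : nat => u (Posz k) + u (Negz k))) ->
  real_norm (zsum u) <= fine (l1_sum u).
Proof.
move=> ufin uc; rewrite -lecR real_normK; apply/ler_addgt0Pl => e e0.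
have /cvgrPdist_lt /(_ _ e0) [N _ /(_ N (leqnn N))/ltW uN] := uc.
rewrite -[zsum u](subrK (series (fun k : nat => u (Posz k) + u (Negz k)) N)).
rewrite (le_trans (ler_normD _ _)) // lerD //.
apply: (@le_trans _ _
  (\sum_(0 <= k < N) (real_norm (u (Posz k)) + real_norm (u (Negz k))))%:C%C).
  rewrite (le_trans (ler_norm_sum _ _ _)) // rmorph_sum /= ler_sum // => k _.
  exact: zsum_terms.
by rewrite lecR zsum_partial.
Qed.

End SumOverIntegers.

Section CrossedProduct.
Variables (R : realType) (S : dynamical_system).
Local Notation C := (R[i]%type)^o.
Local Notation cfun := (cfun R S).

Lemma alpha_continuous (n : int) (f : cfun) :
  continuous (fun x => f (act (- n) x) : C).
Proof.
move=> x; apply: (@continuous_comp _ _ _ (@act S (- n)) f).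
  exact: act_continuous.
exact: cts_fun.
Qed.

Definition alpha (n : int) (f : cfun) : cfun := cfun_of (@alpha_continuous n f).

(* The underlying Banach space of the convolution algebra of (S, shift_map). *)
Definition ell1_dyn := ell1 cfun.
HB.instance Definition _ := NormedModule.on ell1_dyn.

Definition convolution (a b : int -> cfun) : int -> cfun :=
  fun n => zsum (fun k => cfun_mul (a k) (alpha k (b (n - k)))).

Lemma real_norm_conv (f g : cfun) (k : int) :
  real_norm (cfun_mul f (alpha k g)) <= real_norm f * real_norm g.
Proof.
apply: sup_norm_le => x; rewrite normrM rmorphM /=.
by apply: ler_pM => //; rewrite real_normK;
  [exact: (sup_norm_ge f) | exact: (sup_norm_ge g)].
Qed.

Lemma convolution_l1 (a b : ell1_dyn) : convolution a b \in @l1_summable R cfun.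
Proof.
pose F (n k : int) := (real_norm (a k) * real_norm (b (n - k)))%:E.
have F0 n k : (0 <= F n k)%E by rewrite lee_fin mulr_ge0 ?real_norm_ge0.
have afin : (l1_sum a < +oo)%E by exact/asboolP/(valP a).
have bfin : (l1_sum b < +oo)%E by exact/asboolP/(valP b).
have Ffin : (\esum_(n in [set: int]) \esum_(k in [set: int]) F n k < +oo)%E.
  rewrite (@esum_esum _ _ _ setT (fun=> setT)) //.
  rewrite (reindex_esum [set: int * int] _ (fun p => (p.1 + p.2, p.1))); last first.
    split => // [[k m] [k' m'] _ _ [] /[swap] -> /addrI -> // | [n k] _].
    by exists (k, n - k) => //=; rewrite addrC subrK.
  rewrite (_ : [set: int * int] = setT `*`` (fun=> setT)); last first.
    by apply/seteqP; split.
  rewrite -(@esum_esum _ _ _ setT (fun=> setT) (fun k m => F (k + m) k)) //.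
  rewrite (@le_lt_trans _ _ (\esum_(k in [set: int])
      (fine (l1_sum b))%:E * (real_norm (a k))%:E)%E) //.
    apply: le_esum => k _; rewrite muleC fineK ?ge0_fin_numE ?l1_sum_ge0 //.
    apply: le_trans (esumZ_le _ _); first last.
    - by move=> m; rewrite lee_fin real_norm_ge0.
    - exact: real_norm_ge0.
    by apply: le_esum => m _; rewrite /F addrC addKr EFinM.
  apply: le_lt_trans (esumZ_le _ _) _; first by rewrite fine_ge0 ?l1_sum_ge0.
    by move=> m; rewrite lee_fin real_norm_ge0.
  by rewrite lte_mul_pinfty // lee_fin fine_ge0 ?l1_sum_ge0.
have Fn n : (\esum_(k in [set: int]) F n k < +oo)%E.
  apply: le_lt_trans Ffin; apply: esum_ge; exists [set n] => //.
  by rewrite fsbig_set1.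
have le_term (n : int) : (l1_sum (fun k => cfun_mul (a k) (alpha k (b (n - k)%R)))
    <= \esum_(k in [set: int]) F n k)%E.
  by apply: le_esum => k _; rewrite lee_fin real_norm_conv.
apply/asboolP; apply: le_lt_trans Ffin; apply: le_esum => n _.
apply: le_trans (le_term n).
have tfin := le_lt_trans (le_term n) (Fn n).
rewrite -[leRHS]fineK ?ge0_fin_numE ?l1_sum_ge0 // lee_fin.
apply: zsum_norm => //.
exact: (@cauchy_cvg (cfun : completeType) _ _ (zsum_cauchy tfin)).
Qed.

Definition ell1_mul (a b : ell1_dyn) : ell1_dyn := Ell1 (convolution_l1 a b).

End CrossedProduct.

Section Representations.
Variables (R : realType) (S : dynamical_system).
Local Notation A := (ell1_dyn R S).

Record representation (E : lmodType R[i]) := Representation {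
  rep :> A -> E -> E;
  rep_linearr : forall a, linear (rep a);
  rep_linearl : forall v, linear (rep^~ v);
  rep_mul : forall a b v, rep (ell1_mul a b) v = rep a (rep b v) }.

Section OneRepresentation.
Variables (E : lmodType R[i]) (pi : representation E).

Definition invariant_subspace (W : set E) :=
  [/\ W 0, forall (c : R[i]) u v, W u -> W v -> W (c *: u + v)
    & forall a v, W v -> W (pi a v)].

Definition algebraically_irreducible :=
  (exists a v, pi a v <> 0) /\
  forall W, invariant_subspace W -> W = [set 0] \/ W = setT.

Definition rep_kernel : set A := [set a | forall v, pi a v = 0].

Lemma rep0r a : pi a 0 = 0.
Proof. by have := rep_linearr pi a (-1) 0 0; rewrite scaler0 addr0 scaleN1r addNr. Qed.

Lemma rep0l v : pi 0 v = 0.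
Proof. by have := rep_linearl pi v (-1) 0 0; rewrite scaler0 addr0 scaleN1r addNr. Qed.

Lemma irreducible_cyclic v : algebraically_irreducible -> v <> 0 ->
  forall w, exists a, pi a v = w.
Proof.
move=> [[a0 [v0 av0]] irr] v_neq0.
have [|W0|WT] := irr [set w | exists a, pi a v = w].
- split=> /=; first by exists 0; rewrite rep0l.
  + by move=> c _ _ [a <-] [b <-]; exists (c *: a + b); rewrite rep_linearl.
  + by move=> a _ [b <-]; exists (ell1_mul a b); rewrite rep_mul.
- have av a : pi a v = 0.
    by suff : [set w | exists a, pi a v = w] (pi a v); [rewrite W0 | exists a].
  have [||UT] := irr [set w | forall a, pi a w = 0].
  + split=> /=; first exact: rep0r.
    * by move=> c u w u0 w0 a; rewrite rep_linearr u0 w0 scaler0 addr0.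
    * by move=> b w w0 a; rewrite w0 rep0r.
  + by move=> U0; case: v_neq0; rewrite -[_ = _]/([set 0] v) -U0.
  + by case: av0; have : [set w | forall a, pi a w = 0] v0 by rewrite UT.
- by move=> w; rewrite -[exists _, _]/([set w | exists a, pi a v = w] w) WT.
Qed.

End OneRepresentation.

Definition primitive (P : set A) := exists (E : lmodType R[i])
  (pi : representation E), algebraically_irreducible pi /\ P = rep_kernel pi.

Record primitive_ideal := PrimitiveIdeal {
  ideal_set :> set A;
  ideal_primitive : primitive ideal_set }.

HB.instance Definition _ := gen_eqMixin primitive_ideal.
HB.instance Definition _ := gen_choiceMixin primitive_ideal.

Implicit Types F G : set primitive_ideal.

Definition hull_kernel_closure F : set primitive_ideal :=
  [set P | \bigcap_(Q in F) Q `<=` P].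

Lemma sub_hull_kernel F : F `<=` hull_kernel_closure F.
Proof. by move=> P FP a; apply. Qed.

Lemma hull_kernelS F G :
  F `<=` G -> hull_kernel_closure F `<=` hull_kernel_closure G.
Proof. by move=> FG P PF a Ga; apply: PF => Q /FG; exact: Ga. Qed.

Lemma hull_kernelI F :
  hull_kernel_closure (hull_kernel_closure F) = hull_kernel_closure F.
Proof.
apply/seteqP; split; last exact: sub_hull_kernel.
by move=> P PF a Fa; apply: PF => Q QF; exact: QF.
Qed.

Lemma hull_kernel0 : hull_kernel_closure set0 = set0.
Proof.
apply/seteqP; split => // -[P [E [pi [[[a [v av]] _] PE]]]] /(_ a) /=.
by rewrite PE => /(_ _)/= Pa; case: av; apply: Pa => Q [].
Qed.

Lemma hull_kernelU F G : hull_kernel_closure (F `|` G) =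
  hull_kernel_closure F `|` hull_kernel_closure G.
Proof.
apply/seteqP; split; last first.
  by move=> P [] /hull_kernelS; apply => Q; [left | right].
move=> P PFG; have [PF|PnF] := pselect (hull_kernel_closure F P); first by left.
right=> b Gb; apply: contrapT => Pnb; apply: PnF => a Fa; apply: contrapT => Pna.
have [E [pi [irr PE]]] := ideal_primitive P.
move: Pna Pnb; rewrite PE => Pna Pnb.
have [w aw] : exists w, pi a w <> 0 by apply/existsNP.
have [v bv] : exists v, pi b v <> 0 by apply/existsNP.
have [c cw] := irreducible_cyclic irr bv w.
have abc Q : (F `|` G) Q -> ideal_set Q (ell1_mul a (ell1_mul c b)).
  move=> FGQ; have QF : F Q -> ideal_set Q a by exact: Fa.
  have QG : G Q -> ideal_set Q b by exact: Gb.
  have [E' [pi' [_ QE]]] := ideal_primitive Q.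
  move: QF QG; rewrite QE => QF QG u; rewrite !rep_mul.
  by case: FGQ => [/QF|/QG] Q0; rewrite Q0 ?rep0r.
by apply: aw; have := PFG _ abc; rewrite PE => /(_ v); rewrite !rep_mul cw.
Qed.

(* The hull-kernel topology: U is open iff its complement is hull-kernel closed;
   [closure_hull_kernel] below states that the closure operator of this topology
   is [hull_kernel_closure]. *)
Definition hull_kernel_open (U : set primitive_ideal) :=
  hull_kernel_closure (~` U) = ~` U.

Fact hull_kernel_openT : hull_kernel_open setT.
Proof. by rewrite /hull_kernel_open setCT hull_kernel0. Qed.

Fact hull_kernel_openI : setI_closed hull_kernel_open.
Proof.
by move=> U W UO WO; rewrite /hull_kernel_open setCI hull_kernelU UO WO.
Qed.

Fact hull_kernel_open_bigU (I : Type) (f : I -> set primitive_ideal) :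
  (forall i, hull_kernel_open (f i)) -> hull_kernel_open (\bigcup_i f i).
Proof.
move=> fO; apply/seteqP; split; last exact: sub_hull_kernel.
move=> P PU [i _ fiP]; have : (~` f i) P; last by [].
by rewrite -(fO i); apply: hull_kernelS PU => Q QU fQ; apply: QU; exists i.
Qed.

HB.instance Definition _ := isOpenTopological.Build primitive_ideal
  hull_kernel_openT hull_kernel_openI hull_kernel_open_bigU.

Lemma closure_hull_kernel F : closure F = hull_kernel_closure F.
Proof.
have clP G : closed G <-> hull_kernel_closure G = G.
  by rewrite -openC -[open _]/(hull_kernel_open _) /hull_kernel_open setCK.
apply/seteqP; split.
  rewrite closureE => P; apply; split; last exact: sub_hull_kernel.
  by apply/clP; exact: hull_kernelI.
have /clP <- : closed (closure F) by exact: closed_closure.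
by apply: hull_kernelS; exact: subset_closure.
Qed.

Definition infinite_dimensional (E : lmodType R[i]) :=
  ~ exists (n : nat) (e : 'I_n -> E), forall v, exists c : 'I_n -> R[i],
      v = \sum_i c i *: e i.

Definition embed (f : cfun R S) : A := single 0 f.
Definition delta : A := single 1 (cfun_cst S (1 : R[i]^o)).

(* The closed set X_pi: the unique closed Y such that the restriction of pi to
   the continuous functions vanishes exactly on those that vanish on Y. *)
Definition is_rep_support (E : lmodType R[i]) (pi : representation E)
    (Y : set S) :=
  closed Y /\ [set f | forall v, pi (embed f) v = 0] =
              [set f : cfun R S | forall x, Y x -> f x = 0].

Definition rep_support (E : lmodType R[i]) (pi : representation E) : set S :=
  get (is_rep_support pi).

(* The subspace topology of Y is that of a metric space M, transported along the
   bijection h from M to Y. *)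
Definition metrizable (Y : set S) :=
  exists (M : metricType R) (h : M -> S), [/\ injective h, range h = Y
    & forall U : set M, open U <-> exists2 V : set S, open V & U = h @^-1` V].

Definition supports_metrizable :=
  forall (E : lmodType R[i]) (pi : representation E),
    infinite_dimensional E -> algebraically_irreducible pi ->
    metrizable (rep_support pi).

Definition orbit_closures (D : set S) : set (set S) :=
  [set closure (orbit x) | x in D].

Definition minimal_orbit_closure (O : set S) :=
  orbit_closures setT O /\
  forall O', orbit_closures setT O' -> O' `<=` O -> O' = O.

Definition has_period (x : S) (p : nat) :=
  [/\ (0 < p)%N, act p x = x
    & forall q : nat, (0 < q < p)%N -> act q x <> x].

(* Continuity is automatic for an algebraically irreducible representation; it
   makes pi determined by the values below, since finitely supported elements are
   dense. *)
Definition periodic_rep (x : S) (p : nat) (l : R[i])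
    (pi : representation 'cV[R[i]]_p) :=
  let e (j : 'I_p) : 'cV[R[i]]_p := delta_mx j 0 in
  [/\ algebraically_irreducible pi,
      forall v (k : 'I_p), continuous (fun a => pi a v k 0 : R[i]^o),
      forall f (j : 'I_p), pi (embed f) (e j) = f (act j x) *: e j,
      forall j k : 'I_p, k = j.+1 :> nat -> pi delta (e j) = e k
    & forall j k : 'I_p, j.+1 = p -> k = 0%N :> nat ->
        pi delta (e j) = l *: e k].

Definition periodic_ideal (O : set S) (l : R[i]) (P : set A) :=
  exists (x : S) (p : nat) (pi : representation 'cV[R[i]]_p),
    [/\ has_period x p, O = closure (orbit x), periodic_rep x l pi
      & P = rep_kernel pi].

Definition aperiodic_rep (x : S) (pi : representation (ell1 (R[i]^o))) :=
  let e (k : int) : ell1 (R[i]^o) := single k (1 : R[i]^o) in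
  [/\ algebraically_irreducible pi,
      forall a v, `|pi a v| <= `|a| * `|v|,
      forall f (k : int), pi (embed f) (e k) = f (act k x) *: e k
    & forall k, pi delta (e k) = e (k + 1)].

Definition aperiodic_ideal (O : set S) (P : set A) :=
  exists (x : S) (pi : representation (ell1 (R[i]^o))),
    [/\ aper S x, O = closure (orbit x), aperiodic_rep x pi & P = rep_kernel pi].

Definition ideals_per : set primitive_ideal :=
  [set P : primitive_ideal | exists O (l : R[i]),
    [/\ orbit_closures (per S) O, `|l| = 1 & periodic_ideal O l P]].
Definition ideals_aper : set primitive_ideal :=
  [set P : primitive_ideal |
    exists2 O, orbit_closures (aper S) O & aperiodic_ideal O P].
Definition ideals_X := ideals_per `|` ideals_aper.
Definition ideals_infty : set primitive_ideal :=
  [set P : primitive_ideal | exists (E : lmodType R[i]) (pi : representation E),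
    [/\ infinite_dimensional E, algebraically_irreducible pi
      & P = rep_kernel pi :> set A]].

Definition associated (P : set A) (O : set S) :=
  (exists2 l : R[i], `|l| = 1 & periodic_ideal O l P) \/ aperiodic_ideal O P.

End Representations.

Arguments metrizable R {S} Y.
Arguments supports_metrizable R S : clear implicits.
Arguments ideals_per R S _ : clear implicits.
Arguments ideals_aper R S _ : clear implicits.
Arguments ideals_X R S _ : clear implicits.
Arguments ideals_infty R S _ : clear implicits.

(* Main.v *)
(** Let pi be an algebraically irreducible representation with support Y.
    Transitivity of the shift on Y and Baire's theorem show that Y is either a
    finite orbit or contained in the closure of the aperiodic points, and that
    Y is an orbit closure when it is metrizable.  If x in Y is aperiodic and a
    is in the kernel of pi, then multiplying a on both sides by functions
    concentrated near x isolates each coefficient, so a(n)(x) = 0 for all n;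
    hence a dense aperiodic orbit determines the kernel.  If Y is an orbit of
    period p, then delta^p is central, and a Gelfand-Mazur argument for the
    quotient norms inf {|a| : pi(a) v = w} makes it a unimodular scalar l;
    the kernel is then cut out by the sums of l^m a(r + m p) on the orbit.
    A function on Z whose weighted sums over residues modulo p vanish for every
    unimodular l is 0, as averaging over the square roots of l passes from p to
    2p.  Thus an element lies in all ideals attached to a set of orbits exactly
    when its coefficients vanish there, and density of ideals becomes density of
    points.  Compactness holds because the algebra is unital: the directed union
    of the ideals attached to the members of a filter is proper, hence lies in a
    maximal left ideal M, and acts trivially on the quotient by M. *)

From HB Require Import structures.
Require Import Defs.
From mathcomp Require Import all_boot all_order all_algebra.
From mathcomp Require Import all_classical all_reals all_analysis.
From mathcomp Require Import finmap complex ring lra zify.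

Set Implicit Arguments.
Unset Strict Implicit.
Unset Printing Implicit Defensive.

Import Order.TTheory GRing.Theory Num.Theory.
Import numFieldNormedType.Exports.
Import Defs.

Local Open Scope classical_set_scope.
Local Open Scope ring_scope.

(** * The convolution algebra *)

Section RealNorm.
Variables (R : realType) (V : normedModType R[i]).
Implicit Types u v w : V.

(** The space of a representation has no norm here, only its linear structure, so every estimate is
    made inside the algebra. The substitute for a norm is that an element of norm below 1 cannot fix
    a nonzero vector, since [one - t] has a left inverse. This alone yields closed annihilators,
    localisation at a point of the support and the exclusion of spectrum.

    Gelfand-Mazur is done without holomorphic functions. If D = delta^p had no unimodular
    eigenvalue, averaging resolvents over the roots of order n = 2^N would give vectors mu (mu -
    D^n)^-1 v that approach v for large |mu| and 0 for small |mu|, and yet stay within 1/4 of each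
    other. The circle is the right place to look because delta and its inverse both have norm 1.

    The definitions of the ideals of orbits only list properties of a representation. Kernels are
    therefore computed for any irreducible representation with the given support, and concrete
    models serve for existence. Each model is the quotient of the algebra by the annihilator of the
    basis vector of index 0, realised through an explicit linear section. *)

Lemma real_normN v : real_norm (- v) = real_norm v.
Proof. by rewrite /real_norm normrN. Qed.

Lemma real_normB u v : real_norm (u - v) <= real_norm u + real_norm v.
Proof. by rewrite -(real_normN v) real_normD. Qed.

Lemma real_normBC u v : real_norm (u - v) = real_norm (v - u).
Proof. by rewrite /real_norm distrC. Qed.

Lemma real_norm_eq0 v : real_norm v = 0 -> v = 0.
Proof. by move=> v0; apply/normr0_eq0; rewrite -real_normK v0. Qed.

Lemma real_norm_small v : (forall e, 0 < e -> real_norm v <= e) -> v = 0.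
Proof.
move=> ve; apply/real_norm_eq0/eqP; rewrite eq_le real_norm_ge0 andbT.
by apply/ler_addgt0Pr => e /ve; rewrite add0r.
Qed.

Lemma real_norm_sum (I : Type) (s : seq I) (P : pred I) (F : I -> V) :
  real_norm (\sum_(i <- s | P i) F i) <= \sum_(i <- s | P i) real_norm (F i).
Proof.
elim/big_rec2: _ => [|i y x _ h]; first by rewrite real_norm0.
by rewrite (le_trans (real_normD _ _)) // lerD2l.
Qed.

Lemma cvg_real_norm (T : Type) (F : set_system T) {FF : Filter F} (f : T -> V)
    (l : V) :
  f @ F --> l ->
  forall e, 0 < e -> \forall t \near F, real_norm (l - f t) <= e.
Proof.
move=> fl e e0; have ec : 0 < e%:C%C :> R[i] by rewrite ltcR.
move/cvgrPdist_le: fl => /(_ _ ec); apply: filterS => t.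
by rewrite -lecR real_normK.
Qed.

Lemma real_norm_cvg (T : Type) (F : set_system T) {FF : Filter F} (f : T -> V)
    (l : V) :
  (forall e, 0 < e -> \forall t \near F, real_norm (l - f t) <= e) ->
  f @ F --> l.
Proof.
move=> fl; apply/cvgrPdist_le => e /gt0_complexP[r r0 ->].
by apply: filterS (fl r r0) => t; rewrite -lecR real_normK.
Qed.

Lemma cvg_real_norm_comp (T : Type) (F : set_system T) {FF : Filter F}
    (f : T -> V) (l : V) :
  f @ F --> l -> (fun t => real_norm (f t)) @ F --> real_norm l.
Proof.
move=> fl; apply/cvgrPdist_le => e e0; apply: filterS (cvg_real_norm fl e0) => t.
apply: le_trans; rewrite ler_norml lerBlDr lerNl opprB lerBlDr; apply/andP; split.
  by rewrite real_normBC (le_trans _ (real_normD _ _)) // subrK.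
by rewrite (le_trans _ (real_normD _ _)) // subrK.
Qed.

End RealNorm.

Section ScalarNorm.
Variable R : realType.
Local Notation C := (R[i]%type)^o.

Lemma real_normM (z w : C) : real_norm (z * w : C) = real_norm z * real_norm w.
Proof. exact: (real_normZ (V := C)). Qed.

Lemma real_norm1 : real_norm (1 : C) = 1.
Proof. by apply: complexI; rewrite real_normK normr1. Qed.

Lemma real_norm_real (r : R) : real_norm (r%:C%C : C) = `|r|.
Proof.
by apply: complexI; rewrite real_normK normc_def /= expr0n addr0 sqrtr_sqr.
Qed.

Lemma real_normV (z : C) : real_norm (z^-1 : C) = (real_norm z)^-1.
Proof. by apply: complexI; rewrite real_normK normfV fmorphV /= real_normK. Qed.

Lemma real_normX (z : C) n : real_norm (z ^+ n : C) = real_norm z ^+ n.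
Proof.
by elim: n => [|n IH]; rewrite ?expr0 ?real_norm1 // !exprS -IH real_normM.
Qed.

End ScalarNorm.

(** * Norm estimates and density of finitely supported elements *)

Section Ell1Density.
Variables (R : realType) (V : normedModType R[i]).
Implicit Types (a b : ell1 V) (u v : V).

Lemma l1_normE a : real_norm a = l1_norm a. Proof. by []. Qed.

Lemma l1_sumK a : (l1_norm a)%:E = l1_sum a.
Proof. by rewrite /l1_norm fineK ?l1_sum_fin. Qed.

Lemma ell1D a b n : (a + b) n = a n + b n. Proof. by []. Qed.
Lemma ell1B a b n : (a - b) n = a n - b n. Proof. by []. Qed.
Lemma ell1Z c a n : (c *: a) n = c *: a n. Proof. by []. Qed.
Lemma ell1_sumE (I : Type) (s : seq I) (P : pred I) (F : I -> ell1 V) n :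
  (\sum_(i <- s | P i) F i) n = \sum_(i <- s | P i) F i n.
Proof. by apply: (big_morph (fun a : ell1 V => a n)). Qed.

Lemma singleE n u m : single n u m = if m == n then u else 0.
Proof. by []. Qed.

Lemma singleD n u v : single n (u + v) = single n u + single n v.
Proof. by apply/ell1_eqP => m; rewrite ell1D !singleE; case: ifP; rewrite ?addr0. Qed.

Lemma singleZ n c u : single n (c *: u) = c *: single n u.
Proof. by apply/ell1_eqP => m; rewrite ell1Z !singleE; case: ifP; rewrite ?scaler0. Qed.

Lemma single0 n : single n (0 : V) = 0.
Proof. by apply/ell1_eqP => m; rewrite singleE if_same. Qed.

Lemma ell1_le a n : real_norm (a n) <= real_norm a.
Proof.
rewrite -lee_fin l1_normE l1_sumK; apply: esum_ge; exists [set n] => //.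
by rewrite fsbig_set1.
Qed.

Lemma real_norm_single n u : real_norm (single n u) = real_norm u.
Proof.
rewrite l1_normE; apply: EFin_inj; rewrite l1_sumK.
rewrite /l1_sum (esumID [set n]) ?setTI; last first.
  by move=> m _; rewrite lee_fin real_norm_ge0.
rewrite esum_set1 ?lee_fin ?real_norm_ge0 // singleE eqxx esum1 ?adde0 //.
by move=> m /= /eqP/negPf mn; rewrite mn real_norm0.
Qed.

Lemma l1_norm_le a (r : R) :
  (forall s : seq int, uniq s -> \sum_(n <- s) real_norm (a n) <= r) ->
  real_norm a <= r.
Proof.
move=> ar; rewrite l1_normE -lee_fin l1_sumK; apply: ge_ereal_sup.
move=> _ [A [/finite_fsetP[s ->] _] <-].
by rewrite fsbig_finite //= set_fsetK sumEFin lee_fin; exact/ar/fset_uniq.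
Qed.

Lemma l1_sum_lt_pinfty (a : int -> V) (r : R) :
  (forall s : seq int, uniq s -> \sum_(n <- s) real_norm (a n) <= r) ->
  (l1_sum a < +oo)%E.
Proof.
move=> ar; apply: (@le_lt_trans _ _ r%:E); last exact: ltry.
apply: ge_ereal_sup => _ [A [/finite_fsetP[s ->] _] <-].
by rewrite fsbig_finite //= set_fsetK sumEFin lee_fin; exact/ar/fset_uniq.
Qed.

Lemma l1_norm_ge a (s : seq int) : uniq s ->
  \sum_(n <- s) real_norm (a n) <= real_norm a.
Proof.
move=> us; rewrite -lee_fin l1_normE l1_sumK; apply: esum_ge.
exists [set` s]; first by split; [exact: finite_seq | exact: subsetT].
by rewrite -sumEFin fsbig_seq.
Qed.

Lemma ell1_approx a e : 0 < e ->
  exists s : seq int, real_norm (a - \sum_(n <- s) single n (a n)) < e.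
Proof.
move=> e0.
have [s us sa] : exists2 s : seq int, uniq s &
    real_norm a - e / 2 < \sum_(n <- s) real_norm (a n).
  apply: contrapT => /forall2NP ns.
  have : real_norm a <= real_norm a - e / 2.
    by apply: l1_norm_le => s us; case: (ns s) => // /negP; rewrite -leNgt.
  by rewrite lerBrDl gerDr leNgt divr_gt0.
exists s.
have aS n : (a - \sum_(m <- s) single m (a m)) n = if n \in s then 0 else a n.
  rewrite ell1B ell1_sumE; case: ifPn => ns.
    rewrite (bigD1_seq n) // singleE eqxx big1 /= ?addr0 ?subrr // => m mn.
    by rewrite eq_sym (negPf mn).
  rewrite big_seq big1 ?subr0 // => m ms; rewrite singleE.
  by case: eqP => // nm; rewrite nm ms in ns.
apply: (@le_lt_trans _ _ (e / 2)); last by rewrite ltr_pdivrMr // ltr_pMr // ltr1n.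
apply: l1_norm_le => t ut.
have -> : \sum_(n <- t) real_norm ((a - \sum_(m <- s) single m (a m)) n) =
    \sum_(n <- t | n \notin s) real_norm (a n).
  rewrite [RHS]big_mkcond; apply: eq_bigr => n _.
  by rewrite aS; case: ifP; rewrite ?real_norm0.
(* Indices of [t] outside [s] can be appended to [s] without repetition, so their terms share the
   part of the norm that [s] leaves over. *)
have := @l1_norm_ge a (s ++ [seq n <- t | n \notin s]).
rewrite cat_uniq us filter_uniq // andbT -all_predC.
rewrite (_ : all _ _); last by apply/allP => n; rewrite mem_filter => /andP[].
by move=> /(_ isT); rewrite big_cat /= big_filter; lra.
Qed.

(* Finitely supported elements are dense: identities between bounded additive
   maps need only be checked on the elements [single n v]. *)
Lemma ell1_eq0 (W : normedModType R[i]) (T : ell1 V -> W) (K : R) :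
  (forall a b, T (a + b) = T a + T b) ->
  (forall a, real_norm (T a) <= K * real_norm a) ->
  (forall n v, T (single n v) = 0) -> forall a, T a = 0.
Proof.
move=> TD TK T0 a; apply: real_norm_small => e e0.
have T00 : T 0 = 0 by rewrite -(single0 0) T0.
have TS s : T (\sum_(n <- s) single n (a n)) = 0.
  elim: s => [|n s IH]; first by rewrite big_nil T00.
  by rewrite big_cons TD T0 IH addr0.
have K0 : 0 < `|K| + 1 by rewrite ltr_wpDl.
have [s sP] := ell1_approx a (divr_gt0 e0 K0).
have -> : T a = T (a - \sum_(n <- s) single n (a n)).
  by rewrite -[RHS]addr0 -(TS s) -TD subrK.
apply: le_trans (TK _) _.
rewrite (@le_trans _ _ ((`|K| + 1) * (e / (`|K| + 1)))) //; last first.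
  by rewrite mulrC divfK // gt_eqF.
rewrite (le_trans (ler_wpM2r (real_norm_ge0 _) (_ : K <= `|K| + 1))) //.
  by rewrite (le_trans (ler_norm K)) // lerDl.
by rewrite ler_wpM2l ?(ltW K0) // ltW.
Qed.

End Ell1Density.

Section Zsum.
Variables (R : realType) (V : normedModType R[i]).
Hypothesis V_complete :
  forall F : set_system V, ProperFilter F -> cauchy F -> cvg F.
Implicit Types u v : int -> V.

Lemma zsum_is_cvg u : (l1_sum u < +oo)%E ->
  cvgn (series (fun k : nat => u (Posz k) + u (Negz k))).
Proof. by move=> /zsum_cauchy; exact: V_complete. Qed.

Lemma zsum_le u : (l1_sum u < +oo)%E -> real_norm (zsum u) <= fine (l1_sum u).
Proof. by move=> ufin; apply: zsum_norm => //; exact: zsum_is_cvg. Qed.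

Lemma zsumD u v : (l1_sum u < +oo)%E -> (l1_sum v < +oo)%E ->
  zsum (fun k => u k + v k) = zsum u + zsum v.
Proof.
move=> /zsum_is_cvg uc /zsum_is_cvg vc; rewrite /zsum -limD // -seriesD.
by congr (limn (series _)); apply/funext => k; exact: addrACA.
Qed.

Lemma zsumZ c u : (l1_sum u < +oo)%E ->
  zsum (fun k => c *: u k) = c *: zsum u.
Proof.
move=> /zsum_is_cvg uc; rewrite /zsum -limZr //.
congr (limn _); apply/funext => N; rewrite /series /=.
by under eq_bigr do rewrite -scalerDr; rewrite -scaler_sumr.
Qed.

Lemma zsum_supp1 n u : (forall k, k != n -> u k = 0) -> zsum u = u n.
Proof.
move=> u0; apply: (@lim_near_cst V) => //.
have uE m : (Posz m == n) || (Negz m == n) -> u (Posz m) + u (Negz m) = u n.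
  move=> /orP[] /eqP mn; rewrite -mn.
    by rewrite [X in _ + X]u0 ?addr0 -?mn.
  by rewrite [X in X + _]u0 ?add0r -?mn.
have uN m : ~~ ((Posz m == n) || (Negz m == n)) -> u (Posz m) + u (Negz m) = 0.
  by rewrite negb_or => /andP[m1 m2]; rewrite !u0 ?addr0.
(* Term k of the series pairs k with [Negz k], which is -(k+1); hence [n] occurs in exactly one
   term. *)
have [m mn mu] : exists2 m, (Posz m == n) || (Negz m == n) &
    forall k, k != m -> ~~ ((Posz k == n) || (Negz k == n)).
  case: n {u0 uE uN} => m; exists m; rewrite ?eqxx ?orbT // => k km;
    by apply/negP => /orP[]/eqP // [] kn; rewrite kn eqxx in km.
near=> N; rewrite /series /= (bigD1_seq m) ?iota_uniq //=; last first.
  by rewrite mem_index_iota /=; near: N; exists m.+1.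
rewrite uE // big1 ?addr0 // => k /mu; exact: uN.
Unshelve. all: by end_near. Qed.

End Zsum.

Section Ell1Complete.
Variables (R : realType) (V : normedModType R[i]).
Hypothesis V_complete :
  forall F : set_system V, ProperFilter F -> cauchy F -> cvg F.

(** The limit is taken coefficientwise, and the estimate survives because it is tested on finite
    sets of indices, where limits commute with sums. The explicit rate [e] is kept so that its value
    at 0 gives the norm bound in [neumann]. *)
Lemma ell1_complete (a : nat -> ell1 V) (e : nat -> R) :
  (forall N M, (N <= M)%N -> real_norm (a M - a N) <= e N) ->
  e @ \oo --> (0 : R) -> exists b, forall N, real_norm (b - a N) <= e N.
Proof.
move=> ae e0.
have ac n : cvgn (fun k => a k n).
  apply: V_complete; apply/cauchy_exP => _ /gt0_complexP[r r0 ->].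
  move/cvgrPdist_lt : e0 => /(_ _ r0) [N _ /(_ N (leqnn N))]; rewrite sub0r normrN => eN.
  exists (a N n); rewrite /fmapE /=; exists N => // M /= NM.
  rewrite -ball_normE /= -real_normK ltcR real_normBC -ell1B.
  rewrite (le_lt_trans (ell1_le _ _)) // (le_lt_trans (ae _ _ NM)) //.
  by rewrite (le_lt_trans (ler_norm _)).
pose b n := limn (fun k => a k n).
have bs (s : seq int) r : 0 < r ->
    \forall M \near \oo, \sum_(n <- s) real_norm (b n - a M n) <= r.
  elim: s r => [|n s IH] r r0; first by near=> M; rewrite big_nil ltW.
  have r20 : 0 < r / 2 by rewrite divr_gt0.
  have bn : \forall M \near \oo, real_norm (b n - a M n) <= r / 2.
    exact: (cvg_real_norm (ac n) r20).
  near=> M; rewrite big_cons [r]splitr lerD //; last first.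
    by near: M; apply: IH; rewrite divr_gt0.
  by near: M; exact: bn.
have bN N (s : seq int) : uniq s -> \sum_(n <- s) real_norm (b n - a N n) <= e N.
  move=> us; apply/ler_addgt0Pr => r r0; near \oo => M.
  have NM : (N <= M)%N by near: M; exists N.
  rewrite (@le_trans _ _ (\sum_(n <- s)
      (real_norm (a M n - a N n) + real_norm (b n - a M n)))) //.
    apply: ler_sum => n _; rewrite [leRHS]addrC (le_trans _ (real_normD _ _)) //.
    by rewrite subrKA.
  rewrite big_split lerD //=; last by near: M; exact: bs.
  by rewrite (le_trans _ (ae _ _ NM)) // (le_trans _ (l1_norm_ge _ us)).
have bl : b \in @l1_summable R V.
  apply/asboolP; apply: (@l1_sum_lt_pinfty _ _ _ (e 0%N + real_norm (a 0%N))).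
  move=> s us; rewrite (@le_trans _ _ (\sum_(n <- s)
      (real_norm (b n - a 0%N n) + real_norm (a 0%N n)))) //.
    by apply: ler_sum => n _; rewrite (le_trans _ (real_normD _ _)) // subrK.
  by rewrite big_split lerD ?bN //= l1_norm_ge.
by exists (Ell1 bl) => N; apply: l1_norm_le => s us; exact: bN.
Unshelve. all: by end_near. Qed.

End Ell1Complete.

Section Action.
Variable S : dynamical_system.
Implicit Type x : S.

Lemma actS n x : act (n + 1) x = shift_map (act n x).
Proof.
case: n => [m|[|m]]; first by rewrite -PoszD addn1.
  by rewrite /= shift_invK.
by rewrite (_ : Negz m.+1 + 1 = Negz m) /= ?shift_invK //; lia.
Qed.

Lemma actP n x : act (n - 1) x = shift_inv (act n x).
Proof. by rewrite -{2}(subrK 1 n) actS shift_mapK. Qed.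

Lemma actD m n x : act (m + n) x = act m (act n x).
Proof.
elim/int_ind: m => [|m IH|m IH]; first by rewrite add0r.
  by rewrite -addn1 PoszD addrAC actS IH -actS.
by rewrite -addn1 PoszD opprD addrAC actP IH -actP.
Qed.

Lemma actK n : cancel (@act S n) (act (- n)).
Proof. by move=> x; rewrite -actD addNr. Qed.

Lemma actVK n : cancel (@act S (- n)) (act n).
Proof. by move=> x; rewrite -actD subrr. Qed.

End Action.

(** * The unital Banach algebra of the dynamical system *)

Section Convolution.
Variables (R : realType) (S : dynamical_system).
Local Notation C := (R[i]%type)^o.
Local Notation cfun := (cfun R S).
Local Notation A := (ell1_dyn R S).
Local Notation "a ** b" := (ell1_mul a b) (at level 40, left associativity).
Implicit Types (f g h : cfun) (a b c : A).

Lemma cfunDE f g x : (f + g) x = f x + g x. Proof. by []. Qed.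
Lemma cfunBE f g x : (f - g) x = f x - g x. Proof. by []. Qed.
Lemma cfunZE k f x : (k *: f) x = k * f x. Proof. by []. Qed.
Lemma cfun0E x : (0 : cfun) x = 0. Proof. by []. Qed.
Lemma cfunME f g x : cfun_mul f g x = f x * g x. Proof. by []. Qed.
Lemma cfun_cstE k x : cfun_cst S k x = k :> C. Proof. by []. Qed.
Lemma alphaE n f x : alpha n f x = f (act (- n) x). Proof. by []. Qed.

Lemma cfun_mulC f g : cfun_mul f g = cfun_mul g f.
Proof. by apply/cfunP => x; rewrite !cfunME mulrC. Qed.
Lemma cfun_mulA f g h : cfun_mul f (cfun_mul g h) = cfun_mul (cfun_mul f g) h.
Proof. by apply/cfunP => x; rewrite !cfunME mulrA. Qed.
Lemma cfun_mulDl f g h : cfun_mul (f + g) h = cfun_mul f h + cfun_mul g h.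
Proof. by apply/cfunP => x; rewrite cfunDE !cfunME cfunDE mulrDl. Qed.
Lemma cfun_mulDr f g h : cfun_mul h (f + g) = cfun_mul h f + cfun_mul h g.
Proof. by rewrite !(cfun_mulC h) cfun_mulDl. Qed.
Lemma cfun_mulZl k f g : cfun_mul (k *: f) g = k *: cfun_mul f g.
Proof. by apply/cfunP => x; rewrite cfunZE !cfunME cfunZE mulrA. Qed.
Lemma cfun_mulZr k f g : cfun_mul f (k *: g) = k *: cfun_mul f g.
Proof. by rewrite !(cfun_mulC f) cfun_mulZl. Qed.
Lemma cfun_mul0l f : cfun_mul 0 f = 0.
Proof. by apply/cfunP => x; rewrite cfunME cfun0E mul0r. Qed.
Lemma cfun_mul0r f : cfun_mul f 0 = 0.
Proof. by rewrite cfun_mulC cfun_mul0l. Qed.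

Lemma alpha0 f : alpha 0 f = f. Proof. by apply/cfunP. Qed.
Lemma alpha_alpha m n f : alpha m (alpha n f) = alpha (m + n) f.
Proof. by apply/cfunP => x; rewrite !alphaE -actD opprD addrC. Qed.
Lemma alpha_mul n f g : alpha n (cfun_mul f g) = cfun_mul (alpha n f) (alpha n g).
Proof. by apply/cfunP. Qed.
Lemma alphaD n f g : alpha n (f + g) = alpha n f + alpha n g.
Proof. by apply/cfunP. Qed.
Lemma alphaZ n k f : alpha n (k *: f) = k *: alpha n f.
Proof. by apply/cfunP. Qed.
Lemma alpha_z n : alpha n (0 : cfun) = 0. Proof. by apply/cfunP. Qed.

Lemma real_norm_cfun_le f (r : R) :
  (forall x, real_norm (f x : C) <= r) -> real_norm f <= r.
Proof. by move=> fr; apply: sup_norm_le => x; rewrite -(@real_normK _ C) lecR. Qed.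

Lemma real_norm_cfun_ge f x : real_norm (f x : C) <= real_norm f.
Proof. by rewrite -lecR (@real_normK _ C); exact: sup_norm_ge. Qed.

Lemma real_norm_cfun_cst (k : C) : real_norm (cfun_cst S k) = real_norm k.
Proof.
apply/eqP; rewrite eq_le real_norm_cfun_le //=.
by have [x _] := @space_nonempty S; have := real_norm_cfun_ge (cfun_cst S k) x.
Qed.

Lemma cfun_cvg (F : set_system cfun) : ProperFilter F -> cauchy F -> cvg F.
Proof. exact: cfun_complete. Qed.

Lemma ell1_mulE a b n :
  (a ** b) n = zsum (fun k => cfun_mul (a k) (alpha k (b (n - k)))).
Proof. by []. Qed.

Lemma conv_summable a b (n : int) :
  (l1_sum (fun k => cfun_mul (a k) (alpha k (b (n - k)%R))) < +oo)%E.
Proof.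
apply: (@l1_sum_lt_pinfty _ _ _ (real_norm a * real_norm b)) => s us.
rewrite (@le_trans _ _ (\sum_(k <- s) (real_norm (a k) * real_norm b))) //.
  apply: ler_sum => k _; rewrite (le_trans (real_norm_conv _ _ _)) //.
  by rewrite ler_wpM2l ?real_norm_ge0 // ell1_le.
by rewrite -mulr_suml ler_wpM2r ?real_norm_ge0 // l1_norm_ge.
Qed.

Lemma ell1_mulDl a b c : (a + b) ** c = a ** c + b ** c.
Proof.
apply/ell1_eqP => n; rewrite ell1D !ell1_mulE.
rewrite -(zsumD cfun_cvg (conv_summable _ _ _) (conv_summable _ _ _)).
by congr zsum; apply/funext => k; rewrite ell1D cfun_mulDl.
Qed.

Lemma ell1_mulDr a b c : c ** (a + b) = c ** a + c ** b.
Proof.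
apply/ell1_eqP => n; rewrite ell1D !ell1_mulE.
rewrite -(zsumD cfun_cvg (conv_summable _ _ _) (conv_summable _ _ _)).
by congr zsum; apply/funext => k; rewrite ell1D alphaD cfun_mulDr.
Qed.

Lemma ell1_mulZl k a b : (k *: a) ** b = k *: (a ** b).
Proof.
apply/ell1_eqP => n; rewrite ell1Z !ell1_mulE.
rewrite -(zsumZ cfun_cvg _ (conv_summable _ _ _)).
by congr zsum; apply/funext => m; rewrite ell1Z cfun_mulZl.
Qed.

Lemma ell1_mulZr k a b : a ** (k *: b) = k *: (a ** b).
Proof.
apply/ell1_eqP => n; rewrite ell1Z !ell1_mulE.
rewrite -(zsumZ cfun_cvg _ (conv_summable _ _ _)).
by congr zsum; apply/funext => m; rewrite ell1Z alphaZ cfun_mulZr.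
Qed.

Lemma ell1_mulNl a b : (- a) ** b = - (a ** b).
Proof. by rewrite -scaleN1r ell1_mulZl scaleN1r. Qed.
Lemma ell1_mulNr a b : a ** (- b) = - (a ** b).
Proof. by rewrite -scaleN1r ell1_mulZr scaleN1r. Qed.
Lemma ell1_mulBl a b c : (a - b) ** c = a ** c - b ** c.
Proof. by rewrite ell1_mulDl ell1_mulNl. Qed.
Lemma ell1_mulBr a b c : c ** (a - b) = c ** a - c ** b.
Proof. by rewrite ell1_mulDr ell1_mulNr. Qed.
Lemma ell1_mul0l a : 0 ** a = 0.
Proof. by have := ell1_mulZl 0 0 a; rewrite !scale0r. Qed.

Lemma real_norm_mul a b : real_norm (a ** b) <= real_norm a * real_norm b.
Proof.
apply: l1_norm_le => s us; rewrite -lee_fin -sumEFin.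
apply: (@le_trans _ _ (\sum_(n <- s) \esum_(k in [set: int])
    (real_norm (cfun_mul (a k) (alpha k (b (n - k)%R))))%:E)%E).
  apply: lee_sum => n _; rewrite -[leRHS]fineK ?ge0_fin_numE; last 2 first.
  - exact: conv_summable.
  - exact: l1_sum_ge0.
  by rewrite lee_fin; apply: (zsum_le cfun_cvg); exact: conv_summable.
rewrite -esum_sum; last by move=> *; rewrite lee_fin real_norm_ge0.
rewrite mulrC EFinM (l1_sumK a).
apply: le_trans (esumZ_le _ _); first last.
- by move=> k; rewrite lee_fin real_norm_ge0.
- exact: real_norm_ge0.
apply: le_esum => k _; rewrite sumEFin -EFinM lee_fin.
apply: (@le_trans _ _ (\sum_(n <- s) real_norm (a k) * real_norm (b (n - k)))).
  by apply: ler_sum => n _; exact: real_norm_conv.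
rewrite -mulr_sumr mulrC ler_wpM2r ?real_norm_ge0 //.
have := @l1_norm_ge _ _ b [seq n - k | n <- s]; rewrite big_map; apply.
by rewrite map_inj_uniq // => m n /addIr.
Qed.

Lemma single_mull m f b n : (single m f ** b) n = cfun_mul f (alpha m (b (n - m))).
Proof.
rewrite ell1_mulE (@zsum_supp1 _ _ m) ?singleE ?eqxx // => k km.
by rewrite singleE (negPf km) cfun_mul0l.
Qed.

Lemma single_mulr a m g n :
  (a ** single m g) n = cfun_mul (a (n - m)) (alpha (n - m) g).
Proof.
rewrite ell1_mulE (@zsum_supp1 _ _ (n - m)) ?singleE ?subKr ?eqxx // => k km.
rewrite singleE (_ : (_ == _) = false) ?alpha_z ?cfun_mul0r //.
by apply: contraNF km => /eqP <-; rewrite subKr.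
Qed.

Lemma single_mul m n f g :
  single m f ** single n g = single (m + n) (cfun_mul f (alpha m g)).
Proof.
apply/ell1_eqP => k; rewrite single_mull !singleE subr_eq addrC.
by case: ifP => // _; rewrite alpha_z cfun_mul0r.
Qed.

(** Both sides are bounded and additive in each factor, so density applied three times reduces the
    identity to elements [single n f]; no double series has to be rearranged. *)
Lemma ell1_mulA a b c : a ** (b ** c) = a ** b ** c.
Proof.
have le3 a' b' c' : real_norm (a' ** (b' ** c') - a' ** b' ** c') <=
    2 * (real_norm a' * real_norm b' * real_norm c').
  rewrite mulr_natl mulr2n (le_trans (real_normB _ _)) // lerD //.
    by rewrite (le_trans (real_norm_mul _ _)) // -mulrA ler_wpM2l ?real_norm_ge0 // real_norm_mul.
  by rewrite (le_trans (real_norm_mul _ _)) // ler_wpM2r ?real_norm_ge0 // real_norm_mul.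
apply/subr0_eq.
apply: (@ell1_eq0 _ _ _ (fun a => a ** (b ** c) - a ** b ** c)
  (2 * real_norm b * real_norm c)).
- by move=> a1 a2; rewrite !ell1_mulDl opprD addrACA.
- by move=> a'; rewrite (le_trans (le3 _ _ _)) //; lra.
move=> m f {a}; set a := single m f.
apply: (@ell1_eq0 _ _ _ (fun b => a ** (b ** c) - a ** b ** c)
  (2 * real_norm a * real_norm c)).
- by move=> b1 b2; rewrite !(ell1_mulDl, ell1_mulDr) opprD addrACA.
- by move=> b'; rewrite (le_trans (le3 _ _ _)) //; lra.
move=> n g {b}; set b := single n g.
apply: (@ell1_eq0 _ _ _ (fun c => a ** (b ** c) - a ** b ** c)
  (2 * real_norm a * real_norm b)).
- by move=> c1 c2; rewrite !ell1_mulDr opprD addrACA.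
- by move=> c'; rewrite (le_trans (le3 _ _ _)) //; lra.
move=> k h; rewrite /a /b !single_mul alpha_mul alpha_alpha cfun_mulA addrA.
by rewrite subrr.
Qed.

Definition one : A := single 0 (cfun_cst S (1 : C)).

Lemma cfun_mul1l f : cfun_mul (cfun_cst S (1 : C)) f = f.
Proof. by apply/cfunP => x; rewrite cfunME cfun_cstE mul1r. Qed.

Lemma ell1_mul1l a : one ** a = a.
Proof. by apply/ell1_eqP => n; rewrite single_mull subr0 alpha0 cfun_mul1l. Qed.

Lemma ell1_mul1r a : a ** one = a.
Proof.
apply/ell1_eqP => n; rewrite single_mulr subr0; apply/cfunP => x.
by rewrite cfunME alphaE cfun_cstE mulr1.
Qed.

Lemma real_norm_one : real_norm one = 1.
Proof. by rewrite real_norm_single real_norm_cfun_cst real_norm1. Qed.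

(** Geometric series. A left inverse is the form that representations use: it turns [pi t v = v]
    into [v = 0]. Completeness of the algebra enters only here. *)
Lemma neumann (t : A) : real_norm t < 1 -> exists2 c : A,
  c ** (one - t) = one & real_norm c <= (1 - real_norm t)^-1.
Proof.
set r := real_norm t => r1; have r0 : 0 <= r by exact: real_norm_ge0.
pose pw k := iter k (fun a => a ** t) one.
have pwr k : real_norm (pw k) <= r ^+ k.
  elim: k => [|k IH]; first by rewrite real_norm_one.
  by rewrite exprSr (le_trans (real_norm_mul _ _)) // ler_wpM2r.
pose s N := \sum_(0 <= k < N) pw k.
have d0 : 0 < 1 - r by rewrite subr_gt0.
have sNM N M : (N <= M)%N -> real_norm (s M - s N) <= r ^+ N / (1 - r).
  move=> NM; rewrite /s (@big_cat_nat _ _ _ N) //= addrAC subrr add0r.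
  rewrite (le_trans (real_norm_sum _ _ _)) //.
  rewrite (@le_trans _ _ (\sum_(N <= k < M) r ^+ k)) ?ler_sum // ler_pdivlMr //.
  rewrite mulr_suml (eq_bigr (fun k => - r ^+ k.+1 - - r ^+ k)); last first.
    by move=> k _; rewrite exprS; ring.
  by rewrite telescope_sumr // opprK gerDr oppr_le0 exprn_ge0.
have rN : (fun N => r ^+ N) @ \oo --> 0 by apply: cvg_expr; rewrite ger0_norm.
have [||b bP] := @ell1_complete _ _ cfun_cvg s (fun N => r ^+ N / (1 - r)).
- exact: sNM.
- by rewrite -[X in _ --> X](mul0r (1 - r)^-1); apply: cvgM => //; exact: cvg_cst.
have sE N : s N ** (one - t) = one - pw N.
  elim: N => [|N IH]; first by rewrite /s big_geq // ell1_mul0l subrr.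
  rewrite /s big_nat_recr //= -/(s N) ell1_mulDl IH ell1_mulBr ell1_mul1r.
  by rewrite addrA subrK.
exists b; last by have := bP 0%N; rewrite /s big_geq // subr0 expr0 mul1r.
apply/subr0_eq/real_norm_small => e e0.
(* b (1 - t) - 1 equals (b - s N) (1 - t) - t^N, whose norm is at most r^N K. *)
pose K := (1 - r)^-1 * real_norm (one - t) + 1.
have K0 : 0 < K by rewrite ltr_wpDl // mulr_ge0 ?real_norm_ge0 // invr_ge0 ltW.
move/cvgrPdist_le : rN => /(_ _ (divr_gt0 e0 K0)) [N _ /(_ N (leqnn N))].
rewrite sub0r normrN ger0_norm ?exprn_ge0 // ler_pdivlMr // => /(le_trans _); apply.
rewrite -(subrK (s N) b) ell1_mulDl sE -addrA [one - _ - _]addrAC subrr add0r.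
apply: le_trans (real_normB _ _) _.
rewrite [r ^+ N * K]mulrDr mulr1; apply: lerD; last exact: pwr.
by rewrite (le_trans (real_norm_mul _ _)) // mulrA ler_wpM2r ?real_norm_ge0.
Qed.

End Convolution.

(** * Periodic and aperiodic points *)

Section Periods.
Variable S : dynamical_system.
Implicit Types (x y : S) (p : nat).

Lemma act_mulz (p m : int) x : act p x = x -> act (m * p) x = x.
Proof.
move=> px; elim/int_ind: m => [|m IH|m IH]; first by rewrite mul0r.
  by rewrite -addn1 PoszD mulrDl mul1r actD px.
rewrite -addn1 PoszD opprD mulrDl actD (_ : act (-1 * p) x = x) //.
by rewrite mulN1r -{1}px actK.
Qed.

Lemma act_modz (p n : int) x : act p x = x -> act n x = act (n %% p)%Z x.
Proof. by move=> px; rewrite {1}(divz_eq n p) addrC actD act_mulz. Qed.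

Lemma finite_orbit p x : (0 < p)%N -> act p x = x ->
  orbit x = (fun j : nat => act j x) @` `I_p.
Proof.
move=> p0 px; apply/seteqP; split => [_ [n _ <-]|_ [j _ <-]]; last by exists j.
have m0 : (n %% p)%Z >= 0 by rewrite modz_ge0 //; case: p p0 {px}.
exists `|(n %% p)%Z|%N; last by rewrite gez0_abs // -act_modz.
by rewrite /= -ltz_nat gez0_abs // ltz_mod //; case: p p0 {px m0}.
Qed.

Lemma perP x : per S x <-> exists2 p, (0 < p)%N & act p x = x.
Proof.
split => [xper|[p p0 px]]; last first.
  by rewrite /per /= (finite_orbit p0 px); apply: finite_image.
apply: contrapT => /forall2NP nper; apply: infinite_nat.
have -> : [set: nat] = (fun n : nat => act n x) @^-1` (orbit x).
  by apply/seteqP; split => // n _; exists n.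
apply: finite_preimage xper.
suff mn (m n : nat) : (m < n)%N -> act m x <> act n x.
  move=> m n _ _ /= e; have [/mn //|/mn h|//] := ltngtP m n.
  by case: h.
move=> lmn e; have [|] := nper (n - m)%N; first by rewrite subn_gt0.
by apply; rewrite -subzn ?(ltnW lmn) // addrC actD -e actK.
Qed.

Lemma aperP x : aper S x <-> forall p, (0 < p)%N -> act p x <> x.
Proof.
split => [xa p p0 px|xp xper]; first by apply: xa; apply/perP; exists p.
by have /perP[p p0] := xper; exact: xp.
Qed.

Lemma per_aper x : per S x \/ aper S x.
Proof. exact: lem. Qed.

Lemma per_has_period x : per S x -> exists p, has_period x p.
Proof.
move=> /perP[p p0 px].
have ex : exists p, (0 < p)%N && `[< act p x = x >].
  by exists p; rewrite p0; apply/asboolP.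
exists (ex_minn ex); case: ex_minnP => q /andP[q0 /asboolP qx] qmin; split => //.
move=> r /andP[r0 rq] rx; have := qmin r; rewrite r0 /= leqNgt rq => h.
by have : false by apply: h; apply/asboolP.
Qed.

Lemma has_period_per x p : has_period x p -> per S x.
Proof. by move=> [p0 px _]; apply/perP; exists p. Qed.

Lemma has_period_inj x p (i j : nat) : has_period x p -> (i < p)%N -> (j < p)%N ->
  act i x = act j x -> i = j.
Proof.
move=> [p0 px pmin]; wlog ij : i j / (i <= j)%N => [hw ip jp e|ip jp e].
  have [ij|/ltnW ji] := leqP i j; first exact: hw.
  by apply/esym/hw.
apply/eqP; rewrite eqn_leq ij /= leqNgt; apply/negP => lij.
apply: (pmin (j - i)%N); first by rewrite subn_gt0 lij (leq_ltn_trans (leq_subr _ _)).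
by rewrite -subzn // addrC actD -e actK.
Qed.

Lemma has_period_orbit x p n : has_period x p -> has_period (act n x) p.
Proof.
move=> [p0 px pmin]; split => //; first by rewrite -actD addrC actD px.
by move=> q /pmin qx; rewrite -actD addrC actD => /(can_inj (@actK _ _)).
Qed.

Lemma orbit_act n x : orbit (act n x) = orbit x.
Proof.
apply/seteqP; split => [_ [m _ <-]|_ [m _ <-]]; first by exists (m + n); rewrite ?actD.
by exists (m - n) => //; rewrite -actD subrK.
Qed.

Lemma orbit_self x : orbit x x. Proof. by exists 0. Qed.

Lemma per_act n x : per S x -> per S (act n x).
Proof. by rewrite /per /= orbit_act. Qed.

Lemma orbit_closed x : per S x -> closed (orbit x).
Proof.
have acc := hausdorff_accessible (@space_hausdorff S).
by move/(iffLR accessible_finite_set_closed): acc; apply.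
Qed.

Lemma closure_orbit_per x : per S x -> closure (orbit x) = orbit x.
Proof. by move=> /orbit_closed/closure_id <-. Qed.

End Periods.

(** * Urysohn functions and Baire's theorem *)

Section Separation.
Variables (R : realType) (S : dynamical_system).
Local Notation C := (R[i]%type)^o.
Implicit Types (x y : S) (f : cfun R S).

Lemma real_continuous (g : S -> R) : continuous g ->
  continuous (fun x => (g x)%:C%C : C).
Proof.
move=> gc x; apply: real_norm_cvg => e e0.
move/cvgrPdist_le : (gc x) => /(_ _ e0); apply: filterS => y.
by rewrite -rmorphB real_norm_real.
Qed.

Lemma real_norm_continuous f : continuous (fun x => real_norm (f x : C)).
Proof. by move=> x; apply: cvg_real_norm_comp; exact: cts_fun. Qed.

Lemma cfun_separation (A : set S) x : closed A -> ~ A x -> exists f : cfun R S,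
  [/\ f x = 1, forall y, A y -> f y = 0 & forall y, real_norm (f y : C) <= 1].
Proof.
move=> Acl Ax.
have nS := compact_normal (@space_hausdorff S) (@space_compact S).
have cx : closed [set x].
  exact: (accessible_closed_set1 (hausdorff_accessible (@space_hausdorff S))).
have Ax0 : A `&` [set x] = set0.
  by apply/seteqP; split => // y [Ay yx]; apply: Ax; rewrite -yx.
have /(@uniform_separatorP _ R)[g [gc g01 g0 g1]] :=
  iffLR (@normal_separatorP R S) nS _ _ Acl cx Ax0.
exists (cfun_of (real_continuous gc)); split => /=.
- by rewrite /mkcts; congr (_%:C%C); apply: g1; exists x.
- by move=> y Ay; rewrite /mkcts; congr (_%:C%C); apply: g0; exists y.
move=> y; rewrite /mkcts real_norm_real.
have : `[0, 1]%classic (g y) by apply: g01; exists y.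
by rewrite /= in_itv /= => /andP[g0' g1']; rewrite ger0_norm.
Qed.

End Separation.

Section Baire.
Variables (S : dynamical_system) (Y : set S).
Hypothesis Y_closed : closed Y.

(** Baire's theorem inside the compact set [Y], phrased with open sets of the whole space so that no
    subspace topology is involved. Regularity supplies open sets with nested closures. *)
Lemma baire_closed (U : nat -> set S) (V : set S) :
  (forall n, open (U n)) ->
  (forall n W, open W -> W `&` Y !=set0 -> W `&` U n `&` Y !=set0) ->
  open V -> V `&` Y !=set0 -> exists x, [/\ V x, Y x & forall n, U n x].
Proof.
move=> Uo Ud Vo VY.
have step n (W : {W : set S | open W /\ W `&` Y !=set0}) :
    {W' : {W : set S | open W /\ W `&` Y !=set0} |
      closure (sval W') `<=` sval W `&` U n}.
  apply: cid; case: W => W [Wo WY] /=.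
  have [x [WUx Yx]] := Ud n W Wo WY.
  have nx : nbhs x (W `&` U n).
    by apply: open_nbhs_nbhs; split => //; exact: openI.
  have [B Bx BWU] := compact_regular (@space_hausdorff S) (@space_compact S)
    filterT nx.
  have [B' [B'o B'x] B'B] : exists2 B', open_nbhs x B' & B' `<=` B.
    by move: Bx; rewrite nbhsE => -[B' ? ?]; exists B'.
  unshelve eexists (exist _ B' _); first by split => //; exists x.
  by apply: subset_trans BWU => /=; exact: closureS.
pose W := fix W n := if n is m.+1 then sval (step m (W m)) else exist _ V (conj Vo VY).
have WS n : closure (sval (W n.+1)) `<=` sval (W n) `&` U n.
  by rewrite /=; exact: (svalP (step n (W n))).
have Wdec m n : (m <= n)%N -> sval (W n) `<=` sval (W m).
  elim: n => [|n IH]; first by rewrite leqn0 => /eqP ->.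
  rewrite leq_eqVlt => /predU1P[->//|/IH h]; apply: subset_trans h.
  by move=> x /subset_closure/WS[].
have [x xP] : {x : nat -> S | forall n, (sval (W n) `&` Y) (x n)}.
  have h n : {x | (sval (W n) `&` Y) x} by apply: cid; case: (svalP (W n)).
  by exists (fun n => sval (h n)) => n; exact: (svalP (h n)).
(* A cluster point of the chosen points lies in the closure of every [W n], hence in every [U n]. *)
have [] := @space_compact S (x @ \oo) _ filterT.
move=> z [_ zx]; exists z.
have zW n : closure (sval (W n)) z.
  move=> N Nz; apply: zx => //; exists n => // m /= nm.
  by apply: (Wdec n m) => //; case: (xP m).
split.
- by have [] := WS 0%N z (zW 1%N).
- apply: Y_closed => N Nz; apply: zx => //; exists 0%N => // m _.
  by case: (xP m).
- by move=> n; have [] := WS n z (zW n.+1).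
Qed.

End Baire.

(** * Supports of irreducible representations *)

Section CfunExtras.
Variables (R : realType) (S : dynamical_system).
Local Notation C := (R[i]%type)^o.
Implicit Types (f g : cfun R S).

Lemma conj_continuous f : continuous (fun x => conjc (f x) : C).
Proof.
move=> x; apply: real_norm_cvg => e e0.
have fx : f y @[y --> x] --> (f x : C) by exact: cts_fun.
apply: filterS (cvg_real_norm fx e0) => y; apply: le_trans.
by rewrite -rmorphB -lecR !(@Defs.real_normK _ C) normcJ.
Qed.

Definition cfun_conj f : cfun R S := cfun_of (@conj_continuous f).

(** On vectors concentrated where [f] is small, [f] acts like [f'], whose norm is small everywhere.
    The factor is e / max(|f|, e). *)
Lemma truncate f (e : R) : 0 < e -> exists f' : cfun R S,
  real_norm f' <= e /\ forall x, real_norm (f x : C) <= e -> f' x = f x.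
Proof.
move=> e0; pose m x := Num.max (real_norm (f x : C)) e.
have m0 x : 0 < m x by rewrite lt_max e0 orbT.
have mc : continuous (fun x => e / m x).
  move=> x; apply: cvgM; first exact: cvg_cst.
  apply: cvgV; first by rewrite gt_eqF.
  rewrite /m; under eq_fun do rewrite maxr_absE.
  rewrite maxr_absE; have fx := @real_norm_continuous _ _ f x.
  apply: cvgM; last exact: cvg_cst.
  apply: cvgD; first by apply: cvgD => //; exact: cvg_cst.
  by apply: cvg_norm; apply: cvgB => //; exact: cvg_cst.
exists (cfun_mul f (cfun_of (real_continuous mc))); split.
  apply: real_norm_cfun_le => x.
  rewrite cfunME real_normM /= /mkcts real_norm_real ger0_norm; last first.
    by rewrite divr_ge0 // ltW.
  by rewrite mulrCA ger_pMr // ler_pdivrMr // mul1r /m le_max lexx.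
move=> x fe; rewrite cfunME /= /mkcts /m max_r // divff ?gt_eqF //.
by rewrite mulr1.
Qed.

End CfunExtras.

Section RepresentationBasics.
Variables (R : realType) (S : dynamical_system).
Variables (E : lmodType R[i]) (pi : representation S E).
Local Notation C := (R[i]%type)^o.
Local Notation cfun := (cfun R S).
Local Notation A := (ell1_dyn R S).
Local Notation "a ** b" := (ell1_mul a b) (at level 40, left associativity).
Implicit Types (f g h : cfun) (a b c : A) (v w : E).

Lemma repDl a b v : pi (a + b) v = pi a v + pi b v.
Proof. by have := rep_linearl pi v 1 a b; rewrite !scale1r. Qed.
Lemma repZl k a v : pi (k *: a) v = k *: pi a v.
Proof. by have := rep_linearl pi v k a 0; rewrite rep0l !addr0. Qed.
Lemma repNl a v : pi (- a) v = - pi a v.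
Proof. by rewrite -[- a]scaleN1r repZl scaleN1r. Qed.
Lemma repBl a b v : pi (a - b) v = pi a v - pi b v.
Proof. by rewrite repDl repNl. Qed.
Lemma repDr a v w : pi a (v + w) = pi a v + pi a w.
Proof. by have := rep_linearr pi a 1 v w; rewrite !scale1r. Qed.
Lemma repZr k a v : pi a (k *: v) = k *: pi a v.
Proof. by have := rep_linearr pi a k v 0; rewrite rep0r !addr0. Qed.
Lemma repNr a v : pi a (- v) = - pi a v.
Proof. by rewrite -[- v]scaleN1r repZr scaleN1r. Qed.
Lemma repBr a v w : pi a (v - w) = pi a v - pi a w.
Proof. by rewrite repDr repNr. Qed.
Lemma rep_suml (I : Type) (s : seq I) (P : pred I) (F : I -> A) v :
  pi (\sum_(i <- s | P i) F i) v = \sum_(i <- s | P i) pi (F i) v.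
Proof.
by apply: (big_morph (fun a => pi a v)) => [a b|]; rewrite ?repDl ?rep0l.
Qed.
Lemma rep_sumr (I : Type) (s : seq I) (P : pred I) a (F : I -> E) :
  pi a (\sum_(i <- s | P i) F i) = \sum_(i <- s | P i) pi a (F i).
Proof.
by apply: (big_morph (pi a)) => [v w|]; rewrite ?repDr ?rep0r.
Qed.

Definition dl n : A := single n (cfun_cst S (1 : C)).

Lemma deltaE : delta R S = dl 1. Proof. by []. Qed.
Lemma oneE : one R S = dl 0. Proof. by []. Qed.

Lemma alpha_cst n (k : C) : alpha n (cfun_cst S k) = cfun_cst S k.
Proof. exact/cfunP. Qed.

Lemma cfun_mul1r f : cfun_mul f (cfun_cst S (1 : C)) = f.
Proof. by rewrite cfun_mulC cfun_mul1l. Qed.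

Lemma dlD m n : dl m ** dl n = dl (m + n).
Proof. by rewrite single_mul alpha_cst cfun_mul1l. Qed.

Lemma single_embed n f : single n f = embed f ** dl n.
Proof. by rewrite single_mul add0r alpha_cst cfun_mul1r. Qed.

Lemma dl_embed n f : dl n ** embed f = single n (alpha n f).
Proof. by rewrite single_mul addr0 cfun_mul1l. Qed.

Lemma embedE f n : embed f n = if n == 0 then f else 0. Proof. by []. Qed.

Lemma embedM f g : embed f ** embed g = embed (cfun_mul f g).
Proof. by rewrite single_mul addr0 alpha0. Qed.

Lemma embedD f g : embed (f + g) = embed f + embed g. Proof. exact: singleD. Qed.
Lemma embedZ k f : embed (k *: f) = k *: embed f. Proof. exact: singleZ. Qed.

Lemma embed_cst (k : C) : embed (cfun_cst S k) = k *: one R S.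
Proof.
by rewrite -singleZ; congr single; apply/cfunP => x; rewrite cfunZE mulr1.
Qed.

Hypothesis irr : algebraically_irreducible pi.

Lemma rep1 v : pi (one R S) v = v.
Proof.
have [->|v0] := pselect (v = 0); first by rewrite rep0r.
have [a av] := irreducible_cyclic irr v0 v.
by rewrite -{1}av -rep_mul ell1_mul1l.
Qed.

(** The replacement for a norm on the representation space: apply to [v] a left inverse of
    [one - t]. *)
Lemma rep_small (t : A) v : real_norm t < 1 -> pi t v = v -> v = 0.
Proof.
move=> /neumann[c cP _] tv.
by rewrite -[LHS]rep1 -cP rep_mul repBl rep1 tv subrr rep0r.
Qed.

(** Annihilators of vectors are closed, which is automatic continuity in disguise: if [pi a v] were
    nonzero, some [c] would bring it back to [v], and then [c ** (a - b)] would fix [v] while having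
    norm below 1. *)
Lemma rep_closed a v :
  (forall e, 0 < e -> exists2 b, real_norm (a - b) < e & pi b v = 0) ->
  pi a v = 0.
Proof.
move=> av; apply: contrapT => w0.
have [c cw] := irreducible_cyclic irr w0 v.
have K0 : 0 < real_norm c + 1 by rewrite ltr_wpDl // real_norm_ge0.
have [|b ab bv] := av (real_norm c + 1)^-1; first by rewrite invr_gt0.
have /rep_small v0 : real_norm (c ** (a - b)) < 1.
  rewrite (le_lt_trans (real_norm_mul _ _)) //.
  have [->|c0] := eqVneq (real_norm c) 0; first by rewrite mul0r.
  have cp : 0 < real_norm c by rewrite lt_neqAle eq_sym c0 real_norm_ge0.
  rewrite (@lt_trans _ _ (real_norm c * (real_norm c + 1)^-1)) ?ltr_pM2l //.
  by rewrite ltr_pdivrMr // mul1r ltrDl.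
by apply: w0; rewrite (v0 v) ?rep0r // rep_mul repBl bv subr0 cw.
Qed.

Lemma rep_coef0 a v : (forall n, pi (single n (a n)) v = 0) -> pi a v = 0.
Proof.
move=> av; apply: rep_closed => e /(ell1_approx a)[s se].
by exists (\sum_(n <- s) single n (a n)) => //; rewrite rep_suml big1.
Qed.

Lemma rep_kerN1 : ~ forall v, pi (one R S) v = 0.
Proof.
move=> k1; have [[a [v av]] _] := irr.
by apply: av; rewrite -[v]rep1 k1 rep0r.
Qed.

Lemma dlK n v : pi (dl (- n)) (pi (dl n) v) = v.
Proof. by rewrite -rep_mul dlD addNr rep1. Qed.
Lemma dlVK n v : pi (dl n) (pi (dl (- n)) v) = v.
Proof. by rewrite -rep_mul dlD subrr rep1. Qed.

Definition kerC : set cfun := [set f | forall v, pi (embed f) v = 0].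

Lemma kerC_mul f g : kerC g -> kerC (cfun_mul f g).
Proof. by move=> gk v; rewrite -embedM rep_mul gk rep0r. Qed.

Lemma kerCD f g : kerC f -> kerC g -> kerC (f + g).
Proof. by move=> fk gk v; rewrite embedD repDl fk gk addr0. Qed.

Lemma kerC_closed f :
  (forall e, 0 < e -> exists2 g, kerC g & real_norm (f - g) < e) -> kerC f.
Proof.
move=> fk v; apply: rep_closed => e /fk[g gk fg]; exists (embed g) => //.
by rewrite -[- embed g]scaleN1r -embedZ scaleN1r -embedD real_norm_single.
Qed.

Lemma kerC_alpha n f : kerC f -> kerC (alpha n f).
Proof.
move=> fk v; have -> : embed (alpha n f) = dl n ** embed f ** dl (- n).
  by rewrite dl_embed single_mul subrr alpha_cst cfun_mul1r.
by rewrite !rep_mul fk rep0r.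
Qed.

Definition zeros : set S := [set x | forall f, kerC f -> f x = 0].

Lemma zeros_closed : closed zeros.
Proof.
move=> x xz f fk; apply: (@real_norm_small _ C) => e e0.
have fx : f y @[y --> x] --> (f x : C) by exact: cts_fun.
have [y [yz]] := xz _ (cvg_real_norm fx e0).
by rewrite /= (yz f fk) subr0.
Qed.

(* The nonnegative elements of the kernel are directed upwards, so compactness
   yields one that is at least 1 wherever |f| is not small. *)
Lemma kerC_large (K : set S) : closed K -> (forall x, K x -> ~ zeros x) ->
  exists G, [/\ kerC G, forall x, 0 <= (G x : C) & forall x, K x -> 1 <= (G x : C)].
Proof.
move=> Kcl Kz; pose J := [set G : cfun | kerC G /\ forall x, 0 <= (G x : C)].
pose F := filter_from J (fun G0 => [set G | J G /\ forall x, (G0 x : C) <= G x]).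
have FF : Filter F.
  apply: filter_from_filter.
    exists 0; split => [v|x]; last by rewrite cfun0E.
    by rewrite /embed single0 rep0l.
  move=> G1 G2 [k1 p1] [k2 p2]; exists (G1 + G2).
    by split; [exact: kerCD | move=> x; rewrite cfunDE addr_ge0].
  move=> G [JG Gle]; split; split => // x; apply: le_trans (Gle x).
    by rewrite cfunDE lerDl.
  by rewrite cfunDE lerDr.
have Kco : compact K by exact: (subclosed_compact Kcl (@space_compact S)).
have := (iffLR (compact_near_coveringP _) Kco) cfun F (fun G x => 1 <= (G x : C)) FF.
case=> [x /Kz /existsNP[g /not_implyP[gk /eqP gx]]|G0 [k0 p0] GK]; last first.
  by exists G0; split => // x Kx; apply: (GK G0) => //; split => // y.
have gx0 : 0 < real_norm (g x : C).
  rewrite lt_neqAle real_norm_ge0 andbT eq_sym; apply: contra gx.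
  by move=> /eqP/real_norm_eq0 ->.
(* The value 2 at [x], rather than 1, keeps |g'| above 1 on a whole neighbourhood of [x]. *)
pose g' : cfun := (2 / real_norm (g x : C))%:C%C *: g.
pose G : cfun := cfun_mul (cfun_conj g') g'.
have GE y : G y = (real_norm (g' y : C) ^+ 2)%:C%C.
  by rewrite cfunME /= /mkcts mulrC -normCK rmorphXn /= (@Defs.real_normK _ C).
have g'x : real_norm (g' x : C) = 2.
  rewrite cfunZE real_normM real_norm_real ger0_norm ?divfK ?gt_eqF //.
  by rewrite divr_ge0 // ltW.
exists ([set y | 1 < real_norm (g' y : C)],
        [set G1 : cfun | J G1 /\ forall y, (G y : C) <= G1 y]).
  split => /=; last first.
    exists G => //; split => [|y]; last by rewrite GE lecR sqr_ge0.
    by apply: kerC_mul => v; rewrite embedZ repZl gk scaler0.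
  have : nbhs (real_norm (g' x : C)) [set r : R | 1 < r].
    by apply: open_nbhs_nbhs; split; [exact: open_gt | rewrite /= g'x ltr1n].
  exact: real_norm_continuous.
move=> [y G1] /= [y1 [_ G1y]]; apply: le_trans (G1y y).
have {}y1 : 1 < real_norm (g' y : C) by exact: y1.
by rewrite -[X in _ <= X]/(G y) GE -[1]/(1%:C%C) lecR exprn_ege1 // ltW.
Qed.

(** Closed ideals of continuous functions are determined by their zeros. With [G] from [kerC_large],
    the function f G / (G + d) is in the ideal and differs from [f] by f d / (G + d). *)
Lemma zerosP f : (forall x, zeros x -> f x = 0) -> kerC f.
Proof.
move=> f0; apply: kerC_closed => e e0; have e20 : 0 < e / 2 by rewrite divr_gt0.
pose K := [set x | e / 2 <= real_norm (f x : C)].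
have Kcl : closed K.
  rewrite (_ : K = (fun x => real_norm (f x : C)) @^-1` [set r | e / 2 <= r]) //.
  apply: preimage_closed; last exact: closed_ge.
  by move=> x _; exact: real_norm_continuous.
have [|G [Gk G0 GK]] := kerC_large Kcl.
  by move=> x Kx /f0 fx; move: Kx; rewrite /K /= fx real_norm0 leNgt e20.
have GE x : (real_norm (G x : C))%:C%C = G x.
  by rewrite (@Defs.real_normK _ C) ger0_norm.
(* Off [K] the error is at most |f| < e / 2; on [K], where G >= 1, it is at most |f| d, which this
   choice keeps below e / 2. *)
pose d := e / 2 / (real_norm f + 1).
have f1 : 0 < real_norm f + 1 by rewrite ltr_wpDl // real_norm_ge0.
have d0 : 0 < d by rewrite divr_gt0.
have Gd0 x : 0 < real_norm (G x : C) + d by rewrite ltr_wpDl // real_norm_ge0.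
have qc : continuous (fun x => (real_norm (G x : C) + d)^-1).
  move=> x; apply: cvgV; first by rewrite gt_eqF.
  by apply: cvgD; [exact: real_norm_continuous | exact: cvg_cst].
pose q := cfun_of (real_continuous qc).
exists (cfun_mul (cfun_mul f q) G); first exact: kerC_mul.
apply: (@le_lt_trans _ _ (e / 2)); last by rewrite gtr_pMr // invf_lt1 ?ltr1n.
apply: real_norm_cfun_le => x.
have -> : (f - cfun_mul (cfun_mul f q) G) x =
    f x * (d / (real_norm (G x : C) + d))%:C%C.
  have qE : q x = ((real_norm (G x : C) + d)^-1)%:C%C :> R[i] by [].
  rewrite cfunBE !cfunME qE -[X in _ * _ * X]GE.
  have -> : d / (real_norm (G x : C) + d) =
      1 - (real_norm (G x : C) + d)^-1 * real_norm (G x : C).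
    have fr r t : r + t != 0 -> t / (r + t) = 1 - (r + t)^-1 * r :> R.
      by move=> ?; field.
    by apply: fr; rewrite gt_eqF.
  by rewrite rmorphB rmorphM rmorph1; ring.
rewrite real_normM real_norm_real ger0_norm; last by rewrite divr_ge0 // ltW.
have [Kx|nKx] := pselect (K x); last first.
  rewrite (le_trans (ler_piMr (real_norm_ge0 _) _)) //.
    by rewrite ler_pdivrMr // mul1r lerDr real_norm_ge0.
  by move/negP: nKx; rewrite -ltNge => /ltW.
have G1 : 1 <= real_norm (G x : C) by rewrite -lecR GE GK.
rewrite (@le_trans _ _ (real_norm (f x : C) * d)) //.
  rewrite ler_wpM2l ?real_norm_ge0 // ler_pdivrMr // ler_pMr //.
  by rewrite (le_trans G1) // lerDl ltW.
rewrite /d mulrCA ger_pMr // ler_pdivrMr // mul1r.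
by rewrite (le_trans (real_norm_cfun_ge _ _)) // lerDl.
Qed.

Lemma rep_supportP : is_rep_support pi (rep_support pi).
Proof.
apply: getPex; exists zeros; split; first exact: zeros_closed.
apply/seteqP; split => f; last exact: zerosP.
by move=> fk x; apply.
Qed.

End RepresentationBasics.

(** * Topological transitivity and isolation of coefficients *)

Section Support.
Variables (R : realType) (S : dynamical_system).
Variables (E : lmodType R[i]) (pi : representation S E).
Local Notation C := (R[i]%type)^o.
Local Notation cfun := (cfun R S).
Local Notation A := (ell1_dyn R S).
Local Notation "a ** b" := (ell1_mul a b) (at level 40, left associativity).
Implicit Types (f g h : cfun) (a b c : A) (v w : E).
Hypothesis irr : algebraically_irreducible pi.
Variable Y : set S.
Hypothesis YP : is_rep_support pi Y.

Lemma support_closed : closed Y. Proof. by case: YP. Qed.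

Lemma supportE f : kerC pi f <-> forall x, Y x -> f x = 0.
Proof.
by case: YP => _ YE; rewrite -[kerC pi f]/([set f | forall v, pi (embed f) v = 0] f) YE.
Qed.

Lemma support_coef a v : (forall n x, Y x -> a n x = 0) -> pi a v = 0.
Proof.
move=> aY; apply: rep_coef0 => // n; rewrite single_embed rep_mul.
by move/supportE : (aY n); apply.
Qed.

Lemma support_bump f x : Y x -> f x != 0 -> exists v, pi (embed f) v <> 0.
Proof.
move=> Yx fx; apply/existsNP => fk; move/supportE : fk => /(_ x Yx) f0.
by rewrite f0 eqxx in fx.
Qed.

Lemma support_act n x : Y x -> Y (act n x).
Proof.
move=> Yx; apply: contrapT => /(cfun_separation R support_closed)[f [f1 f0 _]].
have /(kerC_alpha (- n))/supportE : kerC pi f by exact/supportE.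
by move=> /(_ x Yx)/eqP; rewrite alphaE opprK f1 oner_eq0.
Qed.

Lemma support_nonempty : Y !=set0.
Proof.
apply/set0P/eqP => Y0; apply: (rep_kerN1 irr) => v.
by have /supportE : forall x, Y x -> cfun_cst S (1 : C) x = 0; [rewrite Y0 | apply].
Qed.

(** Bumps [f] on [U] and [g] on [V] act as nonzero operators, so irreducibility gives an [a] with f
    a g acting nontrivially. If no orbit went from [U] to [V] within [Y], every coefficient of f a g
    would vanish on [Y]. *)
Lemma support_transitive (U V : set S) : open U -> open V ->
  U `&` Y !=set0 -> V `&` Y !=set0 ->
  exists n y, [/\ Y y, U y & V (act n y)].
Proof.
move=> Uo Vo [x [Ux Yx]] [y [Vy Yy]].
have [|f [f1 f0 _]] := @cfun_separation R S (~` U) x (open_closedC Uo); first by apply.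
have [|g [g1 g0 _]] := @cfun_separation R S (~` V) y (open_closedC Vo); first by apply.
have [w fw] : exists w, pi (embed f) w <> 0.
  by apply: (support_bump Yx); rewrite f1 oner_eq0.
have [v gv] : exists v, pi (embed g) v <> 0.
  by apply: (support_bump Yy); rewrite g1 oner_eq0.
have [a av] := irreducible_cyclic irr gv w.
apply: contrapT => UV; apply: fw; rewrite -av -!rep_mul.
apply: support_coef => n z Yz.
rewrite single_mulr subr0 single_mull subr0 alpha0 !cfunME alphaE.
have [Uz|Uz] := pselect (U z); last by rewrite f0 // !mul0r.
rewrite g0 ?mulr0 // => Vz.
by apply: UV; exists (- n), z.
Qed.

(** Vectors [pi (embed h) w], with [h] concentrated near [x], are approximate eigenvectors of [z]
    with eigenvalue [z x]. Since [z] acts as [- r], a larger |z x| would make an element of norm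
    below 1 fix such a vector. Taking for [e] half the gap leaves room for the truncation error. *)
Lemma support_bound (z : cfun) (r : A) x :
  Y x -> (forall v, pi (embed z + r) v = 0) -> real_norm (z x : C) <= real_norm r.
Proof.
move=> Yx zr; rewrite leNgt; apply/negP => rz.
have m0 : 0 < real_norm (z x : C) by rewrite (le_lt_trans _ rz) ?real_norm_ge0.
pose e := (real_norm (z x : C) - real_norm r) / 2.
have e0 : 0 < e by rewrite divr_gt0 // subr_gt0.
pose f := z - cfun_cst S (z x : C).
have [f' [f'e f'f]] := truncate f e0.
have Acl : closed [set y | e <= real_norm (f y : C)].
  rewrite (_ : [set _ | _] = (fun x => real_norm (f x : C)) @^-1` [set r | e <= r]) //.
  apply: preimage_closed; last exact: closed_ge.
  by move=> y _; exact: real_norm_continuous.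
have fx : f x = 0 by rewrite cfunBE cfun_cstE subrr.
have [|h [h1 h0 _]] := @cfun_separation R S _ x Acl.
  by rewrite /= fx real_norm0 leNgt e0.
have [w hw] : exists w, pi (embed h) w <> 0.
  by apply: (support_bump Yx); rewrite h1 oner_eq0.
set v := pi (embed h) w in hw.
have fv : pi (embed f) v = pi (embed f') v.
  rewrite /v -!rep_mul !embedM; congr (pi (embed _) _); apply/cfunP => y.
  rewrite !cfunME; have [fe|fe] := leP e (real_norm (f y : C)).
    by rewrite h0 // !mulr0.
  by rewrite f'f // ltW.
have zx0 : z x != 0 by apply: contraTneq m0 => ->; rewrite real_norm0 ltxx.
pose t : A := - ((z x)^-1 *: (embed f' + r)).
apply: hw; apply: (rep_small irr (t := t)).
  rewrite real_normN real_normZ real_normV ltr_pdivrMl // mulr1.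
  rewrite (le_lt_trans (real_normD _ _)) // real_norm_single.
  by rewrite (le_lt_trans (lerD f'e (lexx _))) // /e; lra.
have := zr v; rewrite repDl -[z](subrK (cfun_cst S (z x : C))) -/f.
rewrite embedD repDl fv embed_cst repZl rep1 // => zv.
rewrite repNl repZl repDl -[LHS]addr0.
have -> : pi (embed f') v + pi r v = - (z x *: v).
  by apply/eqP; rewrite -addr_eq0 addrAC zv.
by rewrite scalerN opprK scalerA mulVf // scale1r addr0.
Qed.

Lemma aper_actN x n : aper S x -> n != 0 -> act n x <> x.
Proof.
move=> /aperP xp; case: n => [n|n] n0 nx; first by apply: (xp n) => //; case: n n0 {nx}.
by apply: (xp n.+1) => //; rewrite -{1}nx -actD NegzE subrr.
Qed.

(** Each nonzero [n] in [s] contributes a factor supported in a neighbourhood of [x] that is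
    disjoint from its translate, which exists because [x] is aperiodic. *)
Lemma wandering_bump (s : seq int) x : aper S x -> exists h : cfun,
  [/\ h x = 1, forall y, real_norm (h y : C) <= 1 &
      forall n y, n \in s -> n != 0 -> h y * h (act (- n) y) = 0].
Proof.
move=> xa; elim: s => [|n s [h [h1 hb hs]]].
  exists (cfun_cst S (1 : C)); split => // y.
  by rewrite cfun_cstE real_norm1.
have [n0|n0] := eqVneq n 0.
  exists h; split => // m y; rewrite inE n0 => /predU1P[->|/hs]; rewrite ?eqxx //.
  exact.
have nx : x != act (- n) x.
  by apply/eqP => nx; apply: (@aper_actN x (- n)) => //; rewrite oppr_eq0.
have := @space_hausdorff S; rewrite open_hausdorff => /(_ _ _ nx).
move=> [[U V] /= [xU xV] [Uo Vo /eqP UV]].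
have Wo : open (U `&` (act (- n)) @^-1` V).
  apply: openI => //; apply: open_comp => // y _; exact: act_continuous.
have [|g [g1 g0 gb]] := @cfun_separation R S _ x (open_closedC Wo).
  by apply; split; [exact: set_mem | exact: set_mem].
exists (cfun_mul g h); split => [|y|m y].
- by rewrite cfunME g1 h1 mul1r.
- by rewrite cfunME real_normM mulr_ile1 // real_norm_ge0.
rewrite !cfunME inE mulrACA => /predU1P[->|ms] m0; last by rewrite hs // mulr0.
have [gy|/eqP gy] := eqVneq (g y) 0; first by rewrite gy !mul0r.
have [Uy Vy] : (U `&` (act (- n)) @^-1` V) y by apply: contrapT => /g0.
rewrite (g0 (act (- n) y)) ?mulr0 ?mul0r // => -[Ug _].
by have : (U `&` V) (act (- n) y) by []; rewrite UV.
Qed.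

Lemma ell1_le_norm (a b : A) :
  (forall n, real_norm (a n) <= real_norm (b n)) -> real_norm a <= real_norm b.
Proof.
move=> ab; apply: l1_norm_le => s us; rewrite (le_trans _ (l1_norm_ge b us)) //.
by apply: ler_sum => n _.
Qed.

Lemma support_aper a n x : Y x -> aper S x -> (forall v, pi a v = 0) -> a n x = 0.
Proof.
move=> Yx xa; wlog n0 : a n / n = 0 => [hw ak|].
  have := hw (a ** dl R S (- n)) 0 erefl; rewrite single_mulr sub0r opprK.
  rewrite cfunME alpha_cst cfun_cstE mulr1; apply => v.
  by rewrite rep_mul ak.
rewrite {}n0 => ak {n}.
apply: (@real_norm_small _ C) => e e0.
have [s se] := ell1_approx a e0.
have [h [h1 hb hs]] := wandering_bump s xa.
pose b := embed h ** a ** embed h.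
have bE n : b n = cfun_mul (cfun_mul h (a n)) (alpha n h).
  by rewrite single_mulr subr0 single_mull subr0 alpha0.
have -> : a 0 x = b 0 x by rewrite bE alpha0 !cfunME h1 mul1r mulr1.
(* [b] acts as 0, so [support_bound] applies to its coefficient at 0 with the rest of [b] as [r].
   That rest is small: [h] kills the coefficients at nonzero indices in [s], and the others form the
   tail of [a]. *)
apply: (@le_trans _ _ (real_norm (b - embed (b 0)))).
  by apply: support_bound => // v; rewrite addrC subrK /b !rep_mul ak rep0r.
apply: le_trans (ltW se); apply: ell1_le_norm => n.
have -> : (b - embed (b 0)) n = b n - embed (b 0) n by [].
have [->|n0] := eqVneq n 0.
  by rewrite embedE eqxx subrr real_norm0 real_norm_ge0.
rewrite embedE (negPf n0) subr0 bE.
have [ns|ns] := boolP (n \in s).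
  rewrite (_ : cfun_mul _ _ = 0) ?real_norm0 ?real_norm_ge0 //.
  by apply/cfunP => y; rewrite !cfunME alphaE mulrAC hs // mul0r.
rewrite ell1B ell1_sumE big_seq big1 ?subr0; last first.
  by move=> m ms; rewrite singleE; case: eqP => // nm; rewrite nm ms in ns.
apply: real_norm_cfun_le => y; rewrite !cfunME !real_normM alphaE.
rewrite (le_trans (ler_piMr _ (hb _))) ?mulr_ge0 ?real_norm_ge0 //.
rewrite (le_trans (ler_piMl _ (hb _))) ?real_norm_ge0 //.
exact: real_norm_cfun_ge.
Qed.

End Support.

(** * Dynamics on the support *)

Section SupportDynamics.
Variables (R : realType) (S : dynamical_system).
Variables (E : lmodType R[i]) (pi : representation S E).
Local Notation C := (R[i]%type)^o.
Local Notation cfun := (cfun R S).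
Local Notation A := (ell1_dyn R S).
Local Notation "a ** b" := (ell1_mul a b) (at level 40, left associativity).
Implicit Types (f g h : cfun) (a b c : A) (v w : E).
Hypothesis irr : algebraically_irreducible pi.
Variable Y : set S.
Hypothesis YP : is_rep_support pi Y.

Lemma act_neq_open n : open [set z : S | act n z <> z].
Proof.
rewrite openE => z /= nz; have := @space_hausdorff S; rewrite open_hausdorff.
move=> /(_ (act n z) z); case; first exact/eqP.
move=> [U V] /= [zU zV] [Uo Vo /eqP UV]; rewrite /interior.
have : nbhs z (act n @^-1` U `&` V).
  apply: open_nbhs_nbhs; split; last by split; exact: set_mem.
  by apply: openI => //; apply: open_comp => // y _; exact: act_continuous.
apply: filterS => y [Uy Vy] ny.
have : (U `&` V) y by split; rewrite // -ny.
by rewrite UV.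
Qed.

(* By Baire, some power of the shift is the identity on a relatively open part of
   Y, hence, by topological transitivity, on all of Y. *)
Lemma support_finite (V : set S) : open V -> V `&` Y !=set0 ->
  (forall z, V z -> Y z -> per S z) ->
  exists x p, has_period x p /\ Y = orbit x.
Proof.
move=> Vo VY Vper; have Ycl := support_closed YP.
have [p p0 [W [Wo WY WP]]] : exists2 p, (0 < p)%N & exists W, [/\ open W,
    W `&` Y !=set0 & forall z, W z -> Y z -> act p z = z].
  apply: contrapT => /forall2NP np.
  have [n|n W Wo WY|||z [Vz Yz zU]] :=
      @baire_closed S Y Ycl (fun n => [set z | act n.+1 z <> z]) V.
  - exact: act_neq_open.
  - apply: contrapT => WUY; have [//|] := np n.+1; apply; exists W; split => // z Wz Yz.
    by apply: contrapT => nz; apply: WUY; exists z.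
  - exact: Vo.
  - exact: VY.
  - have /perP[p p0 pz] := Vper z Vz Yz.
    by apply: (zU p.-1); rewrite prednK.
have pY z : Y z -> act p z = z.
  move=> Yz; apply: contrapT => nz.
  have zU : [set z | act p z <> z] `&` Y !=set0 by exists z.
  have [n [y [Yy ny Wy]]] := support_transitive irr YP (act_neq_open p) Wo zU WY.
  have {}ny : act p y <> y by [].
  apply: ny; apply: (can_inj (@actK S n)).
  by rewrite -actD addrC actD WP //; exact: support_act YP _ _ Yy.
have [x Yx] := support_nonempty irr YP.
have xper : per S x by apply/perP; exists p => //; exact: pY.
have [q xq] := per_has_period xper.
exists x, q; split => //; apply/seteqP; split => [y Yy|_ [n _ <-]]; last first.
  exact: (support_act YP).
apply: contrapT => /(cfun_separation R (orbit_closed xper))[f [f1 f0 _]].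
(* [F] bounds |f| on the whole cycle of its argument. It is 0 at [x], whereas f y = 1; transitivity
   then finds [w] with |f w| > 1/2 but F < 1/2 on the same orbit. *)
pose F z : R := \sum_(j < p) real_norm (f (act j z) : C).
have Fc : continuous F.
  rewrite /F; elim: (p) => [|m IH] z.
    by under eq_fun do rewrite big_ord0; exact: cvg_cst.
  under eq_fun do rewrite big_ord_recr /=.
  apply: cvgD; first exact: IH.
  apply: (@continuous_comp _ _ _ (act m) (fun z => real_norm (f z : C))).
    exact: (@act_continuous S (Posz m)).
  exact: real_norm_continuous.
have [||||n [w [Yw /= fw Fw]]] := support_transitive irr YP
    (U := [set z | 2^-1 < real_norm (f z : C)]) (V := [set z | F z < 2^-1]).
- rewrite (_ : [set _ | _] = (fun x => real_norm (f x : C)) @^-1` [set r | 2^-1 < r]) //.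
  by apply: open_comp; [move=> z _; exact: real_norm_continuous | exact: open_gt].
- rewrite (_ : [set _ | _] = F @^-1` [set r | r < 2^-1]) //.
  by apply: open_comp; [move=> z _; exact: Fc | exact: open_lt].
- by exists y; split => //=; rewrite f1 real_norm1 invf_lt1 // ltr1n.
- exists x; split => //=; rewrite /F big1 ?invr_gt0 // => j _.
  by rewrite f0 ?real_norm0 //; exists j.
have [] := finite_orbit p0 (pY _ (support_act YP n Yw)).
have /[swap] -> : orbit (act n w) w by exists (- n); rewrite ?actK.
move=> [j /= jp wE]; move: fw; rewrite ltNge => /negP; apply.
apply: le_trans (ltW Fw); rewrite /F (bigD1 (Ordinal jp)) //= wE lerDl.
by apply: sumr_ge0 => k _; exact: real_norm_ge0.
Qed.

Lemma finite_dimensionalN (n : nat) (u : 'I_n.+1 -> E) (e : 'I_n -> E) :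
  (forall c : 'I_n.+1 -> R[i], \sum_k c k *: u k = 0 -> forall k, c k = 0) ->
  ~ forall v, exists c : 'I_n -> R[i], v = \sum_i c i *: e i.
Proof.
move=> ui span; have [M MP] : exists M : 'M[R[i]]_(n.+1, n),
    forall k, u k = \sum_i M k i *: e i.
  have [c cP] := choice (fun k => span (u k)).
  by exists (\matrix_(k, i) c k i) => k; rewrite cP; apply: eq_bigr => i _; rewrite mxE.
have : kermx M != 0.
  by rewrite kermx_eq0 /row_free neq_ltn (leq_ltn_trans (rank_leq_col M)).
move=> /eqP; apply; apply/row_matrixP => i; rewrite row0.
set d := row i _; have dM : d *m M = 0 by rewrite /d -row_mul mulmx_ker row0.
apply/rowP => k; rewrite [RHS]mxE; apply: (ui (fun k => d 0 k)) => /=.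
under eq_bigr do rewrite MP scaler_sumr.
rewrite exchange_big big1 //= => j _; under eq_bigr do rewrite scalerA.
rewrite -scaler_suml (_ : \sum_(_ < _) _ = (d *m M) 0 j); first by rewrite dM mxE scale0r.
by rewrite mxE.
Qed.

(** The first n+1 translates of a bump at an aperiodic point have pairwise product 0, so the
    corresponding translates of a vector are linearly independent. *)
Lemma aper_infinite_dimensional x : Y x -> aper S x -> infinite_dimensional E.
Proof.
move=> Yx xa [n [e span]].
have [h [h1 _ hs]] := wandering_bump R ([seq Posz k | k <- iota 0 n.+1] ++
  [seq - Posz k | k <- iota 0 n.+1]) xa.
(* The square appears because a coefficient is extracted by applying a translate of [h] to vectors
   that already carry one factor [h]. *)
have [w hw] : exists w, pi (embed (cfun_mul h h)) w <> 0.
  by apply: (support_bump YP Yx); rewrite cfunME h1 mulr1 oner_eq0.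
have dlh k v : pi (dl R S k) (pi (embed h) v) = pi (embed (alpha k h)) (pi (dl R S k) v).
  by rewrite -!rep_mul dl_embed single_embed.
have ort (i j : nat) : (i < n.+1)%N -> (j < n.+1)%N -> i != j ->
    cfun_mul (alpha i h) (alpha j h) = 0.
  move=> il jl ij; apply/cfunP => y; rewrite cfunME !alphaE.
  have -> : act (- Posz j) y = act (- (Posz j - Posz i)) (act (- Posz i) y).
    by rewrite -actD; congr act; lia.
  rewrite hs //; last by rewrite subr_eq0 eq_sym.
  rewrite mem_cat; apply/orP; have [lij|lji] := leqP i j.
    left; apply/mapP; exists (j - i)%N; last by rewrite subzn.
    by rewrite mem_iota /=; lia.
  right; apply/mapP; exists (i - j)%N; last by rewrite -subzn ?(ltnW lji) // opprB.
  by rewrite mem_iota /=; lia.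
apply: (@finite_dimensionalN n (fun k => pi (dl R S k) (pi (embed h) w)) e _ span).
move=> c c0 k; apply: contrapT => /eqP ck; apply: hw.
rewrite -[LHS](dlK irr k) -[RHS](rep0r pi (dl R S (- Posz k))); congr (pi _ _).
have := congr1 (pi (embed (alpha k h))) c0.
rewrite rep0r rep_sumr (bigD1 k) //= big1 => [|j jk]; last first.
  rewrite repZr dlh -rep_mul embedM ort //; last by rewrite eq_sym.
  by rewrite /embed single0 rep0l scaler0.
rewrite addr0 repZr => /eqP; rewrite scaler_eq0 (negPf ck) /= => /eqP <-.
by rewrite -embedM rep_mul dlh.
Qed.

Lemma support_finite_dimensional : ~ infinite_dimensional E ->
  exists x p, has_period x p /\ Y = orbit x.
Proof.
move=> fE; apply: (support_finite openT).
  by have [x Yx] := support_nonempty irr YP; exists x.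
move=> z _ Yz; have [//|/(aper_infinite_dimensional Yz)//] := per_aper z.
Qed.

(** The numbering [k] lets the base index a sequence, as Baire's theorem requires; [m0] supplies the
    base point that the pointed structure asks for. *)
Lemma metric_countable_base (M : metricType R) (m0 : M) : compact [set: M] ->
  exists (B : set (set M)) (k : set M -> nat), [/\ {in B &, injective k},
    forall D, B D -> open D &
    forall m N, nbhs m N -> exists2 D, B D /\ D m & D `<=` N].
Proof.
move=> Mco; pose M' : pseudoPMetricType R := HB.pack_for (pseudoPMetricType R) M
  (isPointed.Build M m0).
have [B /countable_injP[k kinj] [Bo Bb]] := @compact_second_countable R M' Mco.
by exists B, k; split => // m N /(Bb m).
Qed.

(** The points whose orbit meets a given nonempty base set form an open set, dense in [Y] by
    transitivity. Baire's theorem yields one point that works for the countably many base sets at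
    once. *)
Lemma support_dense_orbit : metrizable R Y ->
  exists2 x, Y x & Y = closure (orbit x).
Proof.
move=> [M [h [hinj hY hopen]]].
have [y0 Yy0] := support_nonempty irr YP.
have [m0 _] : range h y0 by rewrite hY.
have Mco : compact [set: M].
  move=> F FF _; have [] := subclosed_compact (support_closed YP) (@space_compact S)
    (@subsetT _ Y) (F := h @ F) _.
    rewrite -[(h @ F) Y]/(F (h @^-1` Y)) (_ : h @^-1` Y = setT); first exact: filterT.
    by apply/seteqP; split => // m _; rewrite /= -hY; exists m.
  move=> y []; rewrite -{1}hY => -[m _ <-] hm; exists m; split => // B N FB.
  rewrite nbhsE => -[U [/hopen[V Vo UV] Um] UN].
  have [||z [[m' Bm' <-] Vm']] := hm (h @` B) V.
  - rewrite -[(h @ F) _]/(F (h @^-1` (h @` B))).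
    by apply: filterS FB => m' Bm'; exists m'.
  - by apply: open_nbhs_nbhs; split => //; move: Um; rewrite UV.
  by exists m'; split => //; apply: UN; rewrite UV.
have [B [k [kinj Bo Bb]]] := metric_countable_base m0 Mco.
have [V VP] : {V : set M -> set S | forall b : set M, B b -> open (V b) /\ b = h @^-1` V b}.
  have hV (b : set M) : exists V, B b -> open V /\ b = h @^-1` V.
    have [Bb'|nB] := pselect (B b); last by exists set0.
    by have /hopen[V ? ?] := Bo b Bb'; exists V.
  by have [V ?] := choice hV; exists V.
(* If [n] numbers no nonempty base set the condition is vacuous and [U n] is the whole space. *)
pose U n := [set x | forall b : set M, B b -> b !=set0 -> k b = n ->
  exists m, V b (act m x)].
have Un (b : set M) x : B b -> b !=set0 -> U (k b) x <-> exists m, V b (act m x).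
  move=> Bb' b0; split => [|xm b' Bb1 b'0 bb']; first exact.
  by have -> : b' = b by apply: kinj => //; exact: mem_set.
have UT n : ~ (exists b : set M, [/\ B b, b !=set0 & k b = n]) -> U n = setT.
  by move=> nb; apply/seteqP; split => // x _ b Bb' b0 kb; case: nb; exists b.
have [|||z [_ Yz zU]] := @baire_closed S Y (support_closed YP) U setT _ _ openT.
- move=> n; have [[b [Bb' b0 <-]]|/UT ->] := pselect (exists b : set M, [/\ B b, b !=set0 & k b = n]);
    last exact: openT.
  rewrite (_ : U (k b) = \bigcup_m (act m @^-1` V b)).
    apply: bigcup_open => m _; apply: open_comp; first by move=> *; exact: act_continuous.
    by have [] := VP b Bb'.
  by apply/seteqP; split => x; [move=> /(Un b x Bb' b0)[m]; exists m |
    move=> [m _ Vm]; apply/(Un b x Bb' b0); exists m].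
- move=> n W Wo [y [Wy Yy]].
  have [[b [Bb' [m bm] <-]]|/UT ->] := pselect (exists b : set M, [/\ B b, b !=set0 & k b = n]);
    last by exists y.
  have [Vo bV] := VP b Bb'.
  have [||j [x [Yx Wx Vx]]] := support_transitive irr YP Wo Vo.
  + by exists y.
  + exists (h m); split; last by rewrite -hY; exists m.
    by rewrite -[V b (h m)]/((h @^-1` V b) m) -bV.
  by exists x; split => //; split => //; apply/Un => //; [exists m | exists j].
- by exists y0.
exists z => //; apply/seteqP; split; last first.
  move=> y zy; apply: (support_closed YP); apply: closureS zy => _ [n _ <-].
  exact: (support_act YP).
move=> y; rewrite -{1}hY => -[m _ <-] N Nm.
have [W [Wo Wm] WN] : exists2 W, open_nbhs (h m) W & W `<=` N.
  by move: Nm; rewrite nbhsE => -[W ? ?]; exists W.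
have : nbhs m (h @^-1` W).
  apply: open_nbhs_nbhs; split => //.
  by apply: (iffRL (hopen _)); exists W.
move=> /Bb[b [Bb' bm] bW]; have b0 : b !=set0 by exists m.
have [n Vn] := (iffLR (Un b z Bb' b0)) (zU _).
have : Y (act n z) by exact: (support_act YP).
rewrite -hY => -[m' _ m'E]; exists (act n z); split; first by exists n.
by rewrite -m'E; apply/WN/bW; have [_ ->] := VP b Bb'; rewrite /= m'E.
Qed.

End SupportDynamics.

(** * The spectrum of a central power of delta *)

Section Circle.
Variable R : realType.
Local Notation C := (R[i]%type)^o.

Lemma real_complex_continuous : continuous (fun r : R => r%:C%C : C).
Proof.
move=> r; apply: real_norm_cvg => e e0.
have : nbhs r [set t : R | `|r - t| < e].
  by have := nbhsx_ballx r e e0; apply: filterS => t.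
by apply: filterS => t /ltW; rewrite -rmorphB real_norm_real.
Qed.

Lemma real_normC_continuous : continuous (fun z : C => real_norm z).
Proof.
move=> z; have zz : w @[w --> (z : C)] --> (z : C) by exact: cvg_id.
exact: (cvg_real_norm_comp zz).
Qed.

Lemma circle_compact : compact [set z : C | real_norm z = 1].
Proof.
pose f (ab : R * R) : C := (ab.1)%:C%C + 'i%C * (ab.2)%:C%C.
have c1 : continuous (fun ab : R * R => (ab.1)%:C%C : C).
  by move=> ab; apply: (cvg_comp fst (fun r : R => r%:C%C : C)); [exact: cvg_fst | exact: real_complex_continuous].
have c2 : continuous (fun ab : R * R => (ab.2)%:C%C : C).
  by move=> ab; apply: (cvg_comp snd (fun r : R => r%:C%C : C)); [exact: cvg_snd | exact: real_complex_continuous].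
have fc : continuous f.
  move=> ab; apply: cvgD; first exact: c1.
  by apply: cvgM; [exact: cvg_cst | exact: c2].
apply: (@subclosed_compact _ _ (f @` (`[-1, 1]%classic `*` `[-1, 1]%classic))).
- rewrite (_ : [set _ | _] = (fun z : C => real_norm z) @^-1` [set 1]) //.
  by apply: preimage_closed; [move=> z _; exact: real_normC_continuous | exact: closed_eq].
- apply: continuous_compact; first exact: continuous_subspaceT.
  by apply: compact_setX; exact: segment_compact.
move=> z /= z1; exists (complex.Re z, complex.Im z); last by rewrite /f /= -complexE.
have n1 : `|z| = 1%:C%C by rewrite -(@Defs.real_normK _ C) z1.
have re : `|complex.Re z| <= 1 by rewrite -lecR -n1; exact: normc_ge_Re.
have im : `|complex.Im z| <= 1 by rewrite -lecR -n1; exact: normc_ge_Im.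
by split; rewrite /= in_itv /=; rewrite -ler_norml.
Qed.

End Circle.

Section Spectrum.
Variables (R : realType) (S : dynamical_system).
Variables (E : lmodType R[i]) (pi : representation S E).
Local Notation C := (R[i]%type)^o.
Local Notation A := (ell1_dyn R S).
Local Notation "a ** b" := (ell1_mul a b) (at level 40, left associativity).
Local Notation dl := (dl R S).
Implicit Types (a b c : A) (v w : E) (l m : R[i]).
Hypothesis irr : algebraically_irreducible pi.
Variable p : int.
Hypothesis central : forall a v, pi (dl p) (pi a v) = pi a (pi (dl p) v).

Local Notation D := (pi (dl p)).

(** Schur's lemma for one vector. The kernel of D - l is invariant because D is central; when it
    misses [v], cyclicity returns (D - l) v to [v], and centrality moves the returning element
    inside. *)
Lemma eigen_or_invertible l v : v <> 0 ->
  (forall w, D w = l *: w) \/ exists b, D (pi b v) - l *: pi b v = v.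
Proof.
move=> v0; have [Dv|Dv] := pselect (D v - l *: v = 0).
  left; have [|W0|WT w] := proj2 irr [set w | D w - l *: w = 0].
  - split => /= [|k u w u0 w0|a w w0].
    + by rewrite rep0r scaler0 subr0.
    + rewrite repDr repZr scalerDr opprD addrACA w0 addr0 scalerA mulrC -scalerA.
      by rewrite -scalerBr u0 scaler0.
    + by rewrite central -repZr -repBr w0 rep0r.
  - by case: v0; rewrite -[_ = _]/([set 0] v) -W0.
  - by apply/eqP; rewrite -subr_eq0; apply/eqP; rewrite -[_ = _]/([set w | D w - l *: w = 0] w) WT.
right; have [b bv] := irreducible_cyclic irr Dv v.
by exists b; rewrite central -repZr -repBr.
Qed.

Variable v : E.
Hypothesis v0 : v <> 0.

(** Here [b] represents (D - l)^-1 v. Since (D - m) sends [pi b v] to (1 - (m - l) b) v, a left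
    inverse [c] of that factor makes [c ** b] represent (D - m)^-1 v. *)
Lemma resolvent_perturb l m b : D (pi b v) - l *: pi b v = v ->
  real_norm (m - l : C) * real_norm b <= 2^-1 ->
  exists c, [/\ D (pi (c ** b) v) - m *: pi (c ** b) v = v, real_norm c <= 2 &
    real_norm (c - one R S) <= 2 * (real_norm (m - l : C) * real_norm b)].
Proof.
move=> lb mb; pose t : A := (m - l) *: b.
have tn : real_norm t = real_norm (m - l : C) * real_norm b by rewrite real_normZ.
have [|c ct cn] := @neumann R S t.
  by rewrite tn (le_lt_trans mb) // invf_lt1 // ltr1n.
have c2 : real_norm c <= 2.
  apply: le_trans cn _; rewrite -[leRHS]invrK lef_pV2 ?posrE ?invr_gt0 //.
    by rewrite tn; lra.
  by rewrite subr_gt0 tn (le_lt_trans mb) // invf_lt1 // ltr1n.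
exists c; split => //.
  rewrite rep_mul central -repZr -repBr.
  rewrite (_ : D _ - _ = pi (one R S - t) v); first by rewrite -rep_mul ct rep1.
  have -> : D (pi b v) = v + l *: pi b v by rewrite -{2}lb subrK.
  by rewrite repBl rep1 // /t repZl scalerBl opprB addrA.
rewrite (_ : c - one R S = c ** t); last first.
  by rewrite -[X in _ - X]ct ell1_mulBr ell1_mul1r opprB addrC subrK.
by rewrite -tn (le_trans (real_norm_mul _ _)) // ler_wpM2r ?real_norm_ge0.
Qed.

Hypothesis no_eigen : forall l, real_norm (l : C) = 1 -> ~ forall w, D w = l *: w.

(** At each point of the circle some [b] solves the resolvent equation, and [resolvent_perturb]
    carries it to a neighbourhood at the cost of a factor 2 in norm; compactness makes the bound
    uniform. *)
Lemma resolvent_bound : exists2 K : R, 0 < K & forall l, real_norm (l : C) = 1 ->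
  exists2 b, real_norm b <= K & D (pi b v) - l *: pi b v = v.
Proof.
pose P (K : R) (l : C) :=
  exists2 b, real_norm b <= K & D (pi b v) - l *: pi b v = v.
have /compact_near_coveringP nc := @circle_compact R.
have [l /= l1|K [_ KP]] := nc R (pinfty_nbhs R) P _.
- have [/no_eigen//|[b lb]] := @eigen_or_invertible l v v0.
  exists ([set m : C | real_norm (l - m) <= 2^-1 / (real_norm b + 1)],
          [set K | 2 * real_norm b < K]).
    split => /=; last by apply: nbhs_pinfty_gt; exact: num_real.
    have ll : w @[w --> (l : C)] --> (l : C) by exact: cvg_id.
    apply: (cvg_real_norm ll); rewrite divr_gt0 ?invr_gt0 //.
    by rewrite ltr_wpDl // real_norm_ge0.
  move=> [m K] /= [lm bK].
  have [|c [cb c2 _]] := resolvent_perturb (m := m) lb.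
    rewrite real_normBC (le_trans (ler_wpM2r (real_norm_ge0 _) lm)) //.
    rewrite -mulrA ger_pMr ?invr_gt0 // mulrC ler_pdivrMr ?mul1r ?lerDl //.
    by rewrite ltr_wpDl // real_norm_ge0.
  exists (c ** b) => //; rewrite (le_trans (real_norm_mul _ _)) //.
  by rewrite (le_trans _ (ltW bK)) // ler_wpM2r ?real_norm_ge0.
exists (Num.max K 0 + 1) => [|l l1]; first by rewrite ltr_wpDl // le_max lexx orbT.
apply: KP => //; rewrite (@le_lt_trans _ _ (Num.max K 0)) ?ltrDl //.
by rewrite le_max lexx.
Qed.

(* [resolvent_pair n r s e l]: vectors w, w' with w = mu (mu - D^n)^-1 v for
   mu = r^n l, and likewise w' for mu' = s^n l, that are e-close for the norm
   [inf {|a| : pi a v = w}]. *)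
Definition resolvent_pair (n : nat) (r s e : R) l := exists w w' a,
  [/\ (r ^+ n)%:C%C * l *: w - pi (dl (n%:Z * p)) w = (r ^+ n)%:C%C * l *: v,
      (s ^+ n)%:C%C * l *: w' - pi (dl (n%:Z * p)) w' = (s ^+ n)%:C%C * l *: v,
      w - w' = pi a v & real_norm a <= e].

Lemma resolvent_pair1 : exists2 d : R, 0 < d < 1 & forall l, real_norm (l : C) = 1 ->
  resolvent_pair 1 (1 + d) (1 - d) 4^-1 l.
Proof.
have [K K0 KP] := resolvent_bound.
(* The three error terms below add up to at most 4 d K (K + 1), and this [d] keeps that under
   1/4. *)
pose d := (16 * (K + 1) * (K + 1))^-1.
have K1 : 0 < K + 1 by rewrite addr_gt0.
have dE : d * (16 * (K + 1) * (K + 1)) = 1 by rewrite mulVf // gt_eqF // !mulr_gt0.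
have d0 : 0 < d by rewrite invr_gt0 !mulr_gt0.
have dK : d * K <= 2^-1 by nra.
have dKK : 4 * d * K * (K + 1) <= 4^-1 by nra.
have fin (x y z : R) : x <= 4 * (d * K) * K -> d * y <= d * (2 * K) ->
    d * z <= d * (2 * K) -> x + d * y + d * z <= 4^-1.
  by move=> *; lra.
exists d; first by rewrite d0 /=; nra.
move=> l l1; have [b bK lb] := KP l l1.
have pert (s : R) : `|s| = d -> exists c, [/\ D (pi (c ** b) v) -
    (1 + s)%:C%C * l *: pi (c ** b) v = v, real_norm c <= 2 &
    real_norm (c - one R S) <= 2 * (d * K)].
  move=> sd; have ml : real_norm ((1 + s)%:C%C * l - l : C) = d.
    rewrite rmorphD rmorph1 mulrDl mul1r addrAC subrr add0r real_normM l1 mulr1.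
    by rewrite real_norm_real.
  have dbK : d * real_norm b <= d * K by rewrite ler_wpM2l // ltW.
  have [|c [cb c2 c1]] := resolvent_perturb (m := (1 + s)%:C%C * l) lb.
    by rewrite ml (le_trans dbK).
  exists c; split => //; rewrite (le_trans c1) // ml.
  by rewrite ler_wpM2l.
have [|c [cb c2 c1]] := pert d; first by rewrite gtr0_norm.
have [|c' [cb' c2' c1']] := pert (- d); first by rewrite normrN gtr0_norm.
(* With m = (1 + d) l, and (1 - d) l for the second vector, y = (D - m)^-1 v gives the vector - m y
   = m (m - D)^-1 v. *)
exists (- ((1 + d)%:C%C * l) *: pi (c ** b) v), (- ((1 - d)%:C%C * l) *: pi (c' ** b) v).
exists (- l *: ((c - c') ** b + d%:C%C *: (c ** b) + d%:C%C *: (c' ** b))).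
rewrite !expr1 mul1r; split.
- rewrite repZr -{3}cb; set y := pi _ _; set z := D y; set m := _ * l.
  by rewrite !scaleNr opprK scalerBr scalerN addrC.
- rewrite repZr -{3}cb'; set y := pi _ _; set z := D y; set m := _ * l.
  by rewrite !scaleNr opprK scalerBr scalerN addrC.
- rewrite !(repZl, repDl) ell1_mulBl repBl.
  set y := pi (c ** b) v; set z := pi (c' ** b) v.
  transitivity ((- l - l * d%:C%C) *: y + (l - l * d%:C%C) *: z).
    rewrite -[X in _ + X]scaleNr opprK rmorphD rmorphB rmorph1.
    by congr (_ *: _ + _ *: _); ring.
  rewrite !scalerDr !scalerA !scalerDl scalerN !scaleNr opprK mulNr !scaleNr.
  by rewrite -!addrA; congr (_ + _); rewrite addrCA.
have nd : real_norm (d%:C%C : C) = d by rewrite real_norm_real gtr0_norm.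
rewrite real_normZ real_normN l1 mul1r.
rewrite (le_trans (real_normD _ _)) //.
rewrite (le_trans (lerD (real_normD _ _) (lexx _))) // !real_normZ nd.
have cb2 (c3 : A) : real_norm c3 <= 2 -> d * real_norm (c3 ** b) <= d * (2 * K).
  move=> h; rewrite ler_wpM2l ?(ltW d0) // (le_trans (real_norm_mul _ _)) //.
  by rewrite ler_pM ?real_norm_ge0.
have cc : real_norm (c - c') <= 4 * (d * K).
  rewrite -[c](subrK (one R S)) -addrA (le_trans (real_normD _ _)) //.
  by rewrite real_normBC in c1'; lra.
have : real_norm ((c - c') ** b) <= 4 * (d * K) * K.
  by rewrite (le_trans (real_norm_mul _ _)) // ler_pM ?real_norm_ge0.
by move=> h; exact: (fin _ _ _ h (cb2 _ c2) (cb2 _ c2')).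
Qed.

(** Partial fractions: m^2 / (m^2 - T^2) is the mean of m / (m - T) and m / (m + T). Choosing m =
    t^n k with k a square root of [l] passes from n to 2n, and a mean of two errors bounded by [e]
    is bounded by [e]. *)
Lemma resolvent_pair_double n r s e :
  (forall l, real_norm (l : C) = 1 -> resolvent_pair n r s e l) ->
  forall l, real_norm (l : C) = 1 -> resolvent_pair (2 * n) r s e l.
Proof.
move=> IH l l1; pose k := sqrtC l.
have kk : k * k = l by rewrite -expr2 sqrtCK.
have k1 : real_norm (k : C) = 1.
  apply/eqP; rewrite -(@eqrXn2 _ 2) ?real_norm_ge0 // expr1n expr2.
  by rewrite -(real_normM (k : C)) kk l1.
have kN1 : real_norm (- k : C) = 1 by rewrite real_normN.
have [w1 [w1' [a1 [e1 e1' wa1 n1]]]] := IH _ k1.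
have [w2 [w2' [a2 [e2 e2' wa2 n2]]]] := IH _ kN1.
have half (t : R) u1 u2 :
    (t ^+ n)%:C%C * k *: u1 - pi (dl (n%:Z * p)) u1 = (t ^+ n)%:C%C * k *: v ->
    (t ^+ n)%:C%C * - k *: u2 - pi (dl (n%:Z * p)) u2 = (t ^+ n)%:C%C * - k *: v ->
    (t ^+ (2 * n))%:C%C * l *: (2^-1 *: (u1 + u2)) -
      pi (dl ((2 * n)%N%:Z * p)) (2^-1 *: (u1 + u2)) = (t ^+ (2 * n))%:C%C * l *: v.
  set m := (t ^+ n)%:C%C * k; rewrite mulrN -/m !scaleNr => h1 h2.
  set T := pi (dl (n%:Z * p)) in h1 h2 *.
  have TB u u' : T (u - u') = T u - T u' by rewrite /T repBr.
  have TD u u' : T (u + u') = T u + T u' by rewrite /T repDr.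
  have TZ x u : T (x *: u) = x *: T u by rewrite /T repZr.
  have TT u : pi (dl ((2 * n)%N%:Z * p)) u = T (T u).
    by rewrite /T -rep_mul dlD -mulrDl -PoszD addnn mul2n.
  have mm : (t ^+ (2 * n))%:C%C * l = m * m.
    by rewrite mulnC exprM rmorphXn /= -kk /m; ring.
  have T1 : T u1 = m *: u1 - m *: v by rewrite -h1 opprB addrC subrK.
  have T2 : T u2 = m *: v - m *: u2.
    by rewrite -[m *: v]opprK -h2 opprD !opprK addrAC subrr add0r.
  have TT12 : T (T u1) + T (T u2) = (m * m) *: (u1 + u2) - 2 *: ((m * m) *: v).
    rewrite T1 T2 !TB !TZ T1 T2 addrA subrK !scalerBr !scalerA opprB addrACA.
    by rewrite -scalerDr -opprD -scalerDl mulr_natl mulr2n.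
  rewrite TT mm !TZ !TD TT12 scalerBr !scalerA [2^-1 * (m * m)]mulrC opprB addrC.
  by rewrite subrK [2^-1 * (2 * _)]mulrA mulVf ?mul1r ?pnatr_eq0.
exists (2^-1 *: (w1 + w2)), (2^-1 *: (w1' + w2')), (2^-1 *: (a1 + a2)); split.
- exact: half.
- exact: half.
- by rewrite repZl repDl -wa1 -wa2 -scalerBr opprD addrACA.
rewrite real_normZ real_normV (_ : real_norm (2 : C) = 2); last first.
  by rewrite -(rmorph_nat (@real_complex R)) real_norm_real ger0_norm.
by rewrite ler_pdivrMl // (le_trans (real_normD _ _)) // mulr_natl mulr2n lerD.
Qed.

Lemma real_norm_dl n : real_norm (dl n) = 1.
Proof. by rewrite real_norm_single real_norm_cfun_cst real_norm1. Qed.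

Lemma neumann_small (t : A) : real_norm t <= 8^-1 ->
  exists c, c ** (one R S - t) = one R S /\ real_norm (c ** t) <= 7^-1.
Proof.
move=> t8; have [|c ct cn] := @neumann R S t; first by lra.
exists c; split => //; rewrite (le_trans (real_norm_mul _ _)) //.
have c8 : real_norm c <= 8 / 7.
  apply: le_trans cn _; rewrite -[leRHS]invrK lef_pV2 ?posrE ?invr_gt0 //; last by lra.
  by rewrite invf_div; lra.
rewrite (le_trans (ler_pM _ _ c8 t8)) ?real_norm_ge0 //; lra.
Qed.

(** This takes the place of Liouville's theorem. For n = 2^N large, w - v and w' are both of the
    form pi t v with |t| <= 1/7, and w - w' is one with |t| <= 1/4. Hence [v] itself is fixed by an
    element of norm at most 1/4 + 1/7 + 1/7 < 1. *)
Lemma spectrum_contra : False.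
Proof.
have sum3 (x y z : R) : x <= 4^-1 -> y <= 7^-1 -> z <= 7^-1 -> x + y + z < 1.
  by move=> *; lra.
have [d /andP[d0 d1] base] := resolvent_pair1.
have pairs k : forall l, real_norm (l : C) = 1 ->
    resolvent_pair (2 ^ k) (1 + d) (1 - d) 4^-1 l.
  by elim: k => // k IH; rewrite expnS; exact: resolvent_pair_double.
have small (q : R) : 0 <= q < 1 -> \forall n \near \oo, q ^+ n <= 8^-1.
  move=> /andP[q0 q1]; have q1' : `|q| < 1 by rewrite ger0_norm.
  have e0 : 0 < 8^-1 :> R by rewrite invr_gt0.
  move/cvgrPdist_le : (cvg_expr q1') => /(_ _ e0); apply: filterS => n.
  by rewrite sub0r normrN ger0_norm ?exprn_ge0.
have [N [N1 N2]] : exists N, (1 + d)^-1 ^+ (2 ^ N) <= 8^-1 /\ (1 - d) ^+ (2 ^ N) <= 8^-1.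
  have h1 : 0 <= (1 + d)^-1 < 1.
    by rewrite invr_ge0 addr_ge0 ?(ltW d0) //= invf_lt1 ?ltrDl // addr_gt0.
  have h2 : 0 <= 1 - d < 1 by lra.
  have [M1 _ M1P] := small _ h1; have [M2 _ M2P] := small _ h2.
  exists (maxn M1 M2); split; [apply: M1P | apply: M2P];
    by rewrite /= (leq_trans _ (ltnW (ltn_expl _ _))) // ?leq_maxl ?leq_maxr.
have [w [w' [a [e1 e2 wa an]]]] := pairs N 1 (real_norm1 R).
set T := dl ((2 ^ N)%N%:Z * p) in e1 e2.
set r := (1 + d) ^+ _ in e1; set s := (1 - d) ^+ _ in e2.
have r0 : 0 < r by rewrite exprn_gt0 // addr_gt0.
have s0 : 0 < s by rewrite exprn_gt0 // subr_gt0.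
pose T' := dl (- ((2 ^ N)%N%:Z * p)).
have [|c [ct cn]] := @neumann_small (r^-1%:C%C *: T).
  by rewrite real_normZ real_norm_dl mulr1 real_norm_real ger0_norm ?invr_ge0 ?(ltW r0) // -exprVn.
have [|c' [ct' cn']] := @neumann_small (s%:C%C *: T').
  by rewrite real_normZ real_norm_dl mulr1 real_norm_real gtr0_norm.
have wE : w - v = pi (c ** (r^-1%:C%C *: T)) v.
  have rw : pi (one R S - r^-1%:C%C *: T) w = v.
    rewrite repBl rep1 // repZl; have := congr1 ( *:%R (r^-1)%:C%C) e1.
    by rewrite mulr1 scalerBr !scalerA -rmorphM mulVf ?gt_eqF // rmorph1 !scale1r.
  rewrite -[w in LHS](rep1 irr) -ct rep_mul rw -{2}[v](rep1 irr) -ct -repBl.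
  by rewrite ell1_mulBr ell1_mul1r opprB addrC subrK.
(* The inverse T' of [T] also has norm 1, so s (s - T)^-1 expands in powers of s T', which is
   small. *)
have w'E : w' = - pi (c' ** (s%:C%C *: T')) v.
  have sw : pi (one R S - s%:C%C *: T') w' = - pi (s%:C%C *: T') v.
    have := congr1 (pi T') e2; rewrite mulr1 repBr !repZr dlK // => sv.
    by rewrite repBl rep1 // !repZl -sv opprB.
  by rewrite -[LHS](rep1 irr) -ct' rep_mul sw repNr -rep_mul.
apply: v0; apply: (rep_small irr (t := a - c' ** (s%:C%C *: T') - c ** (r^-1%:C%C *: T))).
  rewrite (le_lt_trans (real_normB _ _)) // (le_lt_trans (lerD (real_normB _ _) (lexx _))) //.
  exact: (sum3 _ _ _ an cn' cn).
by rewrite !repBl -wa -wE -[- pi _ v]w'E subrK opprB addrC subrK.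
Qed.

End Spectrum.

Lemma exists_eigenvalue (R : realType) (S : dynamical_system) (E : lmodType R[i])
    (pi : representation S E) (p : int) :
  algebraically_irreducible pi ->
  (forall a v, pi (dl R S p) (pi a v) = pi a (pi (dl R S p) v)) ->
  exists2 l : R[i], real_norm (l : R[i]^o) = 1 &
    forall v, pi (dl R S p) v = l *: v.
Proof.
move=> irr central; apply: contrapT => /forall2NP nl.
have [[a [v av]] _] := irr.
have v0 : v <> 0 by move=> v0; apply: av; rewrite v0 rep0r.
apply: (spectrum_contra irr central v0) => l l1.
by have [] := nl l.
Qed.

(** * Representations supported on a finite orbit *)

Section Weights.
Variables (R : realType) (S : dynamical_system).
Local Notation C := (R[i]%type)^o.
Local Notation cfun := (cfun R S).
Local Notation A := (ell1_dyn R S).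
Variables (p : nat) (l : R[i]).
Hypothesis (p0 : (0 < p)%N) (l1 : real_norm (l : C) = 1).
Implicit Types (f g : cfun) (a b : A) (n : int) (r : nat).

Lemma unit_neq0 : l != 0.
Proof.
apply/eqP => l0; have := l1; rewrite l0 (@real_norm0 _ C) => /esym/eqP.
by rewrite oner_eq0.
Qed.

Lemma real_norm_exprz n : real_norm (l ^ n : C) = 1.
Proof.
case: n => n; rewrite -?exprnP ?NegzE -?exprnN.
  by rewrite real_normX l1 expr1n.
by rewrite real_normV real_normX l1 expr1n invr1.
Qed.

(* [sum_n (wcoef r n) a n] collects the coefficients of a on the residue class
   of r modulo p when delta^p acts as the scalar l. *)
Definition wcoef r n : C := if (n %% p)%Z == r then l ^ (n %/ p)%Z else 0.

Lemma wcoef_le r n : real_norm (wcoef r n) <= 1.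
Proof. by rewrite /wcoef; case: ifP; rewrite ?real_norm_exprz // real_norm0. Qed.

Lemma wcoef_mod n : exists i : 'I_p, [/\ (n %% p)%Z = i, wcoef i n = l ^ (n %/ p)%Z &
  forall j : 'I_p, j != i -> wcoef j n = 0].
Proof.
have m0 : 0 <= (n %% p)%Z by rewrite modz_ge0 //; case: (p) p0.
have mp : (`|(n %% p)%Z| < p)%N.
  by rewrite -ltz_nat gez0_abs // ltz_mod //; case: (p) p0.
exists (Ordinal mp); rewrite /wcoef /= gez0_abs // eqxx; split => // j jn.
rewrite (_ : (_ == _) = false) //; apply: contraNF jn => /eqP nj.
by apply/eqP/val_inj; rewrite /= nj.
Qed.

Lemma wcoefE r n : wcoef r n = if (n %% p)%Z == r then l ^ (n %/ p)%Z else 0.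
Proof. by []. Qed.

Section WeightedSum.
Variable V : normedModType R[i].
Hypothesis V_complete :
  forall F : set_system V, ProperFilter F -> cauchy F -> cvg F.

(** [V] is the algebra of functions when kernels are described and the scalar field when a single
    orbit is followed. *)
Definition wsum (a : ell1 V) r : V := zsum (fun n => (wcoef r n : R[i]) *: a n).

Lemma wsum_summable (a : ell1 V) r :
  (l1_sum (fun n => (wcoef r n : R[i]) *: a n) < +oo)%E.
Proof.
apply: (@l1_sum_lt_pinfty _ _ _ (real_norm a)) => s us.
rewrite (le_trans _ (l1_norm_ge a us)) //; apply: ler_sum => n _.
by rewrite real_normZ ler_piMl ?real_norm_ge0 // wcoef_le.
Qed.

Lemma wsumD (a b : ell1 V) r : wsum (a + b) r = wsum a r + wsum b r.
Proof.
rewrite /wsum -(zsumD V_complete (wsum_summable _ _) (wsum_summable _ _)).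
by congr zsum; apply/funext => n; rewrite ell1D scalerDr.
Qed.

Lemma wsumZ k (a : ell1 V) r : wsum (k *: a) r = k *: wsum a r.
Proof.
rewrite /wsum -(zsumZ V_complete _ (wsum_summable _ _)).
by congr zsum; apply/funext => n; rewrite ell1Z !scalerA mulrC.
Qed.

Lemma wsumB (a b : ell1 V) r : wsum (a - b) r = wsum a r - wsum b r.
Proof. by rewrite wsumD -scaleN1r wsumZ scaleN1r. Qed.

Lemma wsum_le (a : ell1 V) r : real_norm (wsum a r) <= real_norm a.
Proof.
rewrite /wsum (le_trans (zsum_le V_complete (wsum_summable _ _))) //.
rewrite -lee_fin fineK ?ge0_fin_numE ?l1_sum_ge0 ?wsum_summable // l1_sumK.
by apply: le_esum => n _; rewrite lee_fin real_normZ ler_piMl ?real_norm_ge0 // wcoef_le.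
Qed.

Lemma wsum_single n v r : wsum (single n v) r = (wcoef r n : R[i]) *: v.
Proof.
rewrite /wsum (@zsum_supp1 _ _ n) ?singleE ?eqxx // => k kn.
by rewrite singleE (negPf kn) scaler0.
Qed.

End WeightedSum.
End Weights.

Section PeriodicSupport.
Variables (R : realType) (S : dynamical_system).
Variables (E : lmodType R[i]) (pi : representation S E).
Local Notation C := (R[i]%type)^o.
Local Notation cfun := (cfun R S).
Local Notation A := (ell1_dyn R S).
Local Notation "a ** b" := (ell1_mul a b) (at level 40, left associativity).
Local Notation dl := (dl R S).
Implicit Types (f g h : cfun) (a b c : A) (v w : E).

Definition periodic_kernel (x : S) (p : nat) (l : R[i]) : set A :=
  [set a | forall r : nat, (r < p)%N -> forall z, orbit x z ->
    (wsum p l a r : cfun) z = 0].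

Hypothesis irr : algebraically_irreducible pi.
Variables (x : S) (p : nat).
Hypotheses (xp : has_period x p) (YP : is_rep_support pi (orbit x)).

Let p0 : (0 < p)%N. Proof. by case: xp. Qed.

Lemma orbit_period z : orbit x z -> has_period z p.
Proof. by move=> [n _ <-]; exact: has_period_orbit. Qed.

Lemma rep_dl_embed n f v :
  pi (dl n) (pi (embed f) v) = pi (embed (alpha n f)) (pi (dl n) v).
Proof. by rewrite -!rep_mul dl_embed single_embed. Qed.

Lemma rep_dl_central a v : pi (dl p) (pi a v) = pi a (pi (dl p) v).
Proof.
apply/eqP; rewrite -subr_eq0 -!rep_mul -repBl; apply/eqP.
apply: (support_coef irr YP) => n z /orbit_period[_ pz _].
rewrite ell1B single_mull single_mulr cfun_mul1l alpha_cst cfunBE cfunME alphaE.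
by rewrite cfun_cstE mulr1 -{1}pz actK subrr.
Qed.

Lemma orbit_bump z : orbit x z -> exists h : cfun,
  h z = 1 /\ forall y, orbit x y -> y != z -> h y = 0.
Proof.
move=> xz; have fin : finite_set (orbit x `\` [set z]).
  by apply: finite_setD; exact: has_period_per xp.
have acc := hausdorff_accessible (@space_hausdorff S).
have [|h [h1 h0 _]] := @cfun_separation R S _ z (iffLR accessible_finite_set_closed acc _ fin).
  by move=> [_]; apply.
by exists h; split => // y xy /eqP yz; apply: h0.
Qed.

Variable l : R[i].
Hypotheses (l1 : real_norm (l : C) = 1) (lP : forall v, pi (dl p) v = l *: v).

Lemma rep_dl_mulz (k : int) v : pi (dl (k * p)) v = l ^ k *: v.
Proof.
have l0 := unit_neq0 l1.
elim/int_ind: k v => [|k IH|k IH] v; first by rewrite mul0r expr0z scale1r rep1.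
  by rewrite -addn1 PoszD mulrDl mul1r -dlD rep_mul lP repZr IH scalerA exprzDr ?unitfE // mulrC.
rewrite -addn1 PoszD opprD mulrDl mulN1r -dlD rep_mul IH exprzDr ?unitfE //.
rewrite -scalerA; congr (_ *: _).
rewrite -[in RHS](dlVK irr p v) lP scalerA exprN1 mulVf //.
by rewrite scale1r.
Qed.

Lemma rep_dl_divz (n : int) v :
  pi (dl n) v = l ^ (n %/ p)%Z *: pi (dl (n %% p)%Z) v.
Proof. by rewrite {1}(divz_eq n p) -dlD rep_mul rep_dl_mulz. Qed.

(** For [single n f] this is the relation delta^n = l^(n / p) delta^(n mod p); [rep_closed] extends
    it to all elements, the reduction [red] being bounded by p. *)
Lemma rep_reduce a v :
  pi a v = \sum_(r < p) pi (embed (wsum p l a r)) (pi (dl r) v).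
Proof.
pose red a : A := \sum_(r < p) single r (wsum p l a r).
have redB b c : red (b - c) = red b - red c.
  rewrite /red -sumrB; apply: eq_bigr => r _.
  by rewrite (wsumB _ l1 (@cfun_cvg R S)) singleD -scaleN1r singleZ scaleN1r.
have redD b c : red (b + c) = red b + red c.
  rewrite /red -big_split; apply: eq_bigr => r _.
  by rewrite (wsumD _ l1 (@cfun_cvg R S)) singleD.
have red_single n f : pi (single n f - red (single n f)) v = 0.
  rewrite repBl rep_suml; have [i [ni wi wj]] := wcoef_mod l p0 n.
  rewrite (bigD1 i) //= big1 => [|j ji]; last first.
    by rewrite wsum_single wj // scale0r single0 rep0l.
  rewrite addr0 wsum_single wi singleZ repZl !single_embed !rep_mul.
  by rewrite rep_dl_divz repZr ni subrr.
suff : pi (a - red a) v = 0.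
  rewrite repBl => /eqP; rewrite subr_eq0 => /eqP ->.
  by rewrite rep_suml; apply: eq_bigr => r _; rewrite single_embed rep_mul.
apply: rep_closed => // e e0.
(* Dividing by p + 1 pays for the norm of the identity minus [red]. *)
have [s se] := ell1_approx a (divr_gt0 e0 (ltr0Sn R p)).
pose b := \sum_(n <- s) single n (a n); exists (b - red b).
  have -> : a - red a - (b - red b) = (a - b) - red (a - b).
    by rewrite redB !opprB addrACA [RHS]addrACA [- b - _]addrC.
  have redle c : real_norm (red c) <= p%:R * real_norm c.
    rewrite /red (le_trans (real_norm_sum _ _ _)) // mulr_natl.
    rewrite -[X in _ *+ X]card_ord -sumr_const ler_sum // => r _.
    by rewrite real_norm_single; exact: (wsum_le _ l1 (@cfun_cvg R S)).
  rewrite (le_lt_trans (real_normB _ _)) // (le_lt_trans (lerD (lexx _) (redle _))) //.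
  by move: se; rewrite ltr_pdivlMr ?ltr0Sn // -natr1 mulrDr mulr1 addrC [_ * p%:R]mulrC.
rewrite /b; elim: (s) => [|n t IH].
  by rewrite big_nil -[X in red X](subrr 0) redB !subrr rep0l.
by rewrite big_cons redD opprD addrACA repDl red_single IH addr0.
Qed.

(** To test the residue [r] at a point [z], [a] is placed between a bump at [z] and one at
    [act (- r) z]. As the orbit has exactly [p] points, the other residues carry the second bump to
    points other than [z]. *)
Lemma periodic_kernelE : rep_kernel pi = periodic_kernel x p l.
Proof.
apply/seteqP; split => a; last first.
  move=> ak v; rewrite rep_reduce big1 // => r _.
  by have /(supportE YP) : forall z, orbit x z -> (wsum p l a r : cfun) z = 0; [exact: ak | apply].
move=> ak r rp z xz.
have [h [hz h0]] := orbit_bump xz.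
have xy : orbit x (act (- Posz r) z).
  by have [n _ <-] := xz; exists (- Posz r + n); rewrite ?actD.
have [g [gy g0]] := orbit_bump xy.
have zp := orbit_period xz.
pose u := cfun_mul (cfun_mul h (wsum p l a r)) (alpha r g).
have uk : kerC pi u.
  move=> w; rewrite -[w](dlVK irr r); move: (pi _ w) => w'.
  have := congr1 (pi (embed h)) (ak (pi (embed g) w')).
  rewrite rep0r (rep_reduce a) rep_sumr (bigD1 (Ordinal rp)) //= big1 => [|j jr]; last first.
    rewrite rep_dl_embed -!rep_mul !embedM rep_mul.
    have /(supportE YP) : forall y, orbit x y ->
        cfun_mul (cfun_mul h (wsum p l a j)) (alpha j g) y = 0; last by apply.
    move=> y xy'; rewrite !cfunME alphaE.
    have [->|yz] := eqVneq y z; last by rewrite h0 // !mul0r.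
    rewrite g0 ?mulr0 //.
      by have [n _ <-] := xz; exists (- Posz j + n); rewrite ?actD.
    apply: contra jr => /eqP jr; apply/eqP/val_inj => /=.
    apply: (has_period_inj (has_period_orbit (- Posz j - Posz r) zp)) => //.
    rewrite -!actD (_ : Posz j + (- Posz j - Posz r) = - Posz r); last by lia.
    by rewrite (_ : Posz r + (- Posz j - Posz r) = - Posz j) ?jr //; lia.
  by rewrite addr0 rep_dl_embed -!rep_mul !embedM rep_mul.
have /(supportE YP)/(_ z xz) := uk.
by rewrite !cfunME hz mul1r alphaE gy mulr1.
Qed.

(** On a vector concentrated at one point of the orbit functions act by evaluation, so its first [p]
    translates span the space. *)
Lemma periodic_finite_dimensional : ~ infinite_dimensional E.
Proof.
apply; have [h [hx h0]] := orbit_bump (orbit_self x).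
have [u hu] : exists u, pi (embed h) u <> 0.
  by apply: (support_bump YP (orbit_self x)); rewrite hx oner_eq0.
exists p, (fun r => pi (dl r) (pi (embed h) u)) => w.
have [a <-] := irreducible_cyclic irr hu w.
exists (fun r => wsum p l a r (act r x)); rewrite rep_reduce; apply: eq_bigr => r _.
set g := wsum p l a r.
apply/eqP; rewrite -subr_eq0; apply/eqP.
rewrite rep_dl_embed -rep_mul embedM -repZl -embedZ.
rewrite -repBl -[- embed _]scaleN1r -embedZ scaleN1r -embedD.
set f := (_ - _); have /(supportE YP) : forall y, orbit x y -> f y = 0; last by apply.
move=> y xy; rewrite /f cfunBE cfunME cfunZE alphaE.
have [->|yr] := eqVneq y (act r x); first by rewrite subrr.
rewrite h0 ?mulr0 ?subrr //.
  by have [n _ <-] := xy; exists (- Posz r + n); rewrite ?actD.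
by apply: contra yr => /eqP <-; rewrite actVK.
Qed.

End PeriodicSupport.

(** * The representations attached to orbits *)

Section OrbitRestriction.
Variables (R : realType) (S : dynamical_system).
Local Notation C := (R[i]%type)^o.
Local Notation cfun := (cfun R S).
Local Notation A := (ell1_dyn R S).
Local Notation "a ** b" := (ell1_mul a b) (at level 40, left associativity).
Local Notation dl := (dl R S).
Implicit Types (f g h : cfun) (a b c d : A) (xi : ell1 C).

Lemma ell1_dominated (V W : normedModType R[i]) (u : int -> V) (b : ell1 W) :
  (forall n, real_norm (u n) <= real_norm (b n)) -> u \in @l1_summable R V.
Proof.
move=> ub; apply/asboolP; apply: (@l1_sum_lt_pinfty _ _ _ (real_norm b)) => s us.
by rewrite (le_trans _ (l1_norm_ge b us)) //; apply: ler_sum.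
Qed.

Lemma ell1_dominated_le (V W : normedModType R[i]) (a : ell1 V) (b : ell1 W) :
  (forall n, real_norm (a n) <= real_norm (b n)) -> real_norm a <= real_norm b.
Proof.
move=> ab; apply: l1_norm_le => s us; rewrite (le_trans _ (l1_norm_ge b us)) //.
exact: ler_sum.
Qed.

Fact orbit_restr_l1 (x : S) a : (fun n => a n (act n x) : C) \in @l1_summable R C.
Proof. by apply: (ell1_dominated (b := a)) => n; exact: real_norm_cfun_ge. Qed.

(** This is the map from [a] to pi(a) e_0 for the representation to be built; [const_ell1] is a
    linear section of it. *)
Definition orbit_restr x a : ell1 C := Ell1 (orbit_restr_l1 x a).

Fact const_ell1_l1 xi : (fun n => cfun_cst S (xi n)) \in @l1_summable R cfun.
Proof. by apply: (ell1_dominated (b := xi)) => n; rewrite real_norm_cfun_cst. Qed.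

Definition const_ell1 xi : A := Ell1 (const_ell1_l1 xi).

Lemma orbit_restrE x a n : orbit_restr x a n = a n (act n x). Proof. by []. Qed.
Lemma const_ell1E xi n : const_ell1 xi n = cfun_cst S (xi n). Proof. by []. Qed.

Lemma orbit_restrD x a b : orbit_restr x (a + b) = orbit_restr x a + orbit_restr x b.
Proof. exact/ell1_eqP. Qed.
Lemma orbit_restrZ x k a : orbit_restr x (k *: a) = k *: orbit_restr x a.
Proof. exact/ell1_eqP. Qed.
Lemma orbit_restrB x a b : orbit_restr x (a - b) = orbit_restr x a - orbit_restr x b.
Proof. exact/ell1_eqP. Qed.
Lemma const_ell1D xi eta : const_ell1 (xi + eta) = const_ell1 xi + const_ell1 eta.
Proof. by apply/ell1_eqP => n; apply/cfunP. Qed.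
Lemma const_ell1Z k xi : const_ell1 (k *: xi) = k *: const_ell1 xi.
Proof. by apply/ell1_eqP => n; apply/cfunP. Qed.

Lemma orbit_restr_le x a : real_norm (orbit_restr x a) <= real_norm a.
Proof. by apply: ell1_dominated_le => n; exact: real_norm_cfun_ge. Qed.
Lemma const_ell1_le xi : real_norm (const_ell1 xi) <= real_norm xi.
Proof. by apply: ell1_dominated_le => n; rewrite real_norm_cfun_cst. Qed.

Lemma orbit_restr_single x n f : orbit_restr x (single n f) = single n (f (act n x) : C).
Proof.
by apply/ell1_eqP => m; rewrite orbit_restrE !singleE; case: eqP => [->|].
Qed.

Lemma const_ell1_single n (k : C) : const_ell1 (single n k) = single n (cfun_cst S k).
Proof. by apply/ell1_eqP => m; rewrite const_ell1E !singleE; case: eqP. Qed.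

Lemma const_ell1K x : cancel const_ell1 (orbit_restr x).
Proof. by move=> xi; apply/ell1_eqP. Qed.

(** Says that the kernel of [orbit_restr x] is a left ideal, so that left multiplication descends to
    its image; this is what makes [restr_act] multiplicative. *)
Lemma orbit_restr_mul x a d :
  orbit_restr x (a ** d) = orbit_restr x (a ** const_ell1 (orbit_restr x d)).
Proof.
apply/subr0_eq; rewrite -orbit_restrB -ell1_mulBr; set e := _ - _.
apply: (@ell1_eq0 _ _ _ (fun a => orbit_restr x (a ** e)) (real_norm e)).
- by move=> b c; rewrite ell1_mulDl orbit_restrD.
- move=> b; rewrite (le_trans (orbit_restr_le _ _)) // mulrC.
  exact: real_norm_mul.
move=> m f; apply/ell1_eqP => n; rewrite orbit_restrE single_mull cfunME alphaE.
rewrite /e ell1B cfunBE const_ell1E orbit_restrE cfun_cstE -actD.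
by rewrite [- m + n]addrC subrr mulr0.
Qed.

Variable x : S.

Definition restr_act a xi := orbit_restr x (a ** const_ell1 xi).

Fact restr_act_linearr a : linear (restr_act a).
Proof.
by move=> k u v; rewrite /restr_act const_ell1D const_ell1Z ell1_mulDr ell1_mulZr
  orbit_restrD orbit_restrZ.
Qed.
Fact restr_act_linearl v : linear (restr_act^~ v).
Proof.
by move=> k a b; rewrite /restr_act ell1_mulDl ell1_mulZl orbit_restrD orbit_restrZ.
Qed.
Fact restr_act_mul a b v : restr_act (a ** b) v = restr_act a (restr_act b v).
Proof. by rewrite /restr_act -ell1_mulA orbit_restr_mul. Qed.

Definition orbit_rep : representation S (ell1 C) :=
  Representation restr_act_linearr restr_act_linearl restr_act_mul.

Lemma orbit_repE a xi : orbit_rep a xi = orbit_restr x (a ** const_ell1 xi).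
Proof. by []. Qed.

Lemma orbit_rep_single m f n (k : C) :
  orbit_rep (single m f) (single n k) = single (m + n) (f (act (m + n) x) * k).
Proof.
rewrite orbit_repE const_ell1_single single_mul orbit_restr_single cfunME.
by rewrite alpha_cst cfun_cstE.
Qed.

Lemma orbit_rep_embed f xi n : orbit_rep (embed f) xi n = f (act n x) * xi n.
Proof. by rewrite orbit_repE orbit_restrE single_mull subr0 alpha0 cfunME. Qed.

Lemma orbit_rep_const xi : orbit_rep (const_ell1 xi) (single 0 (1 : C)) = xi.
Proof. by rewrite orbit_repE const_ell1_single -/(one R S) ell1_mul1r const_ell1K. Qed.

Lemma orbit_rep_le a xi : real_norm (orbit_rep a xi) <= real_norm a * real_norm xi.
Proof.
rewrite (le_trans (orbit_restr_le _ _)) // (le_trans (real_norm_mul _ _)) //.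
by rewrite ler_wpM2l ?real_norm_ge0 // const_ell1_le.
Qed.

Hypothesis xa : aper S x.

(* A function concentrated near one point of the orbit cuts a nonzero vector down
   to a small perturbation of a basis vector, which generates
   because 1 - t is invertible for |t| < 1. *)
Lemma orbit_rep_irreducible : algebraically_irreducible orbit_rep.
Proof.
have one_e n : orbit_rep (one R S) (single n (1 : C)) = single n (1 : C).
  by rewrite orbit_rep_single add0r cfun_cstE mulr1.
split.
  exists (one R S), (single 0 (1 : C)); rewrite one_e => /(congr1 (fun xi => ell1_fun xi 0)).
  by rewrite singleE eqxx => /eqP; rewrite oner_eq0.
move=> W [W0 Wl Wpi].
have [WN|nW] := pselect (exists2 xi, W xi & xi <> 0); last first.
  left; apply/seteqP; split => [xi Wxi|_ -> //].
  by apply: contrapT => xi0; apply: nW; exists xi.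
right; apply/seteqP; split => // eta _.
have [xi Wxi xi0] := WN.
have [k xik] : exists k, xi k <> 0.
  by apply/existsNP => xi00; apply: xi0; exact/ell1_eqP.
have e0 : 0 < real_norm (xi k).
  rewrite lt_neqAle real_norm_ge0 andbT eq_sym; apply/eqP.
  by move=> /real_norm_eq0.
(* Tolerance |xi k|: after division by [xi k] the tail of [xi] outside [s] has norm below 1. *)
have [s se] := ell1_approx xi e0.
have finF : finite_set ([set act n x | n in [set` s]] `\ act k x).
  by apply: finite_setD; apply: finite_image.
have acc := hausdorff_accessible (@space_hausdorff S).
have [|f [f1 f0 fb]] :=
  @cfun_separation R S _ (act k x) (iffLR accessible_finite_set_closed acc _ finF).
  by move=> [_]; apply.
pose zeta := (xi k)^-1 *: orbit_rep (embed f) xi.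
have Wz : W zeta by rewrite -[zeta]addr0; apply: Wl => //; exact: Wpi.
have zE : real_norm (zeta - single k (1 : C)) < 1.
  have -> : zeta - single k (1 : C) =
      (xi k)^-1 *: (orbit_rep (embed f) xi - single k (xi k)).
    by rewrite scalerBr -singleZ -[_ *: xi k]/(_ * _) mulVf //; exact/eqP.
  rewrite real_normZ real_normV ltr_pdivrMl // mulr1.
  apply: le_lt_trans se; apply: ell1_dominated_le => n.
  have -> : (orbit_rep (embed f) xi - single k (xi k)) n =
    orbit_rep (embed f) xi n - single k (xi k) n by [].
  rewrite orbit_rep_embed singleE.
  have [->|nk] := eqVneq n k; first by rewrite f1 mul1r subrr real_norm0 real_norm_ge0.
  rewrite subr0; have [ns|ns] := boolP (n \in s).
    rewrite f0 ?mul0r ?real_norm0 ?real_norm_ge0 //; split; first by exists n.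
    move=> /= /(congr1 (act (- k))); rewrite actK -actD => nkx.
    apply: (aper_actN xa _ nkx); rewrite addrC subr_eq0.
    by [].
  rewrite ell1B ell1_sumE [X in _ - X]big_seq [X in _ - X]big1 ?subr0; last first.
    by move=> m ms; rewrite singleE; case: eqP => // nm; rewrite nm ms in ns.
  by rewrite real_normM ler_piMl ?real_norm_ge0.
(* [- t] sends e_k to zeta - e_k, so zeta is the image of e_k under [one - t], and a left inverse
   recovers e_k from zeta. *)
pose t := - (const_ell1 (zeta - single k (1 : C)) ** dl (- k)).
have [|c ct _] := @neumann R S t.
  rewrite real_normN (le_lt_trans (real_norm_mul _ _)) //.
  rewrite real_norm_single real_norm_cfun_cst real_norm1 mulr1.
  by rewrite (le_lt_trans (const_ell1_le _)).
have dlk : orbit_rep (dl (- k)) (single k (1 : C)) = single 0 (1 : C).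
  by rewrite orbit_rep_single addNr cfun_cstE mulr1.
have We : W (single k (1 : C)).
  have <- : orbit_rep c zeta = single k (1 : C); last exact: Wpi.
  have <- : orbit_rep (one R S - t) (single k (1 : C)) = zeta.
    rewrite opprK repDl one_e rep_mul dlk orbit_rep_const.
    by rewrite addrC subrK.
  by rewrite -rep_mul ct one_e.
have <- : orbit_rep (const_ell1 eta) (orbit_rep (dl (- k)) (single k (1 : C))) = eta.
  by rewrite dlk orbit_rep_const.
exact: (Wpi _ _ (Wpi _ _ We)).
Qed.

Lemma orbit_repP : aperiodic_rep x orbit_rep.
Proof.
split.
- exact: orbit_rep_irreducible.
- move=> a v; rewrite -!(@Defs.real_normK R) -rmorphM lecR; exact: orbit_rep_le.
- move=> f k; rewrite orbit_rep_single add0r mulr1 -singleZ.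
  by congr single; rewrite -[_ *: _]/(_ * _) mulr1.
- by move=> k; rewrite deltaE orbit_rep_single cfun_cstE mulr1 addrC.
Qed.

End OrbitRestriction.

Section AperiodicKernel.
Variables (R : realType) (S : dynamical_system).
Local Notation C := (R[i]%type)^o.
Local Notation cfun := (cfun R S).
Local Notation A := (ell1_dyn R S).
Local Notation "a ** b" := (ell1_mul a b) (at level 40, left associativity).
Local Notation dl := (dl R S).
Implicit Types (f g h : cfun) (a b c d : A) (xi : ell1 C).
Variables (x : S) (pi : representation S (ell1 C)).
Hypothesis (pix : aperiodic_rep x pi).

Local Notation e k := (single k (1 : C)).

Lemma basis_ell1_neq0 k : e k <> 0.
Proof.
move=> /(congr1 (fun xi => ell1_fun xi k)); rewrite singleE eqxx => /eqP.
by rewrite oner_eq0.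
Qed.

Lemma aperiodic_rep_dl n : pi (dl n) (e 0) = e n.
Proof.
have [irr _ _ pid] := pix.
elim/int_ind: n => [|n IH|n IH]; first by rewrite -oneE rep1.
  by rewrite -addn1 PoszD addrC -dlD rep_mul IH -deltaE pid addrC.
rewrite -addn1 PoszD opprD addrC -dlD rep_mul IH -[in LHS](subrK 1 (- Posz n)).
by rewrite -pid deltaE dlK // addrC.
Qed.

(** Every vector is [pi a (e 0)], and delta^n carries e 0 to e n, so the action of [f] is governed
    by its values along the orbit. *)
Lemma aperiodic_rep_kerC f : (forall k, f (act k x) = 0) -> kerC pi f.
Proof.
have [irr _ pif _] := pix => f0 v.
have [a <-] := irreducible_cyclic irr (@basis_ell1_neq0 0) v.
rewrite -rep_mul; apply: rep_coef0 => // n.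
rewrite single_mull subr0 alpha0 single_embed rep_mul aperiodic_rep_dl pif.
by rewrite cfunME f0 mul0r scale0r.
Qed.

Lemma aperiodic_rep_support : is_rep_support pi (closure (orbit x)).
Proof.
have [irr _ pif _] := pix; split; first exact: closed_closure.
apply/seteqP; split => f fk; last first.
  apply: aperiodic_rep_kerC => k; apply: fk; apply: subset_closure.
  by exists k.
have f0 k : f (act k x) = 0.
  have := fk (e k); rewrite pif => /eqP; rewrite scaler_eq0 => /orP[/eqP//|/eqP].
  by move=> /basis_ell1_neq0.
move=> y xy; apply: (@real_norm_small _ C) => r r0.
have fy : f z @[z --> y] --> (f y : C) by exact: cts_fun.
have [_ [[k _ <-]]] := xy _ (cvg_real_norm fy r0).
by rewrite /= f0 subr0.
Qed.

Lemma aperiodic_kernelE : aper S x -> rep_kernel pi =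
  [set a : A | forall n z, closure (orbit x) z -> a n z = 0].
Proof.
have [irr _ pif _] := pix; move=> xa; have YP := aperiodic_rep_support.
apply/seteqP; split => a ak; last by move=> v; apply: (support_coef irr YP).
move=> n; apply/(supportE YP)/aperiodic_rep_kerC => k.
apply: (support_aper irr YP) => //; first by apply: subset_closure; exists k.
by rewrite /aper /= orbit_act.
Qed.

End AperiodicKernel.

(** * Models on columns for periodic points *)

Section Columns.
Variables (R : realType) (S : dynamical_system) (p : nat).
Local Notation e j := (delta_mx j 0 : 'cV[R[i]]_p).

Lemma col_basis (v : 'cV[R[i]]_p) : v = \sum_j v j 0 *: e j.
Proof.
apply/colP => i; rewrite summxE (bigD1 i) //= big1 => [|j ji].
  by rewrite !mxE !eqxx mulr1 addr0.
by rewrite !mxE eq_sym (negPf ji) mulr0.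
Qed.

Lemma rep_col (pi : representation S 'cV[R[i]]_p) a v :
  pi a v = \sum_j v j 0 *: pi a (e j).
Proof.
by rewrite {1}[v]col_basis rep_sumr; apply: eq_bigr => j _; rewrite repZr.
Qed.

End Columns.

Section PeriodicRep.
Variables (R : realType) (S : dynamical_system).
Local Notation C := (R[i]%type)^o.
Local Notation cfun := (cfun R S).
Local Notation A := (ell1_dyn R S).
Local Notation "a ** b" := (ell1_mul a b) (at level 40, left associativity).
Local Notation dl := (dl R S).
Implicit Types (f g h : cfun) (a b c d : A) (xi : ell1 C).
Variables (x : S) (p : nat) (l : R[i]).
Hypotheses (xp : has_period x p) (l1 : real_norm (l : C) = 1).
Local Notation E := 'cV[R[i]]_p.
Implicit Types v w : E.

Let p0 : (0 < p)%N. Proof. by case: xp. Qed.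
Let Ccvg (F : set_system C) : ProperFilter F -> cauchy F -> cvg F.
Proof. exact: complex_complete. Qed.

(** The map from [a] to pi(a) e_0 for the representation at the periodic point [x], with [lift_col]
    as its section; the same construction as for aperiodic points. *)
Definition periodize a : E := \col_(j < p) wsum p l (orbit_restr x a) j.

Definition lift_col v : A := \sum_(j < p) single j (cfun_cst S (v j 0 : C)).

Lemma periodizeE a j : periodize a j 0 = wsum p l (orbit_restr x a) j.
Proof. by rewrite mxE. Qed.

Lemma periodizeD a b : periodize (a + b) = periodize a + periodize b.
Proof.
apply/colP => j; rewrite [RHS]mxE; apply: (etrans (periodizeE _ _)).
apply: (etrans _ (esym (f_equal2 +%R (periodizeE a j) (periodizeE b j)))).
by rewrite orbit_restrD; exact: (wsumD _ l1 Ccvg).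
Qed.
Lemma periodizeZ k a : periodize (k *: a) = k *: periodize a.
Proof.
apply/colP => j; rewrite [RHS]mxE; apply: (etrans (periodizeE _ _)).
apply: (etrans _ (esym (f_equal ( *%R k) (periodizeE a j)))).
by rewrite orbit_restrZ; exact: (wsumZ _ l1 Ccvg).
Qed.
Lemma periodizeB a b : periodize (a - b) = periodize a - periodize b.
Proof. by rewrite periodizeD -scaleN1r periodizeZ scaleN1r. Qed.
Lemma lift_colD v w : lift_col (v + w) = lift_col v + lift_col w.
Proof.
rewrite /lift_col -big_split; apply: eq_bigr => j _ /=; rewrite -singleD mxE.
by congr single; apply/cfunP.
Qed.
Lemma lift_colZ k v : lift_col (k *: v) = k *: lift_col v.
Proof.
rewrite /lift_col scaler_sumr; apply: eq_bigr => j _; rewrite -singleZ mxE.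
by congr single; apply/cfunP.
Qed.

Lemma periodize_le a j : real_norm (periodize a j 0 : C) <= real_norm a.
Proof.
by rewrite mxE (le_trans (wsum_le _ l1 Ccvg _ _)) // orbit_restr_le.
Qed.

Lemma lift_col_le v : real_norm (lift_col v) <= \sum_(j < p) real_norm (v j 0 : C).
Proof.
rewrite (le_trans (real_norm_sum _ _ _)) // ler_sum // => j _.
by rewrite real_norm_single real_norm_cfun_cst.
Qed.

Lemma lift_periodize_le a : real_norm (lift_col (periodize a)) <= p%:R * real_norm a.
Proof.
rewrite (le_trans (lift_col_le _)) // mulr_natl -[X in _ *+ X]card_ord -sumr_const.
by rewrite ler_sum // => j _; exact: periodize_le.
Qed.

Lemma periodize_single n f j :
  periodize (single n f) j 0 = (wcoef p l j n : R[i]) * f (act n x).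
Proof. by rewrite mxE orbit_restr_single wsum_single. Qed.

Lemma lift_col_delta (j : 'I_p) k :
  lift_col (k *: delta_mx j 0) = single j (cfun_cst S (k : C)).
Proof.
rewrite /lift_col (bigD1 j) //= big1 => [|i ij].
  by rewrite addr0 !mxE !eqxx mulr1.
by rewrite !mxE (negPf ij) mulr0 (_ : cfun_cst S (0 : C) = 0) ?single0.
Qed.

Lemma lift_errD a b : (a + b) - lift_col (periodize (a + b)) =
  (a - lift_col (periodize a)) + (b - lift_col (periodize b)).
Proof. by rewrite periodizeD lift_colD opprD addrACA. Qed.

(** The kernel of [periodize] is a left ideal. Density in [a] and then in [d] leaves two elements
    [single m f] and [single n g], for which the relation is additivity of exponents of [l] when a
    multiple of [p] is split off. *)
Lemma periodize_mul a d :
  periodize (a ** d) = periodize (a ** lift_col (periodize d)).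
Proof.
apply/subr0_eq; rewrite -periodizeB -ell1_mulBr; set e := d - _.
apply/colP => j; rewrite [RHS]mxE.
apply: (@ell1_eq0 _ _ _ (fun a => periodize (a ** e) j 0 : C) (real_norm e)).
- by move=> b c; rewrite ell1_mulDl periodizeD mxE.
- by move=> b; rewrite (le_trans (periodize_le _ _)) // mulrC real_norm_mul.
move=> m f; rewrite {}/e; set a' := single m f.
apply: (@ell1_eq0 _ _ _ (fun d => periodize (a' ** (d - lift_col (periodize d))) j 0 : C)
  (real_norm a' * (1 + p%:R))).
- by move=> b c; rewrite (lift_errD b c) ell1_mulDr periodizeD mxE.
- move=> b; rewrite (le_trans (periodize_le _ _)) // (le_trans (real_norm_mul _ _)) //.
  rewrite -mulrA ler_wpM2l ?real_norm_ge0 // (le_trans (real_normB _ _)) //.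
  by rewrite mulrDl mul1r lerD // lift_periodize_le.
move=> n g; have [i [ni wi wj]] := wcoef_mod l p0 n.
have px : act p x = x by case: xp.
have -> : periodize (single n g) = (l ^ (n %/ p)%Z * g (act n x)) *: delta_mx i 0.
  apply/colP => k; rewrite periodize_single !mxE eqxx andbT.
  have [->|ki] := eqVneq k i; first by rewrite wi mulr1.
  by rewrite wj // mul0r mulr0.
rewrite lift_col_delta ell1_mulBr !single_mul periodizeB [LHS]mxE [X in _ + X]mxE.
have ix : act n x = act i x by rewrite (act_modz n px) ni.
have E1 : cfun_mul f (alpha m g) (act (m + n) x) = f (act (m + n) x) * g (act n x).
  by rewrite cfunME alphaE -actD addKr.
have E2 (k : C) : cfun_mul f (alpha m (cfun_cst S k)) (act (m + i) x) =
    f (act (m + n) x) * k.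
  by rewrite cfunME alphaE cfun_cstE !actD ix.
apply/eqP; rewrite subr_eq0; apply/eqP; apply: (etrans (periodize_single _ _ _)).
apply: (etrans _ (esym (periodize_single _ _ _))); rewrite E1 E2.
have -> : (wcoef p l j (m + n) : R[i]) = wcoef p l j (m + i) * l ^ (n %/ p)%Z.
  have nE : m + n = (n %/ p)%Z * p + (m + i) by rewrite {1}(divz_eq n p) ni; ring.
  rewrite !wcoefE nE modzMDl divzMDl; last by rewrite -lt0n; case: (p) p0.
  case: ifP => _; last by rewrite mul0r.
  by rewrite exprzDr ?unitfE ?(unit_neq0 l1) // mulrC.
by rewrite -!mulrA; congr (_ * _); rewrite mulrCA.
Qed.

Definition periodic_act a v := periodize (a ** lift_col v).

Fact periodic_act_linearr a : linear (periodic_act a).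
Proof.
by move=> k u v; rewrite /periodic_act lift_colD lift_colZ ell1_mulDr ell1_mulZr
  periodizeD periodizeZ.
Qed.
Fact periodic_act_linearl v : linear (periodic_act^~ v).
Proof.
by move=> k a b; rewrite /periodic_act ell1_mulDl ell1_mulZl periodizeD periodizeZ.
Qed.
Fact periodic_act_mul a b v : periodic_act (a ** b) v = periodic_act a (periodic_act b v).
Proof. by rewrite /periodic_act -ell1_mulA periodize_mul. Qed.

Definition cyclic_rep : representation S E :=
  Representation periodic_act_linearr periodic_act_linearl periodic_act_mul.

Local Notation e j := (delta_mx j 0 : E).

Lemma cyclic_rep_basis n f (j k : 'I_p) :
  cyclic_rep (single n f) (e j) k 0 =
  (wcoef p l k (n + j) : R[i]) * f (act (n + j) x).
Proof.
rewrite -[e j]scale1r -[LHS]/(periodize (_ ** lift_col _) _ _) lift_col_delta.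
by rewrite single_mul periodize_single cfunME alpha_cst cfun_cstE mulr1.
Qed.

Lemma wcoef_small (j k : 'I_p) : wcoef p l k j = (k == j)%:R.
Proof.
rewrite wcoefE modz_small; last by rewrite ltz_nat ltn_ord.
rewrite divz_small; last by rewrite ltz_nat ltn_ord.
rewrite eqz_nat -[k == j]/(val k == val j) eq_sym.
by case: ifP => _; rewrite ?expr0z.
Qed.

Lemma cyclic_rep_embed f (j : 'I_p) : cyclic_rep (embed f) (e j) = f (act j x) *: e j.
Proof.
apply/colP => k; rewrite cyclic_rep_basis add0r wcoef_small !mxE eqxx andbT.
by rewrite mulrC.
Qed.

Lemma cyclic_rep_dl (n : int) (j k : 'I_p) : n + j = k ->
  cyclic_rep (dl n) (e j) = e k.
Proof.
move=> njk; apply/colP => i; rewrite cyclic_rep_basis njk wcoef_small !mxE.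
by rewrite cfun_cstE mulr1 eqxx andbT.
Qed.

Lemma cyclic_rep_irreducible : algebraically_irreducible cyclic_rep.
Proof.
have e0 (j : 'I_p) : e j <> 0.
  by move=> /colP/(_ j); rewrite !mxE !eqxx => /eqP; rewrite oner_eq0.
split.
  exists (dl 0), (e (Ordinal p0)); rewrite (@cyclic_rep_dl _ _ (Ordinal p0)) //.
move=> W [W0 Wl Wpi].
have [[v Wv v0]|nW] := pselect (exists2 v, W v & v <> 0); last first.
  left; apply/seteqP; split => [v Wv|_ -> //].
  by apply: contrapT => v0; apply: nW; exists v.
right; apply/seteqP; split => // w _.
have WZ k u : W u -> W (k *: u) by move=> Wu; rewrite -[_ *: u]addr0; exact: Wl.
have WD u u' : W u -> W u' -> W (u + u') by move=> Wu; rewrite -[u]scale1r; exact: Wl.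
have [j vj] : exists j, v j 0 <> 0.
  by apply/existsNP => v00; apply: v0; apply/colP => j; rewrite v00 mxE.
have [h [h1 h0]] := orbit_bump R xp (ex_intro2 _ _ (Posz j) I erefl).
have Wej : W (e j).
  have <- : (v j 0)^-1 *: cyclic_rep (embed h) v = e j; last by apply: WZ; exact: Wpi.
  rewrite rep_col (eq_bigr (fun k : 'I_p => v k 0 *: (h (act k x) *: e k))); last first.
    by move=> k _; rewrite cyclic_rep_embed.
  rewrite (bigD1 j) //= big1 => [|k kj].
    rewrite addr0 [h _]h1 scale1r scalerA mulVf ?scale1r //.
    exact/eqP.
  rewrite h0 ?scale0r ?scaler0 //; first by exists (Posz k).
  apply: contra kj => /eqP kj; apply/eqP/val_inj.
  by apply: (has_period_inj xp) => //; exact: ltn_ord.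
(* Exponents of delta range over all integers, so lower indices are reached without wrapping
   around. *)
have We k : W (e k).
  by rewrite -(@cyclic_rep_dl (Posz k - Posz j) j k) ?subrK //; exact: Wpi.
by rewrite [w]col_basis; elim/big_rec: _ => // k u _ Wu; apply: WD => //; exact: WZ.
Qed.

Lemma cyclic_repP : periodic_rep x l cyclic_rep.
Proof.
split.
- exact: cyclic_rep_irreducible.
- move=> v k a; apply: (@real_norm_cvg R C A (nbhs (a : A)) _
    (fun b => cyclic_rep b v k 0) (cyclic_rep a v k 0)) => r r0.
  have aa : b @[b --> (a : A)] --> (a : A) by exact: cvg_id.
  have K0 : 0 < real_norm (lift_col v) + 1 by rewrite ltr_wpDl // real_norm_ge0.
  apply: filterS (cvg_real_norm aa (divr_gt0 r0 K0)) => b ab.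
  rewrite -[X in X <= _]/(real_norm (cyclic_rep a v k 0 - cyclic_rep b v k 0 : C)).
  have -> : cyclic_rep a v k 0 - cyclic_rep b v k 0 = cyclic_rep (a - b) v k 0.
    by rewrite repBl; move: (cyclic_rep a v) (cyclic_rep b v) => u w; rewrite !mxE.
  rewrite (le_trans (periodize_le _ _)) // (le_trans (real_norm_mul _ _)) //.
  rewrite (le_trans (ler_wpM2r (real_norm_ge0 _) ab)) // -mulrA ger_pMr //.
  by rewrite mulrC ler_pdivrMr // mul1r lerDl.
- exact: cyclic_rep_embed.
- by move=> j k kj; rewrite deltaE; apply: cyclic_rep_dl; rewrite kj; lia.
move=> j k jp k0; rewrite deltaE; apply/colP => i.
rewrite cyclic_rep_basis cfun_cstE mulr1 !mxE eqxx andbT.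
rewrite wcoefE (_ : 1 + Posz j = Posz p); last by lia.
rewrite modzz divzz (_ : (Posz p != 0) = true) ?expr1z; last by case: (p) p0.
rewrite eq_sym eqz_nat -k0.
by case: eqP => [/val_inj ->|ik]; rewrite ?eqxx ?mulr1 //; case: eqP => [ik'|];
  rewrite ?mulr0 //; case: ik; rewrite ik'.
Qed.

End PeriodicRep.

Section PeriodicRepKernel.
Variables (R : realType) (S : dynamical_system).
Local Notation C := (R[i]%type)^o.
Local Notation dl := (dl R S).
Variables (x : S) (p : nat) (l : R[i]) (pi : representation S 'cV[R[i]]_p).
Hypotheses (xp : has_period x p) (pix : periodic_rep x l pi).
Local Notation e j := (delta_mx j 0 : 'cV[R[i]]_p).

Let p0 : (0 < p)%N. Proof. by case: xp. Qed.

Lemma periodic_rep_support : is_rep_support pi (orbit x).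
Proof.
have [irr _ pif _ _] := pix; split; first exact/orbit_closed/(has_period_per xp).
have [_ px _] := xp.
apply/seteqP; split => f fk.
  rewrite (finite_orbit p0 px) => _ [j /= jp <-].
  have /colP/(_ (Ordinal jp)) := fk (e (Ordinal jp)).
  by rewrite pif !mxE !eqxx mulr1.
move=> v; rewrite [v]col_basis rep_sumr big1 // => j _.
by rewrite repZr pif fk ?scale0r ?scaler0 //; exists (Posz j).
Qed.

Lemma periodic_rep_shift (n : nat) (j k : 'I_p) : (n + j = k)%N ->
  pi (dl n) (e j) = e k.
Proof.
have [irr _ _ pid _] := pix.
elim: n k => [|n IH] k njk.
  by rewrite -oneE rep1 //; congr (delta_mx _ _); apply/val_inj.
have np : (n + j < p)%N by rewrite (leq_trans _ (ltn_ord k)) // -njk.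
rewrite (_ : Posz n.+1 = 1 + Posz n) // -dlD rep_mul (IH (Ordinal np)) // -deltaE; apply: pid.
by rewrite /= -njk.
Qed.

Lemma periodic_rep_power v : pi (dl p) v = l *: v.
Proof.
have [irr _ _ _ pil] := pix; rewrite [v]col_basis rep_sumr scaler_sumr.
apply: eq_bigr => j _; rewrite repZr scalerA mulrC -scalerA; congr (_ *: _).
have mp : (p.-1 < p)%N by rewrite prednK.
(* From index j the shift climbs to the last basis vector, wraps around to index 0 with the factor
   [l], and climbs back to j. *)
have -> : Posz p = Posz j + (1 + Posz (p.-1 - j)%N).
  by have := ltn_ord j; lia.
rewrite -dlD rep_mul -dlD rep_mul (@periodic_rep_shift _ j (Ordinal mp)); last first.
  by rewrite /= subnK // -ltnS prednK.
rewrite -deltaE (pil _ (Ordinal p0)) //=; last by rewrite prednK.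
by rewrite repZr (@periodic_rep_shift _ _ j) //= addn0.
Qed.

Lemma periodic_rep_kernel : real_norm (l : C) = 1 ->
  rep_kernel pi = periodic_kernel x p l.
Proof.
have [irr _ _ _ _] := pix; move=> l1.
exact: (periodic_kernelE irr xp periodic_rep_support l1 periodic_rep_power).
Qed.

End PeriodicRepKernel.

(** * Quotients by left ideals and compactness *)

Section QuotientRepresentation.
Variables (R : realType) (S : dynamical_system).
Local Notation A := (ell1_dyn R S).
Local Notation "a ** b" := (ell1_mul a b) (at level 40, left associativity).

Record left_ideal := LeftIdeal {
  left_ideal_set :> set A;
  left_ideal0 : left_ideal_set 0;
  left_idealL : forall (k : R[i]) a b,
    left_ideal_set a -> left_ideal_set b -> left_ideal_set (k *: a + b);
  left_idealM : forall a b, left_ideal_set b -> left_ideal_set (a ** b) }.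

Definition left_ideal_mem (J : left_ideal) : A -> Prop := left_ideal_set J.
Coercion left_ideal_mem : left_ideal >-> Funclass.

Variable I : left_ideal.

Lemma left_idealZ k a : I a -> I (k *: a).
Proof. by move=> Ia; rewrite -[_ *: a]addr0; apply: left_idealL => //; exact: left_ideal0. Qed.
Lemma left_idealD a b : I a -> I b -> I (a + b).
Proof. by move=> Ia Ib; rewrite -[a]scale1r; exact: left_idealL. Qed.
Lemma left_idealN a : I a -> I (- a).
Proof. by rewrite -scaleN1r; exact: left_idealZ. Qed.
Lemma left_idealB a b : I a -> I b -> I (a - b).
Proof. by move=> Ia /left_idealN; exact: left_idealD. Qed.

(** A coset is kept as a subset of the algebra, so extensionality and proof irrelevance make equal
    cosets equal elements; the operations use chosen representatives. *)
Record quotient := Quotient {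
  quotient_class : set A;
  quotient_classP : exists a, quotient_class = [set b | I (b - a)] }.

HB.instance Definition _ := gen_eqMixin quotient.
HB.instance Definition _ := gen_choiceMixin quotient.

Definition coset a : quotient :=
  Quotient (ex_intro (fun a' => [set b | I (b - a)] = [set b | I (b - a')]) a erefl).

Definition representative (q : quotient) : A := sval (cid (quotient_classP q)).

Lemma coset_eq a b : I (a - b) -> coset a = coset b.
Proof.
move=> ab; have e : [set c | I (c - a)] = [set c | I (c - b)].
  apply/seteqP; split => c /= ca.
    by rewrite -(subrK a c) -addrA; exact: left_idealD.
  have -> : c - a = (c - b) - (a - b) by rewrite opprB addrA subrK.
  exact: left_idealB.
rewrite /coset; move: (ex_intro _ a _) (ex_intro _ b _); rewrite e => p q.
by congr Quotient; exact: Prop_irrelevance.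
Qed.

Lemma coset_inj a b : coset a = coset b -> I (a - b).
Proof.
move=> /(congr1 quotient_class)/= e.
by rewrite -[I _]/([set c | I (c - b)] a) -e /= subrr; exact: left_ideal0.
Qed.

Lemma representativeK q : coset (representative q) = q.
Proof.
rewrite /representative; case: cid => /= a; case: q => Q QP /= Qa.
rewrite /coset; move: (ex_intro _ a _); rewrite -Qa => p.
by congr Quotient; exact: Prop_irrelevance.
Qed.

Lemma representativeP a : I (representative (coset a) - a).
Proof. by apply: coset_inj; rewrite representativeK. Qed.

Definition quotient_add p q := coset (representative p + representative q).
Definition quotient_opp q := coset (- representative q).
Definition quotient_scale (k : R[i]) q := coset (k *: representative q).

Lemma cosetD a b : quotient_add (coset a) (coset b) = coset (a + b).
Proof.
apply: coset_eq; rewrite opprD addrACA.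
by apply: left_idealD; exact: representativeP.
Qed.
Lemma cosetN a : quotient_opp (coset a) = coset (- a).
Proof. by apply: coset_eq; rewrite -opprD; apply: left_idealN; exact: representativeP. Qed.
Lemma cosetZ k a : quotient_scale k (coset a) = coset (k *: a).
Proof. by apply: coset_eq; rewrite -scalerBr; apply: left_idealZ; exact: representativeP. Qed.

Fact quotient_addA : associative quotient_add.
Proof.
by move=> p q r; rewrite -(representativeK p) -(representativeK q) -(representativeK r)
  !cosetD addrA.
Qed.
Fact quotient_addC : commutative quotient_add.
Proof.
by move=> p q; rewrite -(representativeK p) -(representativeK q) !cosetD addrC.
Qed.
Fact quotient_add0 : left_id (coset 0) quotient_add.
Proof. by move=> q; rewrite -(representativeK q) cosetD add0r. Qed.
Fact quotient_addN : left_inverse (coset 0) quotient_opp quotient_add.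
Proof. by move=> q; rewrite -(representativeK q) cosetN cosetD addNr. Qed.
HB.instance Definition _ := GRing.isZmodule.Build quotient
  quotient_addA quotient_addC quotient_add0 quotient_addN.

Fact quotient_scaleA k m q : quotient_scale k (quotient_scale m q) = quotient_scale (k * m) q.
Proof. by rewrite -(representativeK q) !cosetZ scalerA. Qed.
Fact quotient_scale1 : left_id 1 quotient_scale.
Proof. by move=> q; rewrite -(representativeK q) cosetZ scale1r. Qed.
Fact quotient_scaleDr : right_distributive quotient_scale +%R.
Proof.
move=> k p q; rewrite -(representativeK p) -(representativeK q).
by rewrite -[_ + _]/(quotient_add _ _) cosetD !cosetZ -[RHS]/(quotient_add _ _) cosetD scalerDr.
Qed.
Fact quotient_scaleDl q : {morph quotient_scale^~ q : k m / k + m}.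
Proof.
move=> k m; rewrite -(representativeK q) !cosetZ -[RHS]/(quotient_add _ _) cosetD.
by rewrite scalerDl.
Qed.
HB.instance Definition _ := GRing.Zmodule_isLmodule.Build R[i] quotient
  quotient_scaleA quotient_scale1 quotient_scaleDr quotient_scaleDl.

Lemma coset_lin k a b : coset (k *: a + b) = k *: coset a + coset b.
Proof.
rewrite -[RHS]/(quotient_add (quotient_scale _ _) _).
by rewrite cosetZ cosetD.
Qed.

Definition quotient_act a q := coset (a ** representative q).

Lemma quotient_actE a b : quotient_act a (coset b) = coset (a ** b).
Proof.
by apply: coset_eq; rewrite -ell1_mulBr; apply: left_idealM; exact: representativeP.
Qed.

Fact quotient_act_linearr a : linear (quotient_act a).
Proof.
move=> k p q; rewrite -(representativeK p) -(representativeK q) -coset_lin.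
by rewrite !quotient_actE -coset_lin ell1_mulDr ell1_mulZr.
Qed.
Fact quotient_act_linearl q : linear (quotient_act^~ q).
Proof.
move=> k a b; rewrite -(representativeK q) !quotient_actE.
by rewrite ell1_mulDl ell1_mulZl coset_lin.
Qed.
Fact quotient_act_mul a b q : quotient_act (a ** b) q = quotient_act a (quotient_act b q).
Proof. by rewrite -(representativeK q) !quotient_actE ell1_mulA. Qed.

Definition quotient_rep : representation S quotient :=
  Representation quotient_act_linearr quotient_act_linearl quotient_act_mul.

Lemma coset0 : coset 0 = 0. Proof. by []. Qed.

Lemma coset_eq0 a : coset a = 0 <-> I a.
Proof.
split; first by rewrite -coset0 => /coset_inj; rewrite subr0.
by move=> Ia; rewrite -coset0; apply: coset_eq; rewrite subr0.
Qed.

Hypothesis I1 : ~ I (one R S).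
Hypothesis Imax : forall J : left_ideal, I `<=` J -> ~ J (one R S) -> J `<=` I.

(** The preimage of an invariant subspace is a left ideal above [I], so by maximality it either is
    [I] or contains the unit. *)
Lemma quotient_rep_irreducible : algebraically_irreducible quotient_rep.
Proof.
split.
  exists (one R S), (coset (one R S)).
  by rewrite -[quotient_rep _ _]/(quotient_act _ _) quotient_actE ell1_mul1l => /coset_eq0.
move=> W [W0 Wl Wpi].
have J0 : [set a | W (coset a)] 0 by rewrite /= coset0.
have JL k a b : [set a | W (coset a)] a -> [set a | W (coset a)] b ->
    [set a | W (coset a)] (k *: a + b).
  by move=> /= Wa Wb; rewrite coset_lin; exact: Wl.
have JM a b : [set a | W (coset a)] b -> [set a | W (coset a)] (a ** b).
  by move=> /= Wb; rewrite -quotient_actE; exact: (Wpi a).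
pose J := LeftIdeal J0 JL JM.
have [J1|nJ1] := pselect (J (one R S)).
  right; apply/seteqP; split => // q _; rewrite -(representativeK q).
  by rewrite -[representative q]ell1_mul1r -quotient_actE; exact: (Wpi (representative q)).
left; apply/seteqP; split => [q Wq|_ -> //].
rewrite /= -(representativeK q); apply/coset_eq0; apply: (Imax (J := J)) => //.
  by move=> a /coset_eq0 Ia; rewrite /J /= Ia.
by rewrite /J /= representativeK.
Qed.

End QuotientRepresentation.

Section Compactness.
Variables (R : realType) (S : dynamical_system).
Local Notation A := (ell1_dyn R S).
Local Notation "a ** b" := (ell1_mul a b) (at level 40, left associativity).

(** Zorn's lemma on subsets. The predicate [P] also admits [set0], the union of the empty chain; a
    maximal subset is not empty since [I] itself is admissible. *)
Lemma maximal_left_ideal (I : left_ideal R S) : ~ I (one R S) ->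
  exists M : left_ideal R S, [/\ I `<=` M, ~ M (one R S) &
    forall J : left_ideal R S, M `<=` J -> ~ J (one R S) -> J `<=` M].
Proof.
move=> I1; pose P (B : set A) := B = set0 \/ exists J : left_ideal R S,
  [/\ B = J, I `<=` J & ~ J (one R S)].
have chain (F : set (set A)) : F `<=` P -> total_on F subset -> P (\bigcup_(X in F) X).
  move=> FP Ftot; have [[B1 FB1 B1n]|nB] := pselect (exists2 B, F B & B !=set0); last first.
    left; apply/seteqP; split => // a [B FB Ba].
    by case: nB; exists B => //; exists a.
  right; have FJ B : F B -> B !=set0 -> exists J : left_ideal R S,
      [/\ B = J, I `<=` J & ~ J (one R S)].
    by move=> /FP[->|//] [].
  have U0 : (\bigcup_(X in F) X) 0.
    by have [J [B1J _ _]] := FJ _ FB1 B1n; exists B1 => //; rewrite B1J; exact: left_ideal0.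
  have UL k a b : (\bigcup_(X in F) X) a -> (\bigcup_(X in F) X) b ->
      (\bigcup_(X in F) X) (k *: a + b).
    move=> [X FX Xa] [Y FY Yb].
    have [XY|YX] := Ftot X Y FX FY.
      have [|J [YJ _ _]] := FJ Y FY; first by exists b.
      by exists Y => //; rewrite YJ; apply: left_idealL; rewrite -YJ //; exact: XY.
    have [|J [XJ _ _]] := FJ X FX; first by exists a.
    by exists X => //; rewrite XJ; apply: left_idealL; rewrite -XJ //; exact: YX.
  have UM a b : (\bigcup_(X in F) X) b -> (\bigcup_(X in F) X) (a ** b).
    move=> [X FX Xb]; have [|J [XJ _ _]] := FJ X FX; first by exists b.
    by exists X => //; rewrite XJ; apply: left_idealM; rewrite -XJ.
  exists (LeftIdeal U0 UL UM); split => //.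
    move=> a Ia; have [J [B1J IJ _]] := FJ _ FB1 B1n.
    by exists B1 => //; rewrite B1J; exact: IJ.
  move=> [X FX X1]; have [|J [XJ _ J1]] := FJ X FX; first by exists (one R S).
  by apply: J1; rewrite /left_ideal_mem -XJ.
have [B [PB Bmax]] := Zorn_bigcup chain.
case: PB => [B0|[M [BM IM M1]]].
  exfalso; apply: (Bmax (left_ideal_set I)); last by right; exists I; split.
  by split => [a|]; rewrite B0 //; move=> /(_ 0 (left_ideal0 I)).
exists M; split => // J MJ J1; apply: contrapT => nJM; apply: (Bmax J).
  by split; rewrite BM.
by right; exists J; split => //; exact: subset_trans MJ.
Qed.

(** Closure of [I] under right multiplication is what puts it into the annihilator of the whole
    quotient, and not only of the class of the unit. *)
Lemma primitive_above (I : left_ideal R S) : (forall a b, I a -> I (a ** b)) ->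
  ~ I (one R S) -> exists P : primitive_ideal R S, I `<=` P.
Proof.
move=> IM /maximal_left_ideal[M [IsubM M1 Mmax]].
have prim : primitive (rep_kernel (quotient_rep M)).
  exists (quotient M), (quotient_rep M); split => //.
  exact: quotient_rep_irreducible.
exists (PrimitiveIdeal prim) => a Ia q /=.
rewrite -(representativeK q) -[LHS]/(quotient_act _ _) quotient_actE.
by apply/coset_eq0/IsubM/IM.
Qed.

Lemma primitive_ideal_one (P : primitive_ideal R S) : ~ ideal_set P (one R S).
Proof.
have [E [pi [irr PE]]] := ideal_primitive P.
by rewrite PE => /(rep_kerN1 irr).
Qed.

Lemma primitive_ideal_left (P : primitive_ideal R S) :
  [/\ ideal_set P 0,
      forall (k : R[i]) a b, ideal_set P a -> ideal_set P b -> ideal_set P (k *: a + b),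
      forall a b, ideal_set P b -> ideal_set P (a ** b) &
      forall a b, ideal_set P a -> ideal_set P (a ** b)].
Proof.
have [E [pi [irr ->]]] := ideal_primitive P; split.
- by move=> v; rewrite rep0l.
- by move=> k a b Pa Pb v; rewrite repDl repZl Pa Pb scaler0 addr0.
- by move=> a b Pb v; rewrite rep_mul Pb rep0r.
- by move=> a b Pa v; rewrite rep_mul Pa.
Qed.

Lemma primitive_ideals_compact : compact [set: primitive_ideal R S].
Proof.
move=> F FF _.
pose I := [set a : A | exists2 G, F G & forall Q : primitive_ideal R S, G Q -> ideal_set Q a].
have I0 : I 0.
  by exists setT; [exact: filterT | move=> Q _; have [] := primitive_ideal_left Q].
have IL (k : R[i]) a b : I a -> I b -> I (k *: a + b).
  move=> [G FG Ga] [H FH Hb]; exists (G `&` H); first exact: filterI.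
  by move=> Q [/Ga Qa /Hb Qb]; have [_ + _ _] := primitive_ideal_left Q; exact.
have IMl a b : I b -> I (a ** b).
  move=> [G FG Gb]; exists G => // Q /Gb; have [_ _ + _] := primitive_ideal_left Q.
  exact.
have IMr a b : I a -> I (a ** b).
  move=> [G FG Gb]; exists G => // Q /Gb; have [_ _ _] := primitive_ideal_left Q.
  exact.
have [||P IP] := @primitive_above (LeftIdeal I0 IL IMl).
- exact: IMr.
- move=> [G FG G1]; have [Q GQ] := filter_ex FG.
  exact: (@primitive_ideal_one Q) (G1 Q GQ).
(* An element common to all ideals in [G] belongs to [I], hence to [P]. *)
exists P; split => // G B FG; have : closure G P; last exact.
by rewrite closure_hull_kernel => a Ga; apply: IP; exists G.
Qed.

End Compactness.

(** * Uniqueness of weighted sums *)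

Section FourierUniqueness.
Variable R : realType.
Local Notation C := (R[i]%type)^o.
Implicit Types (xi : ell1 C) (l k : R[i]) (p r : nat).

Let Ccvg (F : set_system C) : ProperFilter F -> cauchy F -> cvg F.
Proof. exact: complex_complete. Qed.

(** The residue r modulo p splits into r and r + p modulo 2p. If m is the quotient by 2p, the
    quotient by p is 2m or 2m + 1, so k^(n / p) is (k^2)^m or k (k^2)^m. *)
Lemma wcoef_double p k (r : nat) n : (0 < p)%N -> (r < p)%N ->
  real_norm (k : C) = 1 ->
  (wcoef p k r n : R[i]) = wcoef (2 * p) (k * k) r n + k * wcoef (2 * p) (k * k) (r + p) n.
Proof.
move=> p0 rp k1; have kU : k \is a GRing.unit by rewrite unitfE (unit_neq0 k1).
have pz : Posz p != 0 by case: (p) p0.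
have p2 : (0 < 2 * p)%N by rewrite muln_gt0.
have p2z : Posz (2 * p) != 0 by case: (2 * p)%N p2.
pose m := (n %/ (2 * p)%N)%Z; pose s := (n %% (2 * p)%N)%Z.
have nE : n = m * (2 * p)%N + s by exact: divz_eq.
have s0 : 0 <= s by rewrite modz_ge0.
have s2 : s < (2 * p)%N by rewrite ltz_mod // ltz_nat.
have kk : (k * k) ^ m = k ^ (2 * m) by rewrite -exprz_exp -expr2.
rewrite !wcoefE -/m -/s kk.
have [sp|ps] := ltP s (Posz p).
  have nE' : n = (2 * m) * p + s by rewrite {1}nE PoszM; ring.
  have -> : (n %/ p)%Z = 2 * m by rewrite nE' divzMDl // divz_small ?addr0 // s0.
  have -> : (n %% p)%Z = s by rewrite nE' modzMDl modz_small // s0.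
  rewrite (_ : (s == Posz (r + p)) = false) ?mulr0 ?addr0 //.
  by apply/eqP => h; move: sp; rewrite h PoszD; lia.
have nE' : n = (2 * m + 1) * p + (s - Posz p) by rewrite {1}nE PoszM; ring.
have sp0 : 0 <= s - Posz p by rewrite subr_ge0.
have spp : s - Posz p < Posz p by move: s2; rewrite PoszM; lia.
have -> : (n %/ p)%Z = 2 * m + 1 by rewrite nE' divzMDl // divz_small ?addr0 // sp0.
have -> : (n %% p)%Z = s - Posz p by rewrite nE' modzMDl modz_small // sp0.
rewrite (_ : (s == Posz r) = false) ?add0r; last first.
  by apply/eqP => h; move: ps; rewrite h; lia.
rewrite PoszD subr_eq; case: ifP => _; last by rewrite mulr0.
by rewrite exprzDr // mulrC expr1z.
Qed.

Lemma additive_sum0 (V W : zmodType) (T : V -> W) (F : int -> V) (s : seq int) :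
  {morph T : x y / x + y} -> (forall n, n \in s -> T (F n) = 0) ->
  T (\sum_(n <- s) F n) = 0.
Proof.
move=> TD; elim: s => [|n s IH] TF.
  by rewrite big_nil; apply: (@addrI _ (T 0)); rewrite -TD !addr0.
rewrite big_cons TD TF ?mem_head // IH ?addr0 // => m ms.
by rewrite TF // inE ms orbT.
Qed.

(* The coefficients are separated by halving: averaging over the two square roots
   of l passes from residues modulo p to residues modulo 2p. *)
Lemma wsum_double p xi : (0 < p)%N ->
  (forall l r, real_norm (l : C) = 1 -> (r < p)%N -> wsum p l xi r = 0) ->
  forall l r, real_norm (l : C) = 1 -> (r < 2 * p)%N -> wsum (2 * p) l xi r = 0.
Proof.
move=> p0 H l r l1 rp.
have [k kk] : exists k : R[i], k * k = l by exists (sqrtC l); rewrite -expr2 sqrtCK.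
have k1 : real_norm (k : C) = 1.
  apply/eqP; rewrite -(@eqrXn2 _ 2) ?real_norm_ge0 // expr1n expr2.
  by rewrite -(real_normM (k : C)) kk l1.
have kN1 : real_norm (- k : C) = 1 by rewrite real_normN.
have split_sum (m : R[i]) s : real_norm (m : C) = 1 -> m * m = l -> (s < p)%N ->
    wsum p m xi s = wsum (2 * p) l xi s + m * wsum (2 * p) l xi (s + p).
  move=> m1 mm sp; rewrite -[m * _]/(m *: (_ : C)) -(wsumZ (2 * p) l1 Ccvg).
  have fin1 := wsum_summable (2 * p) l1 xi s.
  have fin2 := wsum_summable (2 * p) l1 (m *: xi) (s + p).
  rewrite /wsum -(zsumD Ccvg fin1 fin2); congr zsum; apply/funext => n.
  rewrite (wcoef_double n p0 sp m1) mm scalerDl ell1Z !scalerA.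
  by congr (_ + _ *: _); rewrite mulrC.
(* The hypothesis for both square roots k and -k of [l] gives u + k v = 0 and u - k v = 0. *)
have even_odd (c u v : R[i]) : c != 0 -> u + c * v = 0 -> u + - c * v = 0 ->
    u = 0 /\ v = 0.
  move=> c0 h1 h2; have u0 : u = 0.
    have : 2 * u = 0 by rewrite -[RHS](addr0 0) -{1}h1 -h2; ring.
    by move=> /eqP; rewrite mulf_eq0 pnatr_eq0 => /eqP.
  by split => //; move: h1; rewrite u0 add0r => /eqP; rewrite mulf_eq0 (negPf c0) => /eqP.
have both s : (s < p)%N -> wsum (2 * p) l xi s = 0 /\ wsum (2 * p) l xi (s + p) = 0.
  move=> sp; have := split_sum k s k1 kk sp; rewrite H // => /esym h1.
  have := split_sum (- k) s kN1; rewrite mulrNN => /(_ kk sp); rewrite H // => /esym h2.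
  move: h1 h2; move: (wsum _ _ _ s) (wsum _ _ _ (s + p)) => u v h1 h2.
  by have [? ?] := even_odd k u v (unit_neq0 k1) h1 h2.
have [rp'|pr] := ltnP r p; first by have [] := both r rp'.
have [|_] := both (r - p)%N; last by rewrite subnK.
by rewrite ltn_subLR // addnn -mul2n.
Qed.

(** Doubling [p] often enough puts the finitely many relevant indices into residue classes other
    than that of [n0]. The weighted sum at l = 1 is then the coefficient at [n0] up to a small
    tail. *)
Lemma wsum_eq0 p xi : (0 < p)%N ->
  (forall l r, real_norm (l : C) = 1 -> (r < p)%N -> wsum p l xi r = 0) -> xi = 0.
Proof.
move=> p0 H; have Hk j : forall l r, real_norm (l : C) = 1 -> (r < 2 ^ j * p)%N ->
    wsum (2 ^ j * p) l xi r = 0.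
  elim: j => [|j IH]; first by rewrite expn0 mul1n.
  by rewrite expnS -mulnA; apply: wsum_double => //; rewrite muln_gt0 expn_gt0 p0.
apply/ell1_eqP => n0; apply: (@real_norm_small _ C) => e e0.
pose xi' := xi - single n0 (xi n0).
have xi'0 : xi' n0 = 0 by rewrite /xi' ell1B singleE eqxx subrr.
have [s se] := ell1_approx xi' e0.
(* Any [j] with 2^j above each |n - n0| would do; the sum dominates them all. *)
pose j := (\sum_(n <- s) `|(n - n0)%R|)%N.
have q0 : (0 < 2 ^ j * p)%N by rewrite muln_gt0 expn_gt0 p0.
have big n : n \in s -> (`|(n - n0)%R| < 2 ^ j * p)%N.
  move=> ns; apply: (@leq_ltn_trans j).
    by rewrite /j (big_rem n) //= leq_addr.
  by rewrite (leq_trans (ltn_expl j (ltnSn 1))) // leq_pmulr.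
have [i [ni wi _]] := wcoef_mod (1 : R[i]) q0 n0.
have one1 : real_norm ((1 : R[i]) : C) = 1 by exact: real_norm1.
have w0 n : n \in s -> (wcoef (2 ^ j * p) 1 i n : R[i]) *: xi' n = 0.
  move=> ns; have [->|nn0] := eqVneq n n0; first by rewrite xi'0 scaler0.
  rewrite wcoefE (_ : (_ == _) = false) ?scale0r //; apply/eqP => nm.
  have := big n ns; set q := (2 ^ j * p)%N in q0 ni nm *.
  have -> : n - n0 = ((n %/ q)%Z - (n0 %/ q)%Z) * q.
    by rewrite {1}(divz_eq n q) {1}(divz_eq n0 q) nm ni; ring.
  rewrite abszM absz_nat -[X in (_ < X)%N]mul1n ltn_pmul2r // ltnS leqn0 absz_eq0.
  rewrite subr_eq0 => /eqP ab; move/eqP: nn0; apply.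
  by rewrite (divz_eq n q) (divz_eq n0 q) ab nm ni.
have wsum_s : wsum (2 ^ j * p) 1 (\sum_(n <- s) single n (xi' n)) i = 0.
  apply: (additive_sum0 (T := fun x => wsum (2 ^ j * p) 1 x i)) => [x y|n ns].
    exact: (wsumD (2 ^ j * p) one1 Ccvg x y i).
  by rewrite wsum_single; exact: w0.
have := Hk j 1 i one1 (ltn_ord i).
rewrite -{1}[xi](subrK (single n0 (xi n0))) -/xi' (wsumD _ one1 Ccvg) wsum_single.
rewrite wi exp1rz scale1r => /eqP; rewrite addr_eq0 => /eqP wxi.
rewrite -real_normN -wxi -[xi'](subrK (\sum_(n <- s) single n (xi' n))).
rewrite (wsumD _ one1 Ccvg) wsum_s addr0.
by rewrite (le_trans (wsum_le _ one1 Ccvg _ _)) // ltW.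
Qed.

End FourierUniqueness.

(** * Ideals of orbits *)

Section SubspaceMetric.
Variables (R : realType) (M : metricType R) (B : set M).

Definition submetric := {m : M | B m}.
HB.instance Definition _ := gen_eqMixin submetric.
HB.instance Definition _ := gen_choiceMixin submetric.

Let dist (u v : submetric) : R := mdist (sval u) (sval v).
Let distxx u : dist u u = 0. Proof. exact: mdistxx. Qed.
Let dist_positivity u v : dist u v = 0 -> u = v.
Proof. by case: u v => [u uB] [v vB] /mdist_positivity /=; exact: eq_exist. Qed.
Let dist_sym u v : dist u v = dist v u. Proof. exact: metric_sym. Qed.
Let dist_triangle v u w : dist u w <= dist u v + dist v w.
Proof. exact: metric_triangle. Qed.
HB.instance Definition _ := isMetric.Build R submetric
  distxx dist_positivity dist_sym dist_triangle.

Lemma submetric_ball (u v : submetric) e : ball u e v <-> ball (sval u) e (sval v).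
Proof. by rewrite !ballEmdist. Qed.

Lemma submetric_openP (U : set submetric) :
  open U <-> exists2 V : set M, open V & U = (fun u => sval u) @^-1` V.
Proof.
split => [Uo|[V Vo ->]]; last first.
  rewrite openE => u /= Vu; rewrite /interior -nbhs_ballE.
  have : nbhs (sval u) V by exact: open_nbhs_nbhs.
  rewrite -nbhs_ballE => -[e e0 eV]; exists e => // v /submetric_ball uv.
  exact: eV.
(* Centres may lie outside [B]: this set collects the balls of [M] whose trace on [B] lies in
   [U]. *)
exists [set m | exists2 e : R, 0 < e & forall v : submetric, ball m e (sval v) -> U v].
  rewrite openE => m /= [e e0 eU]; rewrite /interior -nbhs_ballE.
  exists (e / 2); first by rewrite /= divr_gt0.
  move=> m' mm'; exists (e / 2); first by rewrite divr_gt0.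
  by move=> v m'v; apply: eU; rewrite (splitr e); exact: ball_triangle m'v.
apply/seteqP; split => u /=; last by case=> e e0; apply; exact: ballxx.
move=> Uu; have : nbhs u U by exact: open_nbhs_nbhs.
rewrite -nbhs_ballE => -[e e0 eU]; exists e => // v uv.
by apply: eU; exact/submetric_ball.
Qed.

End SubspaceMetric.

Lemma metrizable_sub (R : realType) (S : dynamical_system) (Y : set S) :
  metrizable R [set: S] -> metrizable R Y.
Proof.
move=> [M [h [hinj hT hO]]].
exists (submetric (h @^-1` Y)), (fun u => h (sval u)); split.
- by move=> [u hu] [v hv] /= /hinj uv; exact: eq_exist.
- apply/seteqP; split => [_ [[u hu] _ <-] //|y Yy].
  have [m _ my] : range h y by rewrite hT.
  have mY : (h @^-1` Y) m by rewrite /= my.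
  by exists (exist _ m mY).
- move=> U; rewrite submetric_openP; split => [[W /hO[V Vo ->] ->]|[V Vo ->]].
    by exists V.
  by exists (h @^-1` V) => //; apply/hO; exists V.
Qed.

Lemma dense_closureP (T : topologicalType) (D : set T) : dense D <-> closure D = setT.
Proof.
split=> [dD|DT U [x Ux] Uo].
  apply/seteqP; split => // x _ B /nbhs_interior xB.
  have [|y [/interior_subset By Dy]] := dD B° _ (@open_interior _ B).
    by exists x; exact: nbhs_singleton.
  by exists y.
have /(_ U)[|y [Dy Uy]] : closure D x by rewrite DT.
  exact: open_nbhs_nbhs.
by exists y.
Qed.

Section IdealsOfOrbits.
Variables (R : realType) (S : dynamical_system).
Local Notation C := (R[i]%type)^o.
Local Notation cfun := (cfun R S).
Local Notation A := (ell1_dyn R S).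
Local Notation dl := (dl R S).
Local Notation primitive_ideal := (primitive_ideal R S).
Implicit Types (x y z : S) (p : nat) (l : R[i]) (a : A) (f : cfun) (P Q : primitive_ideal).

Lemma unit_circleP l : `|l| = 1 <-> real_norm (l : C) = 1.
Proof.
split => [l1|l1]; first by apply: complexI; rewrite Defs.real_normK.
by rewrite -[LHS](@Defs.real_normK _ C) l1.
Qed.

Lemma primitive_ideal_inj P Q : ideal_set P = ideal_set Q -> P = Q.
Proof.
case: P Q => [P HP] [Q HQ] /= PQ; subst Q.
by congr PrimitiveIdeal; exact: Prop_irrelevance.
Qed.

Definition vanishing (Y : set S) : set A := [set a : A | forall n z, Y z -> a n z = 0].

Lemma vanishingS (Y Z : set S) : Y `<=` Z -> vanishing Z `<=` vanishing Y.
Proof. by move=> YZ a Za n z /YZ; exact: Za. Qed.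

Lemma vanishing_embed (Y : set S) f : vanishing Y (embed f) <-> forall z, Y z -> f z = 0.
Proof.
split=> [f0 z Yz|f0 n z Yz]; first by have := f0 0 z Yz; rewrite embedE eqxx.
by rewrite embedE; case: ifP => // _; exact: f0.
Qed.

(** Urysohn functions detect inclusion in a closed set; this is how inclusions of ideals become
    inclusions of orbit closures. *)
Lemma closed_subP (Y Z : set S) : closed Z ->
  (forall f, (forall z, Z z -> f z = 0) -> forall y, Y y -> f y = 0) -> Y `<=` Z.
Proof.
move=> Zcl YZ y Yy; apply: contrapT => nZy.
have [f [fy fZ _]] := cfun_separation R Zcl nZy.
by have /eqP := YZ f fZ y Yy; rewrite fy oner_eq0.
Qed.

(** Trades the existential over representations for an explicit kernel: any representation with the
    listed properties has this kernel, and [cyclic_rep] provides one. *)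
Lemma periodic_idealP (P : set A) (O : set S) l : real_norm (l : C) = 1 ->
  periodic_ideal O l P <->
  exists x p, [/\ has_period x p, O = orbit x & P = periodic_kernel x p l].
Proof.
move=> l1; split => [[x [p [pi [xp -> pix ->]]]]|[x [p [xp -> ->]]]].
  exists x, p; split => //; first exact: closure_orbit_per (has_period_per xp).
  exact: periodic_rep_kernel.
exists x, p, (cyclic_rep xp l1); split => //; last 2 first.
- exact: cyclic_repP.
- by rewrite (periodic_rep_kernel xp (cyclic_repP xp l1)).
- by rewrite closure_orbit_per //; exact: has_period_per xp.
Qed.

Lemma aperiodic_idealP (P : set A) (O : set S) : aperiodic_ideal O P <->
  exists x, [/\ aper S x, O = closure (orbit x) & P = vanishing O].
Proof.
split=> [[x [pi [xa -> pix ->]]]|[x [xa OE ->]]].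
  by exists x; split => //; exact: aperiodic_kernelE.
exists x, (orbit_rep R x); split => //; first exact: orbit_repP.
by rewrite OE (aperiodic_kernelE (orbit_repP R xa)).
Qed.

Lemma periodic_ideal_exists x p l : has_period x p -> real_norm (l : C) = 1 ->
  exists P, ideal_set P = periodic_kernel x p l.
Proof.
move=> xp l1; have := cyclic_repP xp l1 => pix; have [irr _ _ _ _] := pix.
have prim : primitive (rep_kernel (cyclic_rep xp l1)).
  by exists 'cV[R[i]]_p, (cyclic_rep xp l1).
by exists (PrimitiveIdeal prim) => /=; exact: periodic_rep_kernel.
Qed.

Lemma aperiodic_ideal_exists x : aper S x ->
  exists P, ideal_set P = vanishing (closure (orbit x)).
Proof.
move=> xa; have := orbit_repP R xa => pix; have [irr _ _ _] := pix.
have prim : primitive (rep_kernel (orbit_rep R x)).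
  by exists (ell1 C), (orbit_rep R x).
by exists (PrimitiveIdeal prim) => /=; exact: aperiodic_kernelE.
Qed.

Lemma ideals_perP P : ideals_per R S P <-> exists x p l,
  [/\ has_period x p, real_norm (l : C) = 1 & ideal_set P = periodic_kernel x p l].
Proof.
split.
  move=> [D [l [_ /unit_circleP l1 /(periodic_idealP _ _ l1)]]] [x [p [xp _ PE]]].
  by exists x, p, l.
move=> [x [p [l [xp l1 PE]]]]; exists (orbit x), l; split.
- have xper := has_period_per xp.
  by exists x => //; rewrite closure_orbit_per.
- exact/unit_circleP.
- by apply/(periodic_idealP _ _ l1); exists x, p.
Qed.

Lemma ideals_aperP P : ideals_aper R S P <->
  exists2 x, aper S x & ideal_set P = vanishing (closure (orbit x)).
Proof.
split=> [[D _ /aperiodic_idealP[x [xa -> PE]]]|[x xa PE]]; first by exists x.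
exists (closure (orbit x)); first by exists x.
by apply/aperiodic_idealP; exists x.
Qed.

Lemma vanishing_periodic_kernel x p l : has_period x p -> real_norm (l : C) = 1 ->
  vanishing (orbit x) `<=` periodic_kernel x p l.
Proof.
move=> xp l1 a a0; have pix := cyclic_repP xp l1; have [irr _ _ _ _] := pix.
rewrite -(periodic_rep_kernel xp pix l1) => v.
exact: (support_coef irr (periodic_rep_support xp pix)).
Qed.

Lemma periodic_kernel_embed x p l f : has_period x p -> real_norm (l : C) = 1 ->
  periodic_kernel x p l (embed f) <-> forall z, orbit x z -> f z = 0.
Proof.
move=> xp l1; have pix := cyclic_repP xp l1.
rewrite -(periodic_rep_kernel xp pix l1).
exact: (supportE (periodic_rep_support xp pix)).
Qed.

Lemma periodic_kernel_dl x p l : has_period x p -> real_norm (l : C) = 1 ->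
  periodic_kernel x p l (dl p - l *: one R S).
Proof.
move=> xp l1; have pix := cyclic_repP xp l1; have [irr _ _ _ _] := pix.
rewrite -(periodic_rep_kernel xp pix l1) => v.
by rewrite repBl repZl (rep1 irr) (periodic_rep_power xp pix) subrr.
Qed.

(** delta^p - l belongs to the periodic kernel, while its coefficient at p is the constant 1. *)
Lemma vanishing_neq_periodic (Y : set S) x p l : Y !=set0 -> has_period x p ->
  real_norm (l : C) = 1 -> vanishing Y <> periodic_kernel x p l.
Proof.
move=> [y Yy] xp l1 E; have := periodic_kernel_dl xp l1; rewrite -E => /(_ p y Yy).
have [p0 _ _] := xp.
have -> : (dl p - l *: one R S) p = dl p p - l *: (one R S p) by [].
have -> : dl p p = cfun_cst S (1 : C) by rewrite [LHS]singleE eqxx.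
have -> : one R S p = 0 by rewrite [LHS]singleE eqz_nat eqn0Ngt p0.
rewrite scaler0 subr0.
by move/eqP; rewrite cfun_cstE oner_eq0.
Qed.

Fact eval_ell1_l1 z a : (fun n => a n z : C) \in @l1_summable R C.
Proof. by apply: (ell1_dominated (b := a)) => n; exact: real_norm_cfun_ge. Qed.

Definition eval_ell1 z a : ell1 C := Ell1 (eval_ell1_l1 z a).

Lemma wsum_eval p l z a r : real_norm (l : C) = 1 ->
  (wsum p l a r : cfun) z = wsum p l (eval_ell1 z a) r.
Proof.
move=> l1; apply/subr0_eq.
have Ccvg : forall F : set_system C, ProperFilter F -> cauchy F -> cvg F.
  by move=> F FF; exact: complex_complete.
have Fcvg := @cfun_cvg R S.
pose T b : C := (wsum p l b r : cfun) z - wsum p l (eval_ell1 z b) r.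
apply: (@ell1_eq0 R cfun C T 2).
- move=> b c; rewrite /T (wsumD p l1 Fcvg) cfunDE.
  have -> : eval_ell1 z (b + c) = eval_ell1 z b + eval_ell1 z c by exact/ell1_eqP.
  by rewrite (wsumD p l1 Ccvg) opprD addrACA.
- move=> b; rewrite (le_trans (real_normD _ _)) // real_normN mulr_natl mulr2n.
  apply: lerD.
    by rewrite (le_trans (real_norm_cfun_ge _ _)) // (wsum_le p l1 Fcvg).
  rewrite (le_trans (wsum_le p l1 Ccvg _ _)) //.
  by apply: ell1_dominated_le => n; exact: real_norm_cfun_ge.
- move=> n f; rewrite /T wsum_single.
  have -> : eval_ell1 z (single n f) = single n (f z : C).
    by apply/ell1_eqP => m; rewrite [LHS]/(single n f m z) !singleE; case: ifP.
  by rewrite wsum_single cfunZE subrr.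
Qed.

(** Evaluation at [x] turns membership for all unimodular [l] into the hypothesis of [wsum_eq0]. *)
Lemma periodic_kernels_vanish x p a : has_period x p ->
  (forall l, real_norm (l : C) = 1 -> periodic_kernel x p l a) ->
  forall n, a n x = 0.
Proof.
move=> xp ak n; have [p0 _ _] := xp.
have : eval_ell1 x a = 0.
  apply: (wsum_eq0 p0) => l r l1 rp.
  by rewrite -wsum_eval //; apply: ak => //; exact: orbit_self.
by move=> /(congr1 (fun xi => ell1_fun xi n)).
Qed.

Lemma primitive_support P : exists (E : lmodType R[i]) (pi : representation S E) (Y : set S),
  [/\ algebraically_irreducible pi, ideal_set P = rep_kernel pi & is_rep_support pi Y].
Proof.
have [E [pi [irr PE]]] := ideal_primitive P.
by exists E, pi, (rep_support pi); split => //; exact: rep_supportP.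
Qed.

Lemma orbit_support_kernel (E : lmodType R[i]) (pi : representation S E) x p :
  algebraically_irreducible pi -> has_period x p -> is_rep_support pi (orbit x) ->
  ~ infinite_dimensional E /\
  exists2 l, real_norm (l : C) = 1 & rep_kernel pi = periodic_kernel x p l.
Proof.
move=> irr xp YP.
have [l l1 lP] := exists_eigenvalue irr (rep_dl_central irr xp YP).
split; first exact: (periodic_finite_dimensional irr xp YP l1 lP).
by exists l => //; exact: (periodic_kernelE irr xp YP l1 lP).
Qed.

(** A point of [Y] off the closure would have a neighbourhood in [Y] made of periodic points; [Y]
    would be a finite orbit and [E] finite dimensional. *)
Lemma infinite_dimensional_support (E : lmodType R[i]) (pi : representation S E) (Y : set S) :
  algebraically_irreducible pi -> is_rep_support pi Y -> infinite_dimensional E ->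
  Y `<=` closure (aper S).
Proof.
move=> irr YP inf y Yy; apply: contrapT => ny.
have [||z nz Yz|x [p [xp YE]]] := support_finite irr YP (V := ~` closure (aper S)).
- exact/closed_openC/closed_closure.
- by exists y.
- have [//|za] := per_aper z; case: nz; exact: subset_closure.
- by rewrite YE in YP; have [] := orbit_support_kernel irr xp YP.
Qed.

Lemma infinite_dimensional_aper (E : lmodType R[i]) (pi : representation S E) :
  algebraically_irreducible pi -> infinite_dimensional E -> aper S !=set0.
Proof.
move=> irr inf; have YP := rep_supportP irr.
have [y Yy] := support_nonempty irr YP.
have /(_ setT) [|x [xa _]] := infinite_dimensional_support irr YP inf Yy.
  exact: filterT.
by exists x.
Qed.

Lemma closure_sub_zero (D : set S) f :
  (forall x, D x -> f x = 0) -> forall x, closure D x -> f x = 0.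
Proof.
move=> f0 x xD.
have fc : closed [set z : S | (f : S -> C) z = 0].
  apply: (@closed_comp _ C f [set 0]).
    by move=> y _; exact: (@cts_fun _ _ f).
  exact: (accessible_closed_set1 (hausdorff_accessible (@norm_hausdorff _ _))).
by apply: fc; apply: closure_subset xD.
Qed.

Lemma ideals_per_vanish a : (forall P, ideals_per R S P -> ideal_set P a) <->
  (forall n x, per S x -> a n x = 0).
Proof.
split=> [Ha n x xper|a0 P /ideals_perP[x [p [l [xp l1 ->]]]]].
  have [p xp] := per_has_period xper; apply: (periodic_kernels_vanish xp) => l l1.
  have [P PE] := periodic_ideal_exists xp l1.
  by rewrite -PE; apply: Ha; apply/ideals_perP; exists x, p, l.
apply: vanishing_periodic_kernel => // n _ [m _ <-]; apply: a0.
exact: (per_act m (has_period_per xp)).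
Qed.

Lemma ideals_aper_vanish a : (forall P, ideals_aper R S P -> ideal_set P a) <->
  (forall n x, aper S x -> a n x = 0).
Proof.
split=> [Ha n x xa|a0 P /ideals_aperP[x xa ->] n z xz].
  have [P PE] := aperiodic_ideal_exists xa.
  have : ideal_set P a by apply: Ha; apply/ideals_aperP; exists x.
  by rewrite PE; apply; apply: subset_closure; exact: orbit_self.
have oa : orbit x `<=` aper S.
  move=> _ [m _ <-]; have [mp|//] := per_aper (act m x).
  by case: xa; rewrite /per /= orbit_act in mp.
by apply: closure_sub_zero xz => y /oa; exact: a0.
Qed.

Lemma ideals_X_separate a : (forall P, ideals_X R S P -> ideal_set P a) <-> a = 0.
Proof.
split=> [Ha|-> P _]; last by have [] := primitive_ideal_left P.
apply/ell1_eqP => n; apply/cfunP => x; rewrite cfun0E; have [xp|xa] := per_aper x.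
  by apply: ((ideals_per_vanish a).1 _ n x xp) => P PP; apply: Ha; left.
by apply: ((ideals_aper_vanish a).1 _ n x xa) => P PP; apply: Ha; right.
Qed.

Lemma closed_primitiveP P : closed [set P] <->
  forall Q, ideal_set P `<=` ideal_set Q -> Q = P.
Proof.
have clP Q : closure [set P] Q <-> ideal_set P `<=` ideal_set Q.
  rewrite closure_hull_kernel; split=> PQ a Pa; apply: PQ; last exact: Pa.
  by move=> _ ->.
split=> [/closure_id cP Q /clP|PQ]; first by rewrite -cP.
by apply/closure_id/seteqP; split => Q => [-> |/clP/PQ ->//]; exact: subset_closure.
Qed.

(** The ideals of orbits already intersect in 0, so a set of primitive ideals is dense exactly when
    its intersection is 0. *)
Lemma dense_idealsP (F : set primitive_ideal) :
  dense F <-> forall a, (forall P, F P -> ideal_set P a) -> a = 0.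
Proof.
rewrite dense_closureP closure_hull_kernel; split=> [dF a Fa|Fa].
  apply/ideals_X_separate => P _.
  have : hull_kernel_closure F P by rewrite dF.
  by apply.
apply/seteqP; split => // P _ a /Fa ->; by have [] := primitive_ideal_left P.
Qed.

Lemma dense_vanishP (D : set S) :
  dense D <-> forall f, (forall x, D x -> f x = 0) -> f = 0.
Proof.
rewrite dense_closureP; split=> [dD f f0|fD].
  apply/cfunP => x; have : closure D x by rewrite dD.
  exact: (closure_sub_zero f0).
apply/seteqP; split => // x _.
have := @closed_subP setT (closure D) (@closed_closure _ D).
apply => // f f0 y _; rewrite (fD f) // => z Dz; apply: f0; exact: subset_closure.
Qed.

Lemma dense_ideals_iff (F : set primitive_ideal) (D : set S) :
  (forall a, (forall P, F P -> ideal_set P a) <-> forall n x, D x -> a n x = 0) ->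
  dense F <-> dense D.
Proof.
move=> FD; rewrite dense_idealsP dense_vanishP; split=> [Fa f f0|Df a /FD a0].
  have : embed f = 0 by apply/Fa/FD/vanishing_embed.
  by move=> /(congr1 (fun a => ell1_fun a 0)); rewrite embedE eqxx.
by apply/ell1_eqP => n; apply: Df => x; exact: a0.
Qed.

End IdealsOfOrbits.

(** * Density, closed points and the metrizable case *)

Section MainTheorem.
Variables (R : realType) (S : dynamical_system).
Local Notation C := (R[i]%type)^o.
Local Notation A := (ell1_dyn R S).
Local Notation primitive_ideal := (primitive_ideal R S).
Implicit Types (x y z : S) (p : nat) (l : R[i]) (a : A) (P Q : primitive_ideal).

Lemma ideals_X_dense : dense (ideals_X R S).
Proof. by apply/dense_idealsP => a /ideals_X_separate. Qed.

Lemma ideals_per_dense : dense (ideals_per R S) <-> dense (per S).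
Proof. exact/dense_ideals_iff/ideals_per_vanish. Qed.

Lemma ideals_aper_dense : dense (ideals_aper R S) <-> dense (aper S).
Proof. exact/dense_ideals_iff/ideals_aper_vanish. Qed.

Lemma ideals_aper_infty : ideals_aper R S `<=` ideals_infty R S.
Proof.
move=> P [D _ [x [pi [xa _ pix PE]]]]; have [irr _ _ _] := pix.
exists (ell1 C), pi; split => //.
apply: (aper_infinite_dimensional irr (aperiodic_rep_support pix)) xa.
by apply: subset_closure; exact: orbit_self.
Qed.

Lemma ideals_infty_dense : dense (ideals_infty R S) <-> dense (aper S).
Proof.
split=> [|/ideals_aper_dense]; last first.
  move=> /dense_idealsP da; apply/dense_idealsP => a a0; apply: da => P /ideals_aper_infty.
  exact: a0.
move=> /dense_idealsP di; apply/(dense_vanishP R) => f f0.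
suff : embed f = 0.
  by move=> /(congr1 (fun a => ell1_fun a 0)); rewrite embedE eqxx.
apply: di => P [E [pi [inf irr ->]]].
have YP := rep_supportP irr; apply/(supportE YP) => x Yx.
exact: closure_sub_zero (infinite_dimensional_support irr YP inf Yx).
Qed.

(** The support depends only on the kernel, so a kernel attached to a finite orbit cannot come from
    an infinite dimensional representation; conversely, finite dimension forces a finite orbit. *)
Lemma ideals_inftyT : ideals_infty R S = setT <-> aper S = setT.
Proof.
split=> [iT|aT].
  apply/seteqP; split => // x _; have [xper|//] := per_aper x.
  have [p xp] := per_has_period xper.
  have l1 : real_norm (1 : C) = 1 := real_norm1 R.
  have [P PE] := periodic_ideal_exists xp l1.
  have : ideals_infty R S P by rewrite iT.
  move=> [E [pi [inf irr PE']]].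
  suff YP : is_rep_support pi (orbit x) by have [] := orbit_support_kernel irr xp YP.
  split; first exact: orbit_closed.
  apply/seteqP; split => f /= fk.
    by apply/(periodic_kernel_embed f xp l1); rewrite -PE PE'.
  by move: fk => /(periodic_kernel_embed f xp l1); rewrite -PE PE'.
apply/seteqP; split => // P _.
have [E [pi [Y [irr PE YP]]]] := primitive_support P.
exists E, pi; split => //; apply: contrapT => ninf.
have [x [p [xp _]]] := support_finite_dimensional irr YP ninf.
have : aper S x by rewrite aT.
by apply; exact: has_period_per xp.
Qed.

(** For an ideal Q above P the support is invariant and inside the orbit, hence equal to it; and
    delta^p - l, being in P, forces the same eigenvalue for Q. *)
Lemma periodic_ideal_closed x p l P : has_period x p -> real_norm (l : C) = 1 ->
  ideal_set P = periodic_kernel x p l -> closed [set P].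
Proof.
move=> xp l1 PE; apply/closed_primitiveP => Q PQ.
have [E [pi [Y [irr QE YP]]]] := primitive_support Q.
have Yx : Y `<=` orbit x.
  apply: (@closed_subP R); first exact: orbit_closed (has_period_per xp).
  move=> f /(periodic_kernel_embed f xp l1); rewrite -PE => /PQ.
  by rewrite QE => /(supportE YP).
have YE : Y = orbit x.
  apply/seteqP; split => // z; have [y Yy] := support_nonempty irr YP.
  have [n _ yn] := Yx y Yy; rewrite -(orbit_act n) yn => -[m _ <-].
  exact: (support_act YP).
rewrite YE in YP; apply: primitive_ideal_inj; rewrite QE PE.
apply: (periodic_kernelE irr xp YP l1) => v.
have := periodic_kernel_dl xp l1; rewrite -PE => /PQ; rewrite QE => /(_ v).
by rewrite repBl repZl (rep1 irr) => /eqP; rewrite subr_eq0 => /eqP.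
Qed.

(** Within [ideals_X], ideals above [P] belong to orbits inside the closure of the orbit of [x].
    Smaller closures may come from periodic points, so both kinds of ideals are compared with
    [P]. *)
Lemma aperiodic_ideal_closed x P : aper S x ->
  ideal_set P = vanishing (closure (orbit x)) ->
  closed ([set P] : set (subspace (ideals_X R S))) <->
  minimal_orbit_closure (closure (orbit x)).
Proof.
move=> xa PE.
have PX : ideals_X R S P by right; apply/ideals_aperP; exists x.
have ne y : closure (orbit y) !=set0.
  by exists y; apply: subset_closure; exact: orbit_self.
have one1 : real_norm (1 : C) = 1 := real_norm1 R.
rewrite closed_subspaceP; split=> [[V Vcl VP]|[_ xmin]].
  have above Q : ideals_X R S Q -> ideal_set P `<=` ideal_set Q -> Q = P.
    move=> QX PQ; suff : (V `&` ideals_X R S) Q by rewrite VP => -[].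
    split => //; have : closure V Q; last by rewrite -(closure_id V).1.
    apply: (@closure_subset _ [set P]).
      have : (V `&` ideals_X R S) P by rewrite VP.
      by move=> [? _] _ ->.
    by rewrite closure_hull_kernel => a; move=> /(_ P erefl)/PQ.
  split; first by exists x.
  move=> _ [y _ <-] yx; have [yper|ya] := per_aper y.
    have [p yp] := per_has_period yper.
    have [Q QE] := periodic_ideal_exists yp one1.
    (* A periodic orbit in the closure would put its ideal at l = 1 above [P], hence equal to
       [P]. *)
    exfalso; apply: (vanishing_neq_periodic (ne x) yp one1).
    rewrite -PE -QE; congr ideal_set; apply/esym/above.
      by left; apply/ideals_perP; exists y, p, 1.
    rewrite PE QE; apply: subset_trans (vanishing_periodic_kernel yp one1).
    by apply: vanishingS; rewrite -(closure_orbit_per yper).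
  have [Q QE] := aperiodic_ideal_exists R ya.
  apply/seteqP; split => //; apply: (@closed_subP R); first exact: closed_closure.
  move=> f /vanishing_embed; rewrite -QE (above Q) ?PE; first by move/vanishing_embed.
    by right; apply/ideals_aperP; exists y.
  by rewrite QE; exact: vanishingS.
exists (closure [set P]); first exact: closed_closure.
apply/seteqP; split => Q; last by move=> [-> _]; split => //; exact: subset_closure.
rewrite closure_hull_kernel => -[PQ QX]; split => //.
have {}PQ : ideal_set P `<=` ideal_set Q by move=> a Pa; apply: PQ => _ ->.
have min y : (forall f, ideal_set Q (embed f) -> forall z, closure (orbit y) z -> f z = 0) ->
    closure (orbit y) = closure (orbit x).
  move=> Qy; apply: xmin; first by exists y.
  apply: (@closed_subP R); first exact: closed_closure.
  by move=> f /vanishing_embed; rewrite -PE => /PQ; exact: Qy.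
case: QX => [/ideals_perP[y [p [l [yp l1 QE]]]]|/ideals_aperP[y ya QE]].
  have yper := has_period_per yp.
  have yx : closure (orbit y) = closure (orbit x).
    apply: min => f; rewrite QE => /(periodic_kernel_embed f yp l1).
    by rewrite closure_orbit_per.
  have [n _ nx] : orbit y x.
    by rewrite -(closure_orbit_per yper) yx; apply: subset_closure; exact: orbit_self.
  by case: xa; rewrite -nx; exact: (per_act n yper).
apply: primitive_ideal_inj; rewrite QE PE; congr vanishing; apply: min => f.
by rewrite QE => /vanishing_embed.
Qed.

Lemma per_supports_metrizable : per S = setT -> supports_metrizable R S.
Proof.
move=> pT E pi inf irr; have [x] := infinite_dimensional_aper irr inf.
by case; rewrite -[finite_set _]/(per S x) pT.
Qed.

(** When the support is the closure of an aperiodic orbit, [support_aper] gives vanishing of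
    coefficients at each orbit point, and continuity extends it to the closure. *)
Lemma ideals_XT : supports_metrizable R S -> ideals_X R S = setT.
Proof.
move=> met; apply/seteqP; split => // P _.
have [E [pi [irr PE]]] := ideal_primitive P; have YP := rep_supportP irr.
have orb x p : has_period x p -> rep_support pi = orbit x -> ideals_X R S P.
  move=> xp YE; rewrite YE in YP; left; apply/ideals_perP.
  have [_ [l l1 KE]] := orbit_support_kernel irr xp YP.
  by exists x, p, l; split => //; rewrite PE.
have [inf|/(support_finite_dimensional irr YP)] := pselect (infinite_dimensional E); last first.
  by move=> [x [p [xp YE]]]; exact: (orb x p).
have [x Yx YE] := support_dense_orbit irr YP (met E pi inf irr).
have [xper|xa] := per_aper x.
  have [p xp] := per_has_period xper.
  by apply: (orb x p) => //; rewrite YE closure_orbit_per.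
right; apply/ideals_aperP; exists x => //; rewrite PE; apply/seteqP; split => a ak.
  move=> n z xz; apply: (@closure_sub_zero R S (orbit x) (a n)) xz => _ [m _ <-].
  apply: (support_aper irr YP) => //; first exact: (support_act YP).
  have [mp|//] := per_aper (act m x).
  by case: xa; rewrite /per /= orbit_act in mp.
by move=> v; apply: (support_coef irr YP) => n z; rewrite YE; exact: ak.
Qed.

(** If all points are periodic there are no infinite dimensional irreducible representations, so the
    metrizability condition holds vacuously and [ideals_XT] applies. *)
Lemma ideals_perT : ideals_per R S = setT <-> per S = setT.
Proof.
split=> pT.
  apply/seteqP; split => // x _; have [//|xa] := per_aper x.
  have [P PE] := aperiodic_ideal_exists R xa.
  have : ideals_per R S P by rewrite pT.
  move=> /ideals_perP[y [p [l [yp l1]]]]; rewrite PE => /vanishing_neq_periodic.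
  case => //; exists x; apply: subset_closure; exact: orbit_self.
apply/seteqP; split => // P _.
have : ideals_X R S P by rewrite ideals_XT //; exact: per_supports_metrizable.
case=> // /ideals_aperP[x []]; by rewrite -[finite_set _]/(per S x) pT.
Qed.

Lemma periodic_minimal x : per S x -> minimal_orbit_closure (orbit x).
Proof.
move=> xper; split; first by exists x => //; exact: closure_orbit_per.
move=> _ [y _ <-] yx; have [n _ ny] : orbit x y.
  by apply: yx; apply: subset_closure; exact: orbit_self.
by rewrite -ny closure_orbit_per ?orbit_act //; exact: per_act.
Qed.

Lemma closed_iff_minimal P : supports_metrizable R S ->
  closed [set P] <-> exists2 O, minimal_orbit_closure O & associated P O.
Proof.
move=> met; have XT := ideals_XT met.
have sub : closed [set P] <-> closed ([set P] : set (subspace (ideals_X R S))).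
  rewrite closed_subspaceP XT; split => [cP|[V Vcl]]; first by exists [set P].
  by rewrite !setIT => <-.
split=> [cP|[D Dmin [[l /unit_circleP l1]|]]].
- have : ideals_X R S P by rewrite XT.
  case=> [/ideals_perP[x [p [l [xp l1 PE]]]]|/ideals_aperP[x xa PE]].
    exists (orbit x); first exact: periodic_minimal (has_period_per xp).
    left; exists l; first exact/unit_circleP.
    by apply/(periodic_idealP _ _ l1); exists x, p.
  exists (closure (orbit x)); first by apply/(aperiodic_ideal_closed xa PE)/sub.
  by right; apply/aperiodic_idealP; exists x.
- move=> /(periodic_idealP _ _ l1)[x [p [xp _ PE]]].
  exact: (periodic_ideal_closed xp l1 PE).
- move=> /aperiodic_idealP[x [xa DE PE]]; rewrite DE in Dmin PE.
  by apply/sub/(aperiodic_ideal_closed xa PE).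
Qed.

End MainTheorem.

Theorem theorem5p1 (R : realType) (S : dynamical_system) :
  (* (1) *)
  compact [set: primitive_ideal R S] /\
  (* (2) *)
  dense (ideals_X R S) /\
  (* (3) *)
  (ideals_per R S = [set: primitive_ideal R S] <-> per S = [set: S]) /\
  (* (4) *)
  (dense (ideals_per R S) <-> dense (per S)) /\
  (* (5) *)
  (ideals_infty R S = [set: primitive_ideal R S] <-> aper S = [set: S]) /\
  (* (6) *)
  ((dense (ideals_aper R S) <-> dense (ideals_infty R S)) /\
   (dense (ideals_infty R S) <-> dense (aper S))) /\
  (* (7) *)
  ((forall (O : set S) (l : R[i]) (P : primitive_ideal R S),
      orbit_closures (per S) O -> `|l| = 1 -> periodic_ideal O l P ->
      closed [set P]) /\
   (forall (O : set S) (P : primitive_ideal R S),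
      orbit_closures (aper S) O -> aperiodic_ideal O P ->
      (closed ([set P] : set (subspace (ideals_X R S))) <->
       minimal_orbit_closure O))) /\
  (* (8) *)
  ((metrizable R [set: S] \/ per S = [set: S] -> supports_metrizable R S) /\
   (supports_metrizable R S ->
     (ideals_X R S = [set: primitive_ideal R S] /\ compact (ideals_X R S)) /\
     (forall P : primitive_ideal R S,
        closed [set P] <->
        exists2 O, minimal_orbit_closure O & associated P O))).

Proof.
split; first exact: primitive_ideals_compact.
split; first exact: ideals_X_dense.
split; first exact: ideals_perT.
split; first exact: ideals_per_dense.
split; first exact: ideals_inftyT.
split; first by split; rewrite ideals_infty_dense // ideals_aper_dense.
split; first split.
- move=> D l P _ /unit_circleP l1 /(periodic_idealP _ _ l1)[x [p [xp _ PE]]].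
  exact: (periodic_ideal_closed xp l1 PE).
- move=> D P _ /aperiodic_idealP[x [xa DE PE]]; rewrite DE in PE *.
  exact: (aperiodic_ideal_closed xa PE).
split.
  case=> [mS E pi _ _|pT]; first exact: metrizable_sub.
  exact: per_supports_metrizable.
move=> met; split; last by move=> P; exact: closed_iff_minimal.
by rewrite ideals_XT //; split => //; exact: primitive_ideals_compact.
Qed.
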